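(* Let $\pi\in\mathcal{P}(\mathbb{R}^d)$ be log-concave, i.e. $\pi(\mathrm{d}x)=e^{-V(x)}\mathrm{d}x$ for some convex $V\in C^2(\mathbb{R}^d)$, let $\mu_0\in\mathcal{P}(\mathbb{R}^d)$ be arbitrary, and let $h>0$. Consider the Proximal Sampler with target $\pi$, initialization $\mu_0$ and step size $h$, with (discrete) mixing times $\mathrm{t}_{\mathrm{mix}}(\mu_0,\cdot)$ and mixing window $\mathrm{w}_{\mathrm{mix}}(\mu_0,\cdot)$. Then for every $\varepsilon\in(0,\tfrac12)$, $$\mathrm{w}_{\mathrm{mix}}(\mu_0,\varepsilon)\ \le\ \frac{6}{\varepsilon}\left(\widehat{C}_{\mathrm P}(\pi)+\sqrt{\widehat{C}_{\mathrm P}(\pi)\,\widehat{C}_{\mathrm P}(\mu_0)}+\sqrt{\widehat{C}_{\mathrm P}(\pi)\,\mathrm{t}_{\mathrm{mix}}(\mu_0,1-\varepsilon)}\right).$$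
   Context: $\mathcal{P}(\mathbb{R}^d)$ is the set of Borel probability measures on $\mathbb{R}^d$. The Proximal Sampler with target $\pi(\mathrm{d}x)=e^{-V(x)}\mathrm{d}x$, initialization $\mu_0$ and step size $h>0$ is the random sequence $X_0,Y_0,X_1,Y_1,\ldots$ of $\mathbb{R}^d$-valued random variables produced by sampling $X_0\sim\mu_0$ and then, inductively for each $k\ge0$: (1) Forward step: conditionally on $(X_0,Y_0,\ldots,X_{k-1},Y_{k-1},X_k)$, $Y_k$ is Gaussian with mean $X_k$ and covariance matrix $hI_d$. (2) Backward step: conditionally on $(X_0,Y_0,\ldots,X_k,Y_k)$, $X_{k+1}$ has density (in $x$, w.r.t. Lebesgue measure) proportional to $\exp\left(-V(x)-\frac{|x-Y_k|^2}{2h}\right)$. Write $\mu_k=\mathrm{law}(X_k)$ for $k\in\mathbb{N}=\{0,1,2,\ldots\}$. Total variation: $\mathrm{TV}(\mu,\pi)=\sup_{A\in\mathcal{B}(\mathbb{R}^d)}|\mu(A)-\pi(A)|$. Mixing time: for $\varepsilon\in(0,1)$, $\mathrm{t}_{\mathrm{mix}}(\mu_0,\varepsilon)=\min\{k\in\mathbb{N}:\mathrm{TV}(\mu_k,\pi)\le\varepsilon\}$. Width of the mixing window: for $\varepsilon\in(0,\frac12)$, $\mathrm{w}_{\mathrm{mix}}(\mu_0,\varepsilon)=\mathrm{t}_{\mathrm{mix}}(\mu_0,\varepsilon)-\mathrm{t}_{\mathrm{mix}}(\mu_0,1-\varepsilon)$. Poincaré constant: for $\mu\in\mathcal{P}(\mathbb{R}^d)$,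 $C_{\mathrm P}(\mu)\in[0,\infty]$ is the smallest number such that $\mathrm{Var}_\mu(f)\le C_{\mathrm P}(\mu)\int|\nabla f|^2\,\mathrm{d}\mu$ for all smooth $f:\mathbb{R}^d\to\mathbb{R}$ (equal to $+\infty$ if there is no such finite number). Moreover $\widehat{C}_{\mathrm P}(\mu)=1+\frac{C_{\mathrm P}(\mu)}{h}$. *)

(* Defs.v *)
From HB Require Import structures.
From mathcomp Require Import all_boot all_order all_algebra.
From mathcomp Require Import all_classical all_reals all_analysis.
From mathcomp Require Import measurable_realfun.

Set Implicit Arguments.
Unset Strict Implicit.
Unset Printing Implicit Defensive.
Import Order.TTheory GRing.Theory Num.Theory.
Import numFieldNormedType.Exports.

Local Open Scope classical_set_scope.
Local Open Scope ring_scope.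

(* The Borel sigma-algebra; R^d is rendered by 'rV[R]_d. *)
HB.instance Definition _ (R : realType) (m n : nat) :=
  Measurable.copy 'M[R]_(m, n) (g_sigma_algebraType (@open 'M[R]_(m, n))).

Section borel_rV.
Context {R : realType}.

Lemma measurable_coord_rV (n : nat) (i : 'I_n) :
  measurable_fun [set: 'rV[R]_n] (fun x : 'rV[R]_n => x ord0 i).
Proof.
apply: (measurability _ (RGenOInfty.measurableE R)) => _ [_ [a ->] <-].
rewrite setTI; apply: sub_sigma_algebra.
apply: open_comp; last exact: interval_open.
by move=> x _; exact: coord_continuous.
Qed.

Lemma measurable_fun_rV d (T : measurableType d) (n : nat) (f : T -> 'rV[R]_n) :
  (forall i, measurable_fun setT (fun t => f t ord0 i)) ->
  measurable_fun setT f.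
Proof.
move=> mf; apply: (@measurability _ _ _ _ _ _ (@open 'rV[R]_n)) => //.
move=> _ [U oU <-]; rewrite setTI.
pose q (p : 'rV[rat]_n * nat) : 'rV[R]_n := map_mx ratr p.1.
pose B p : set 'rV[R]_n := ball (q p) (p.2.+1%:R^-1).
have -> : f @^-1` U = \bigcup_p (f @^-1` B p `&` [set _ | B p `<=` U]).
  apply/seteqP; split => [t /= Ut|t [p _ [Bp /= pU]]]; last exact: pU.
  have /nbhs_ballP[e /= e0 eU] : nbhs (f t) U by exact: open_nbhs_nbhs.
  have [k] : exists k : nat, (0 + k.+1%:R^-1 : R) < e / 2.
    by apply: ltr_add_invr; rewrite divr_gt0.
  rewrite add0r => ke; set r := k.+1%:R^-1 in ke.
  have r0 : 0 < r by rewrite invr_gt0.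
  have /choice[v vP] : forall i, exists v : rat, ball (f t ord0 i) r (ratr v).
    move=> i; have : f t ord0 i - r < f t ord0 i + r.
      by rewrite ltrBlDr -addrA ltrDl addr_gt0.
    move=> /rat_in_itvoo[v]; rewrite in_itv/= => /andP[v1 v2].
    by exists v; rewrite /ball/= ltr_distlC v1 v2.
  have tB : ball (f t) r (q (\row_i v i, k)).
    by split => // i j; rewrite ord1 !mxE; exact: vP.
  exists (\row_i v i, k) => //; split => /=; first exact: ball_sym.
  move=> x Bx; apply: eU; rewrite (splitr e).
  apply: (@ball_triangle _ _ (q (\row_i v i, k))).
    apply: le_ball tB; exact: ltW.
  by apply: le_ball Bx; exact: ltW.
apply: countable_bigcupT_measurable => [|p]; first exact: countableP.
apply: measurableI; last first.
  case: (pselect (B p `<=` U)) => BU.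
    by have -> : [set _ : T | B p `<=` U] = setT by apply: funext => t; exact/propext.
  by have -> : [set _ : T | B p `<=` U] = set0 by apply: funext => t; exact/propext.
rewrite (_ : _ @^-1` _ = \big[setI/setT]_(i < n)
    ((fun t => f t ord0 i) @^-1` ball (q p ord0 i) (p.2.+1%:R^-1))).
  apply: bigsetI_measurable => i _; rewrite -[X in measurable X]setTI.
  by apply: mf => //; exact: measurable_ball.
rewrite -bigcap_seq; apply/seteqP; split => [t [_ h] i _|t h] /=; first exact: h.
by split => [|i j]; rewrite ?invr_gt0// ord1; apply: h; rewrite /= mem_index_enum.
Qed.

End borel_rV.

Section lebesgue_rV.
Context {R : realType}.

Definition cons_rV n (p : measurableTypeR R * 'rV[R]_n) : 'rV[R]_n.+1 :=
  row_mx (p.1 : R)%:M p.2.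

Let uncons_rV n (x : 'rV[R]_n.+1) : measurableTypeR R * 'rV[R]_n :=
  (x ord0 ord0, @rsubmx R 1 1 n x).

Let cons_rV0 n p : @cons_rV n p ord0 ord0 = p.1.
Proof.
by rewrite mxE; case: splitP => j; rewrite // ord1 mxE eqxx.
Qed.

Let cons_rV_lift n p i : @cons_rV n p ord0 (lift ord0 i) = p.2 ord0 i.
Proof.
rewrite mxE; case: splitP => j /=; first by rewrite ord1.
by rewrite /bump/= => -[/val_inj->].
Qed.

Let cons_rVK n : cancel (@cons_rV n) (@uncons_rV n).
Proof.
move=> [a v]; rewrite /uncons_rV cons_rV0; congr pair.
by rewrite /cons_rV row_mxKr.
Qed.

Let measurable_cons_rV n : measurable_fun [set: _] (@cons_rV n).
Proof.
apply: measurable_fun_rV => i; have [j ->|->] := unliftP ord0 i.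
- under eq_fun do rewrite cons_rV_lift.
  apply: (measurableT_comp (measurable_coord_rV j)).
  exact: measurable_snd.
- under eq_fun do rewrite cons_rV0.
  exact: measurable_fst.
Qed.

Let measurable_uncons_rV n : measurable_fun [set: _] (@uncons_rV n).
Proof.
apply/measurable_fun_pair => /=; first exact: measurable_coord_rV.
apply: measurable_fun_rV => i; under eq_fun do rewrite mxE.
exact: measurable_coord_rV.
Qed.

Section step.
Local Open Scope ereal_scope.
Context {n : nat} (m : {sigma_finite_measure set 'rV[R]_n -> \bar R}).

Definition lebesgue_rV_step : set 'rV[R]_n.+1 -> \bar R :=
  pushforward (@lebesgue_measure R \x m) (@cons_rV n).

Let mpre A : measurable A -> measurable (@cons_rV n @^-1` A).
Proof.
by move=> mA; rewrite -[X in measurable X]setTI; exact: measurable_cons_rV.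
Qed.

Let step0 : lebesgue_rV_step set0 = 0.
Proof. by rewrite /lebesgue_rV_step /pushforward preimage_set0 measure0. Qed.

Let step_ge0 A : 0 <= lebesgue_rV_step A.
Proof. exact: measure_ge0. Qed.

Let step_sigma_additive : semi_sigma_additive lebesgue_rV_step.
Proof.
move=> F mF tF mUF; rewrite /lebesgue_rV_step /pushforward preimage_bigcup.
apply: measure_semi_sigma_additive.
- by move=> k; exact: mpre.
- apply/trivIsetP => /= i j _ _ ij; rewrite -preimage_setI.
  by move/trivIsetP : tF => /(_ _ _ _ _ ij) ->//; rewrite preimage_set0.
- by rewrite -preimage_bigcup; exact: mpre.
Qed.

HB.instance Definition _ := isMeasure.Build _ _ _
  lebesgue_rV_step step0 step_ge0 step_sigma_additive.

Let step_sigma_finite : sigma_finite setT lebesgue_rV_step.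
Proof.
have /sigma_finiteP[F [TF ndF Foo]] := sigma_finiteT (@lebesgue_measure R).
have /sigma_finiteP[G [TG ndG Goo]] := sigma_finiteT m.
exists (fun k => @uncons_rV n @^-1` (F k `*` G k)).
  rewrite -preimage_bigcup -(_ : setT = \bigcup_k (F k `*` G k))//.
  rewrite -setXTT TF TG predeqE => -[x y]; split.
    move=> [/= [k _ Fkx] [l _ Gly]]; exists (maxn k l) => //; split.
    - by move: x Fkx; exact/subsetPset/ndF/leq_maxl.
    - by move: y Gly; exact/subsetPset/ndG/leq_maxr.
  by move=> [k _ []/= ? ?]; split; exists k.
move=> k; have [mF oF] := Foo k; have [mG oG] := Goo k; split.
  rewrite -[X in measurable X]setTI; apply: measurable_uncons_rV => //.
  exact: measurableX.
rewrite /lebesgue_rV_step /pushforward (_ : _ @^-1` _ = F k `*` G k).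
  by rewrite product_measure1E// lte_mul_pinfty// ge0_fin_numE.
rewrite -comp_preimage (_ : _ \o _ = id) ?preimage_id//.
by apply: funext => p; exact: cons_rVK.
Qed.

HB.instance Definition _ := @Measure_isSigmaFinite.Build _ _ _
  lebesgue_rV_step step_sigma_finite.

End step.

(* The n-fold product of the one-dimensional Lebesgue measure; on the
   one-point space 'rV[R]_0 it is the unit mass. *)
Fixpoint lebesgue_rV n : {sigma_finite_measure set 'rV[R]_n -> \bar R} :=
  if n is k.+1 then lebesgue_rV_step (lebesgue_rV k)
  else \d_(0 : 'rV[R]_0).

End lebesgue_rV.

Section calculus_rV.
Context {R : realType} {d : nat}.
Implicit Types (f : 'rV[R]_d -> R) (x : 'rV[R]_d).

(* The norm of the normed module 'rV[R]_d is the sup norm, whence this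
   separate definition of the squared Euclidean norm. *)
Definition sqnorm x : R := \sum_(i < d) x ord0 i ^+ 2.

Definition partial (i : 'I_d) f : 'rV[R]_d -> R := 'D_(delta_mx ord0 i) f.

Definition gradient f x : 'rV[R]_d := \row_i partial i f x.

Fixpoint Ck (n : nat) f : Prop :=
  if n is m.+1 then
    continuous f /\
    forall i : 'I_d,
      (forall x, derivable f x (delta_mx ord0 i)) /\ Ck m (partial i f)
  else continuous f.

Definition smooth f : Prop := forall n, Ck n f.

End calculus_rV.

Section distances.
Local Open Scope ereal_scope.
Context {R : realType} {d : nat}.
Implicit Types mu pi : probability 'rV[R]_d R.

(* In particular pi is a probability measure only if exp(- V) has integral 1. *)
Definition log_concave_with_potential pi (V : 'rV[R]_d -> R) : Prop :=
  [/\ convex_function (E := 'rV[R]_d) setT V,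
      Ck 2 V &
      forall A, measurable A ->
        pi A = \int[lebesgue_rV d]_(x in A) (expR (- V x))%:E].

Definition TV mu pi : \bar R :=
  ereal_sup [set `|mu A - pi A| | A in @measurable _ 'rV[R]_d].

(* variance mu f takes the value +oo when f is not square-integrable. *)
Definition poincare_inequality mu (C : R) : Prop :=
  forall f : 'rV[R]_d -> R, smooth f ->
    variance mu f <= C%:E * \int[mu]_x (sqnorm (gradient f x))%:E.

(* The infimum of the empty set is +oo. *)
Definition poincare_constant mu : \bar R :=
  ereal_inf [set C%:E | C in
    [set C : R | (0 <= C)%R /\ poincare_inequality mu C]].

Definition poincare_hat (h : R) mu : \bar R := 1 + poincare_constant mu / h%:E.

(* The infimum is attained, except that t_mix is +oo when
   eps < TV (mu_ k) pi for all k. *)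
Definition t_mix (mu_ : nat -> probability 'rV[R]_d R) pi (eps : R) : \bar R :=
  ereal_inf [set k%:R%:E | k in [set k : nat | TV (mu_ k) pi <= eps%:E]].

Definition w_mix (mu_ : nat -> probability 'rV[R]_d R) pi (eps : R) : \bar R :=
  t_mix mu_ pi eps - t_mix mu_ pi (1 - eps).

End distances.

Section conditional_law.
Local Open Scope ereal_scope.
Context {R : realType} {dT dE} {T : measurableType dT} {E : measurableType dE}.

(* K is a version of the conditional law of Y given the sigma-algebra generated
   by the collection of events G. *)
Definition conditional_law (P : probability T R) (G : set (set T))
    (Y : T -> E) (K : T -> set E -> \bar R) : Prop :=
  forall B, measurable B ->
    measurable_fun setT (K ^~ B : g_sigma_algebraType G -> \bar R) /\
    forall A, <<s G >> A -> P (A `&` Y @^-1` B) = \int[P]_(w in A) K w B.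

End conditional_law.

Section proximal_sampler.
Local Open Scope ereal_scope.
Context {R : realType} {d : nat}.
Implicit Types (h : R) (V : 'rV[R]_d -> R).

(* The Gaussian law with mean x and covariance matrix h%:M. *)
Definition gaussian h (x : 'rV[R]_d) (B : set 'rV[R]_d) : \bar R :=
  \int[lebesgue_rV d]_(y in B)
    (\prod_(i < d) normal_pdf (x ord0 i) (Num.sqrt h) (y ord0 i))%:E.

(* The law with density proportional to f. *)
Definition law_of_density (f : 'rV[R]_d -> R) (B : set 'rV[R]_d) : \bar R :=
  (\int[lebesgue_rV d]_(x in B) (f x)%:E) / (\int[lebesgue_rV d]_x (f x)%:E).

Definition backward_density h V (y x : 'rV[R]_d) : R :=
  expR (- V x - sqnorm (x - y) / (2 * h)).

Context {dT} {T : measurableType dT} (P : probability T R).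
Implicit Types X Y : nat -> {RV P >-> 'rV[R]_d}.

(* These events generate the sigma-algebra of (X_0, .., X_(m - 1)) and
   (Y_0, .., Y_(n - 1)). *)
Definition past X Y (m n : nat) : set (set T) :=
  [set A | exists i B, measurable B /\
    ((i < m)%N /\ A = X i @^-1` B \/ (i < n)%N /\ A = Y i @^-1` B)].

Definition proximal_sampler V (mu0 : probability 'rV[R]_d R) h X Y : Prop :=
  [/\ forall B, measurable B -> distribution P (X 0%N) B = mu0 B,
      forall k, conditional_law P (past X Y k.+1 k) (Y k)
        (fun w => gaussian h (X k w)) &
      forall k, conditional_law P (past X Y k.+1 k.+1) (X k.+1)
        (fun w => law_of_density (backward_density h V (Y k w)))].

End proximal_sampler.

(* Main.v *)
Require Import Defs.
From HB Require Import structures.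
From mathcomp Require Import all_boot all_order all_algebra.
From mathcomp Require Import all_classical all_reals all_analysis.
From mathcomp Require Import measurable_realfun ring lra.

(* The chain mu_k = law (X_k) is driven by P = Q S, where Q is the Gaussian kernel
   and S the backward kernel; both kernels have densities proportional to
   exp (- W u - |u - y|^2 / 2h) with W convex (W = 0 for Q, W = V for S).  The
   Prekopa-Leindler inequality gives for every such kernel a log-Harnack
   inequality, a contraction property for transport-type inequalities (whence
   1-Lipschitz functions stay 1-Lipschitz), and a variance at most h for
   1-Lipschitz functions.  Composing 2n steps,
     P^n (ln f) x <= ln (P^n f y) + |x - y|^2 / (4 n h).
   Moreover h |grad (Q g)|^2 is at most the variance of g under Q, so that the
   Poincare inequality of pi makes P^m contract variances under pi by
   (C / (C + h))^m, and that of mu0 gives Var_{mu_k} f <= 2 k h + C0 for f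
   1-Lipschitz and k >= 1.

   Let TV (mu_k, pi) <= 1 - eps, and let B be an event.  The set D where P^m 1_B
   is below pi B - eps / 2 has exponentially small pi-mass, and P^n 1_D has the
   same pi-mean; so P^n 1_D <= exp (- L) on a set A of pi-mass at least 1 - eps / 2,
   whence mu_k A >= eps / 2.  The log-Harnack inequality with y in A bounds
   L P^n 1_D x by ln 2 + dist (x, A)^2 / (4 n h), and the second moment of
   dist (., A) under mu_k is at most Var / mu_k A because it vanishes on A.
   Hence mu_{k+n} D <= eps / 2, so mu_{k+n+m} B >= pi B - eps; it remains to
   optimize over n and m. *)

Set Implicit Arguments.
Unset Strict Implicit.
Unset Printing Implicit Defensive.
Import Order.TTheory GRing.Theory Num.Theory.
Import numFieldNormedType.Exports.

Local Open Scope classical_set_scope.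
Local Open Scope ring_scope.

(** * The Prekopa-Leindler inequality *)

(** The Poincare inequalities concern smooth functions, whereas indicators, distances and their
    images under [S] need not be smooth. They are therefore applied only to functions [Q g], which
    are smooth for bounded measurable [g], and the gradient of [Q g] is paid for by the variance of
    [g] under the Gaussian law. This is why the variance bound under mu_k asks for k >= 1, and why
    the argument starts one step after the mixing time for 1 - eps. The log-Harnack inequality comes
    from tilting: shifting the centre of a Gibbs law multiplies its density by the exponential of a
    linear function, up to a constant. Jensen's inequality leaves the unknown mean of that linear
    function, which cancels because the logarithm of the normalizing constant is concave, by
    Prekopa-Leindler. With K = 1 + C / h and c the variance bound divided by h, n Harnack steps lead
    to L of order c / (n eps^2), up to lower order terms, hence to about K c / (n eps^2) contraction
    steps. Balancing this with n gives n of order sqrt (c K) / eps, whence the two square roots and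
    the factor 1 / eps. *)

Section brunn_minkowski.
Context {R : realType}.
Notation leb := (@lebesgue_measure R).
Implicit Types (A B C : set (measurableTypeR R)).

Lemma measurable_affine (a b : R) :
  measurable_fun setT (fun x : measurableTypeR R => a * x + b : measurableTypeR R).
Proof.
apply: (@measurable_funD _ (measurableTypeR R) R setT (fun x => a * x) (cst b)) => //.
exact: measurable_funM.
Qed.

(** The pushforward of [leb] by the affine map, multiplied by [a], gives every half-open interval
    its length, so it is [leb] by uniqueness. *)
Lemma lebesgue_measure_affine (a b : R) A : 0 < a -> measurable A ->
  leb ((fun x => a * x + b) @^-1` A) = (a^-1%:E * leb A)%E.
Proof.
move=> a0 mA.
pose phi (x : measurableTypeR R) : measurableTypeR R := a * x + b.
have mphi : measurable_fun setT phi by exact: measurable_affine.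
pose nu0 : {measure set (measurableTypeR R) -> \bar R} :=
  mscale (NngNum (ltW a0)) (pushforward leb phi).
have H X : ocitv X -> leb X = nu0 mphi X.
  move=> [[x y] _ <-] /=; rewrite /nu0 /mscale/= /pushforward.
  have -> : phi @^-1` `]x, y] = `](x - b) / a, (y - b) / a]%classic.
    apply/seteqP; split => z; rewrite /phi /= !in_itv /=;
      by rewrite ltr_pdivrMr// ler_pdivlMr// ltrBlDr lerBrDr mulrC.
  rewrite !lebesgue_measure_itv/= !lte_fin ltr_pM2r ?invr_gt0// ltrD2r.
  case: ifPn => _; last by rewrite mule0.
  rewrite -!EFinB -EFinM; congr EFin; field; exact: lt0r_neq0.
rewrite (lebesgue_measure_unique H mA) /nu0/= /mscale/= /pushforward.
by rewrite muleA -EFinM mulVf ?mul1e// lt0r_neq0.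
Qed.

End brunn_minkowski.

Section brunn_minkowski1.
Context {R : realType}.
Notation leb := (@lebesgue_measure R).
Implicit Types (A B C : set (measurableTypeR R)).

(** Take [a] near the supremum of [A] and [b] near the infimum of [B]. The sets (1 - l) A + l b and
    (1 - l) a + l B, called [S1] and [S2], both lie in [C], and they overlap only inside an interval
    of length [e] around [z0]. *)
Lemma brunn_minkowski1_bounded (l M : R) A B C : 0 < l -> l < 1 ->
  measurable A -> measurable B -> measurable C -> A !=set0 -> B !=set0 ->
  A `<=` `[- M, M] -> B `<=` `[- M, M] ->
  (forall a b, A a -> B b -> C ((1 - l) * a + l * b)) ->
  ((1 - l)%:E * leb A + l%:E * leb B <= leb C)%E.
Proof.
move=> l0 l1 mA mB mC A0 B0 AM BM ABC.
have l1' : 0 < 1 - l by lra.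
apply/lee_addgt0Pr => e e0.
have hA : has_sup A.
  by split => //; exists M => x /AM /=; rewrite in_itv /= => /andP[].
have hB : has_inf B.
  by split => //; exists (- M) => x /BM /=; rewrite in_itv /= => /andP[].
have [a Aa ae] := sup_adherent e0 hA.
have [b Bb be] := inf_adherent e0 hB.
have supA x : A x -> x < a + e.
  by move=> Ax; rewrite -ltrBlDr in ae *; have := ub_le_sup hA.2 Ax; lra.
have infB y : B y -> b - e < y.
  by move=> By; have := ge_inf hB.2 By; lra.
pose phi1 (z : R) := (1 - l)^-1 * z + (- (l * b) / (1 - l)).
pose phi2 (z : R) := l^-1 * z + (- ((1 - l) * a) / l).
pose S1 : set (measurableTypeR R) := phi1 @^-1` A.
pose S2 : set (measurableTypeR R) := phi2 @^-1` B.
have S1E : leb S1 = ((1 - l)%:E * leb A)%E.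
  by rewrite /S1 lebesgue_measure_affine// ?invr_gt0// invrK.
have S2E : leb S2 = (l%:E * leb B)%E.
  by rewrite /S2 lebesgue_measure_affine// ?invr_gt0// invrK.
have mS1 : measurable S1.
  by rewrite -[S1]setTI; apply: measurable_affine.
have mS2 : measurable S2.
  by rewrite -[S2]setTI; apply: measurable_affine.
have lphi1 z : z = (1 - l) * phi1 z + l * b.
  by rewrite /phi1; field; exact: lt0r_neq0.
have lphi2 z : z = (1 - l) * a + l * phi2 z.
  by rewrite /phi2; field; exact: lt0r_neq0.
have S1C : S1 `<=` C by move=> z /= Sz; rewrite (lphi1 z); exact: ABC.
have S2C : S2 `<=` C by move=> z /= Sz; rewrite (lphi2 z); exact: ABC.
pose z0 := (1 - l) * a + l * b.
pose I : set (measurableTypeR R) := `[z0 - l * e, z0 + (1 - l) * e]%classic.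
have mI : measurable I by exact: measurable_itv.
have lebI : leb I = e%:E.
  rewrite /I lebesgue_measure_itv/= lte_fin ifT.
    by rewrite -EFinB; congr EFin; ring.
  by rewrite -subr_gt0 (_ : _ - _ = e)//; ring.
have disj : S1 `&` (S2 `\` I) = set0.
  apply/seteqP; split => // z [/= S1z [S2z nI]]; apply: nI.
  rewrite /I /= in_itv/=; apply/andP; split.
    have := infB _ S2z; rewrite {2}(lphi2 z) /z0; nra.
  have := supA _ S1z; rewrite {2}(lphi1 z) /z0; nra.
have le1 : (leb S1 + leb (S2 `\` I) <= leb C)%E.
  rewrite -measureU//; last exact: measurableD.
  apply: le_measure; rewrite ?inE//.
    by apply: measurableU => //; exact: measurableD.
  by rewrite subUset; split => // z [/S2C].
have le2 : (leb S2 <= leb (S2 `\` I) + e%:E)%E.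
  rewrite -lebI; apply: le_trans (measureU2 _ _ _) => //.
    apply: le_measure; rewrite ?inE//.
      by apply: measurableU => //; exact: measurableD.
    by move=> z S2z; have [Iz|nIz] := pselect (I z); [right|left].
  exact: measurableD.
rewrite -S1E -S2E; apply: le_trans (leeD2r e%:E le1).
by rewrite -addeA leeD2l.
Qed.

Lemma brunn_minkowski1 (l : R) A B C : 0 < l -> l < 1 ->
  measurable A -> measurable B -> measurable C -> A !=set0 -> B !=set0 ->
  (forall a b, A a -> B b -> C ((1 - l) * a + l * b)) ->
  ((1 - l)%:E * leb A + l%:E * leb B <= leb C)%E.
Proof.
move=> l0 l1 mA mB mC [a Aa] [b Bb] ABC.
pose T D (n : nat) : set (measurableTypeR R) := D `&` `[- n%:R, n%:R]%classic.
have mT D n : measurable D -> measurable (T D n).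
  by move=> mD; apply: measurableI => //; exact: measurable_itv.
have cT D : measurable D -> (leb (T D n) @[n --> \oo] --> leb D)%E.
  move=> mD; rewrite [X in _ --> leb X](_ : D = \bigcup_n T D n).
    apply: nondecreasing_cvg_mu => //.
    - by move=> n; exact: mT.
    - by apply: bigcupT_measurable => n; exact: mT.
    - move=> n m nm; apply/subsetPset => x [Dx /=]; rewrite in_itv /= => /andP[? ?].
      split => //=; rewrite in_itv/=; apply/andP; split.
        by apply: le_trans; last eassumption; rewrite lerN2 ler_nat.
      by apply: le_trans; first eassumption; rewrite ler_nat.
  apply/seteqP; split => [x Dx|x [n _ [] //]].
  exists (Num.trunc `|x|).+1 => //; split => //=.
  by rewrite in_itv/= -ler_norml ltW// truncnS_gt.
apply: (@cvge_le _ \oo _ _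
    (fun n => (1 - l)%:E * leb (T A n) + l%:E * leb (T B n))%E); last first.
  apply: cvgeD; [|by apply: cvgeZl => //; exact: cT..].
  by apply: ge0_adde_def; rewrite inE mule_ge0// ?lee_fin//; lra.
near=> n.
have nab : `|a| <= n%:R /\ `|b| <= n%:R.
  split; near: n.
    exact: nbhs_infty_ger.
  exact: nbhs_infty_ger.
apply: (@brunn_minkowski1_bounded _ n%:R) => //; try exact: mT.
- by exists a; split => //=; rewrite in_itv/= -ler_norml; case: nab.
- by exists b; split => //=; rewrite in_itv/= -ler_norml; case: nab.
- by move=> x [].
- by move=> x [].
- by move=> x y [Ax _] [By _]; exact: ABC.
Unshelve. all: by end_near. Qed.

End brunn_minkowski1.

Section weighted_amgm.
Context {R : realType}.

(** Concavity of [ln]: both logarithms lie below the tangent at the weighted mean [m], and the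
    linear terms average to zero. *)
Lemma powR_amgm (l p q : R) : 0 < l -> l < 1 -> 0 < p -> 0 < q ->
  p `^ (1 - l) * q `^ l <= (1 - l) * p + l * q.
Proof.
move=> l0 l1 p0 q0.
have m0 : 0 < (1 - l) * p + l * q by nra.
set m := _ + _ in m0 *.
rewrite /powR !gt_eqF//= -expRD -[leRHS](@lnK R)// ler_expR.
have lnle x : 0 < x -> ln x <= ln m + (x / m - 1).
  move=> x0; rewrite -lerBlDl -ln_div//.
  have := @le_ln1Dx R (x / m - 1); rewrite addrCA subrr addr0; apply.
  by rewrite ltrBrDl subrr divr_gt0.
have hp := lnle _ p0; have hq := lnle _ q0.
have -> : ln m = (1 - l) * (ln m + (p / m - 1)) + l * (ln m + (q / m - 1)).
  have -> : (1 - l) * (ln m + (p / m - 1)) + l * (ln m + (q / m - 1)) =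
    ln m + (((1 - l) * p + l * q) / m - 1) by ring.
  by rewrite -/m divff ?gt_eqF// subrr addr0.
by apply: lerD; apply: ler_wpM2l => //; lra.
Qed.

End weighted_amgm.

Section prekopa_leindler1.
Context {R : realType}.
Notation leb := (@lebesgue_measure R).
Local Open Scope ereal_scope.
Implicit Types (f g h : measurableTypeR R -> \bar R).

(* Cavalieri's principle for the sets of points [(x, r)] lying below a graph. *)
Lemma integral_section_swap (A : set (measurableTypeR R * measurableTypeR R)) :
  measurable A ->
  \int[leb]_x leb (xsection A x) = \int[leb]_r leb (ysection A r).
Proof.
move=> mA; have := @indic_fubini_tonelli _ _ _ _ R leb leb _ mA.
by rewrite indic_fubini_tonelli_FE// indic_fubini_tonelli_GE.
Qed.

(** The levels are fractions [r] in (0, 1) of a height [a], so that functions of different heights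
    can be compared level by level. The strict version is meant for the two factors and the weak
    version below for the dominating function, which matches the hypothesis of the inequality. *)
Definition subgraph01 (a : R) f : set (measurableTypeR R * measurableTypeR R) :=
  [set p | (0 < p.2 < 1)%R /\ (a * p.2)%:E < f p.1].

Definition wsubgraph01 (a : R) f : set (measurableTypeR R * measurableTypeR R) :=
  [set p | (0 < p.2 < 1)%R /\ (a * p.2)%:E <= f p.1].

Let measurable_strip :
  measurable [set p : measurableTypeR R * measurableTypeR R | (0 < p.2 < 1)%R].
Proof.
rewrite (_ : [set p | _] = snd @^-1` `]0%R, 1%R[%classic).
  by rewrite -[X in measurable X]setTI; apply: measurable_snd => //; exact: measurable_itv.
by apply/seteqP; split => -[x y] /=; rewrite in_itv.
Qed.

Let measurable_scale2 (a : R) : measurable_fun setT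
  (fun p : measurableTypeR R * measurableTypeR R => (a * p.2)%:E).
Proof.
by apply/measurable_EFinP; apply: measurable_funM => //; exact: measurable_snd.
Qed.

Lemma measurable_subgraph01 a f : measurable_fun setT f -> measurable (subgraph01 a f).
Proof.
move=> mf; apply: measurableI; first exact: measurable_strip.
rewrite -[X in measurable X]setTI; apply: measurable_lte => //.
exact: (measurableT_comp mf).
Qed.

Lemma measurable_wsubgraph01 a f : measurable_fun setT f -> measurable (wsubgraph01 a f).
Proof.
move=> mf; apply: measurableI; first exact: measurable_strip.
rewrite -[X in measurable X]setTI; apply: measurable_lee => //.
exact: (measurableT_comp mf).
Qed.

Lemma integral_subgraph01 (a : R) f : (0 < a)%R -> measurable_fun setT f ->
  (forall x, 0 <= f x <= a%:E) ->
  \int[leb]_r leb (ysection (subgraph01 a f) r) = a^-1%:E * \int[leb]_x f x.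
Proof.
move=> a0 mf f0a.
rewrite -integral_section_swap; last exact: measurable_subgraph01.
rewrite -ge0_integralZl_EFin//; last 2 first.
- by move=> x _; case/andP: (f0a x).
- by rewrite invr_ge0 ltW.
apply: eq_integral => x _.
have /andP[f0 fa] := f0a x.
have fin : f x \is a fin_num by rewrite ge0_fin_numE// (le_lt_trans fa)// ltry.
have [r fr] : exists r, f x = r%:E by exists (fine (f x)); rewrite fineK.
rewrite fr !lee_fin in f0 fa.
rewrite (_ : xsection _ x = `]0%R, (r / a)%R[%classic).
  rewrite lebesgue_measure_itv/= lte_fin fr.
  case: ifPn => [_|]; first by rewrite sube0 -EFinM mulrC.
  rewrite -leNgt => ra0; rewrite -EFinM (_ : r = 0%R) ?mulr0//.
  apply/eqP; rewrite eq_le f0 andbT.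
  by have := ler_wpM2l (ltW a0) ra0; rewrite mulr0 mulrC divfK ?gt_eqF.
apply/seteqP; split => [t /xsectionP[/= /andP[t0 t1]]|t /=]; rewrite in_itv/=.
  by rewrite fr lte_fin t0/= ltr_pdivlMr// mulrC.
move=> /andP[t0 tr]; apply/xsectionP; rewrite /subgraph01/= t0/= fr lte_fin.
have tr' : (a * t < r)%R by rewrite mulrC -ltr_pdivlMr.
by split => //; rewrite -(ltr_pM2l a0) mulr1 (lt_le_trans tr').
Qed.

(** Only an inequality: [f] may exceed [a], and the levels [r >= 1] are cut off. *)
Lemma integral_wsubgraph01_le (a : R) f : (0 < a)%R -> measurable_fun setT f ->
  (forall x, 0 <= f x) ->
  \int[leb]_r leb (ysection (wsubgraph01 a f) r) <= a^-1%:E * \int[leb]_x f x.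
Proof.
move=> a0 mf f0.
have mG := measurable_wsubgraph01 a mf.
rewrite -integral_section_swap// -ge0_integralZl_EFin//; last by rewrite invr_ge0 ltW.
apply: ge0_le_integral => //.
- exact: measurable_fun_xsection.
- by apply: measurable_funeM.
move=> x _.
have [->|fin] := eqVneq (f x) +oo.
  by rewrite gt0_muley ?leey// lte_fin invr_gt0.
have [r fr] : exists r, f x = r%:E.
  by exists (fine (f x)); rewrite fineK// ge0_fin_numE// ltey.
have r0 : (0 <= r)%R by rewrite -lee_fin -fr.
rewrite fr; apply: (@le_trans _ _ (leb `[0%R, (r / a)%R]%classic)).
  apply: le_measure; rewrite ?inE//.
  - exact: measurable_xsection.
  - move=> t /xsectionP[/= /andP[t0 t1]]; rewrite fr lee_fin in_itv/= => atr.
    by rewrite ltW//= ler_pdivlMr// mulrC.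
rewrite lebesgue_measure_itv/= lte_fin; case: ifPn => _.
  by rewrite sube0 -EFinM mulrC.
by rewrite -EFinM lee_fin mulr_ge0// invr_ge0 ltW.
Qed.

End prekopa_leindler1.

Section prekopa_leindler1d.
Context {R : realType}.
Notation leb := (@lebesgue_measure R).
Local Open Scope ereal_scope.
Implicit Types (f g h : measurableTypeR R -> \bar R).

(** Reals strictly below [f u] and [g v] replace the values themselves, so that no infinite value is
    raised to a power. The conclusions take [s] and [t] below the integrals in the same way, which
    lets the induction on the dimension feed one into the other. *)
Let pl1_below (l : R) f g h := forall (u v s t : R), (0 < s)%R -> (0 < t)%R ->
  s%:E < f u -> t%:E < g v -> (s `^ (1 - l) * t `^ l)%:E <= h ((1 - l) * u + l * v)%R.

(** [a] is the supremum rather than the essential supremum: Brunn-Minkowski asks for nonempty level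
    sets, not for level sets of positive measure. *)
Let essbound f (s M : R) : (0 < s)%R -> measurable_fun setT f ->
  (forall x, 0 <= f x <= M%:E) -> s%:E < \int[leb]_x f x ->
  exists a : R, [/\ (0 < a)%R, forall x, f x <= a%:E &
    forall r, (r < 1)%R -> exists x, (a * r)%:E < f x].
Proof.
move=> s0 mf f0M sf.
pose S := ereal_sup (range f).
have SM : S <= M%:E by apply: ge_ereal_sup => _ [x _ <-]; case/andP: (f0M x).
have fS x : f x <= S by apply: ereal_sup_ubound; exists x.
have S0 : 0 < S.
  rewrite ltNge; apply/negP => S0; move: sf; rewrite ltNge => /negP; apply.
  rewrite integral0_eq ?lee_fin ?ltW// => x _; apply/eqP; rewrite eq_le.
  by case/andP: (f0M x) => -> _; rewrite (le_trans (fS x)).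
have finS : S \is a fin_num by rewrite ge0_fin_numE ?ltW// (le_lt_trans SM) ?ltry.
exists (fine S); split.
- by rewrite -lte_fin fineK.
- by move=> x; rewrite fineK.
- move=> r r1; have : (fine S * r)%:E < S.
    by rewrite -[X in _ < X]fineK// lte_fin gtr_pMr// -lte_fin fineK.
  by move/ereal_sup_gt => [_ [x _ <-] ?]; exists x.
Qed.

(** Once [f], [g] and [h] are divided by [a], [b] and [c], their level sets at the same [r] satisfy
    the hypothesis of [brunn_minkowski1]. Integrating over [r] bounds a weighted arithmetic mean of
    the scaled integrals, hence also the geometric mean. *)
Let prekopa_leindler1_bounded (l M s t : R) f g h : (0 < l)%R -> (l < 1)%R ->
  measurable_fun setT f -> measurable_fun setT g -> measurable_fun setT h ->
  (forall x, 0 <= f x <= M%:E) -> (forall x, 0 <= g x <= M%:E) ->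
  (forall x, 0 <= h x) -> pl1_below l f g h ->
  (0 < s)%R -> (0 < t)%R -> s%:E < \int[leb]_x f x -> t%:E < \int[leb]_x g x ->
  (s `^ (1 - l) * t `^ l)%:E <= \int[leb]_x h x.
Proof.
move=> l0 l1 mf mg mh f0M g0M h0 fgh s0 t0 sf tg.
have l1' : (0 < 1 - l)%R by lra.
have [a [a0 fa asup]] := essbound s0 mf f0M sf.
have [b [b0 gb bsup]] := essbound t0 mg g0M tg.
pose c := (a `^ (1 - l) * b `^ l)%R.
have c0 : (0 < c)%R by rewrite mulr_gt0// powR_gt0.
have f0 x : 0 <= f x by case/andP: (f0M x).
have g0 x : 0 <= g x by case/andP: (g0M x).
pose A r := ysection (subgraph01 a f) r.
pose B r := ysection (subgraph01 b g) r.
pose C r := ysection (wsubgraph01 c h) r.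
have mA : measurable_fun setT (fun r => leb (A r)).
  by apply: measurable_fun_ysection; exact: measurable_subgraph01.
have mB : measurable_fun setT (fun r => leb (B r)).
  by apply: measurable_fun_ysection; exact: measurable_subgraph01.
have mC : measurable_fun setT (fun r => leb (C r)).
  by apply: measurable_fun_ysection; exact: measurable_wsubgraph01.
have ABC r : (1 - l)%:E * leb (A r) + l%:E * leb (B r) <= leb (C r).
  have [/andP[r0 r1]|nr] := boolP (0 < r < 1)%R; last first.
    have A0 : A r = set0.
      by apply/seteqP; split => // x /ysectionP[/=]; rewrite (negbTE nr).
    have B0 : B r = set0.
      by apply/seteqP; split => // x /ysectionP[/=]; rewrite (negbTE nr).
    by rewrite A0 B0 !measure0 !mule0 adde0.
  apply: brunn_minkowski1 => //.
  - by apply: measurable_ysection; exact: measurable_subgraph01.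
  - by apply: measurable_ysection; exact: measurable_subgraph01.
  - by apply: measurable_ysection; exact: measurable_wsubgraph01.
  - by have [x ax] := asup _ r1; exists x; apply/ysectionP; split => //=; rewrite r0.
  - by have [x bx] := bsup _ r1; exists x; apply/ysectionP; split => //=; rewrite r0.
  - move=> u v /ysectionP[/= _ fu] /ysectionP[/= _ gv]; apply/ysectionP.
    split => /=; first by rewrite r0.
    have -> : (c * r = (a * r) `^ (1 - l) * (b * r) `^ l)%R.
      rewrite !powRM ?(ltW a0) ?(ltW b0) ?(ltW r0)// /c.
      have rE : r = (r `^ (1 - l) * r `^ l)%R.
        rewrite -powRD ?subrK ?powRr1 ?ltW//.
        by apply/implyP => _; rewrite gt_eqF.
      by rewrite [in LHS]rE; ring.
    by apply: fgh => //; exact: mulr_gt0.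
have key : (1 - l)%:E * (a^-1%:E * \int[leb]_x f x) +
           l%:E * (b^-1%:E * \int[leb]_x g x) <= c^-1%:E * \int[leb]_x h x.
  rewrite -(integral_subgraph01 a0 mf); last by move=> x; rewrite f0 fa.
  rewrite -(integral_subgraph01 b0 mg); last by move=> x; rewrite g0 gb.
  apply: le_trans (integral_wsubgraph01_le c0 mh h0).
  rewrite -!ge0_integralZl_EFin//; [|lra..].
  rewrite -ge0_integralD//; [|by move=> x _; rewrite mule_ge0// lee_fin; lra|exact: measurable_funeM|by move=> x _; rewrite mule_ge0// lee_fin; lra|exact: measurable_funeM].
  apply: ge0_le_integral => //.
  - by move=> x _; rewrite adde_ge0// mule_ge0// lee_fin; lra.
  - by apply: emeasurable_funD; exact: measurable_funeM.
have low : ((1 - l) * (s / a) + l * (t / b))%:E <= c^-1%:E * \int[leb]_x h x.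
  apply: le_trans key; rewrite EFinD; apply: leeD.
  - rewrite EFinM lee_pmul2l ?lte_fin// mulrC EFinM lee_pmul2l ?lte_fin ?invr_gt0//.
    exact: ltW.
  - rewrite EFinM lee_pmul2l ?lte_fin// mulrC EFinM lee_pmul2l ?lte_fin ?invr_gt0//.
    exact: ltW.
have -> : (s `^ (1 - l) * t `^ l = c * ((s / a) `^ (1 - l) * (t / b) `^ l))%R.
  have sE : (s `^ (1 - l) = a `^ (1 - l) * (s / a) `^ (1 - l))%R.
    by rewrite -powRM ?divr_ge0 ?ltW// mulrC divfK ?gt_eqF.
  have tE : (t `^ l = b `^ l * (t / b) `^ l)%R.
    by rewrite -powRM ?divr_ge0 ?ltW// mulrC divfK ?gt_eqF.
  by rewrite sE tE /c; ring.
rewrite EFinM -lee_pdivlMl//; apply: le_trans low.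
by rewrite lee_fin powR_amgm// divr_gt0.
Qed.

Let trunc_integral f (s : R) : measurable_fun setT f -> (forall x, 0 <= f x) ->
  s%:E < \int[leb]_x f x ->
  exists n : nat, s%:E < \int[leb]_x (mine (f x) n%:R%:E).
Proof.
move=> mf f0 sf; apply/not_existsP => H; move: sf; rewrite ltNge => /negP; apply.
have -> : \int[leb]_x f x = \int[leb]_x (limn (fun n => mine (f x) n%:R%:E)).
  apply: eq_integral => x _; apply/esym/cvg_lim => //.
  have [fx|fin] := eqVneq (f x) +oo.
    rewrite fx.
    by under eq_fun do rewrite minye; apply/cvgeryP; exact: cvgr_idn.
  have [r fr] : exists r, f x = r%:E.
    by exists (fine (f x)); rewrite fineK// ge0_fin_numE// ltey.
  apply: cvg_near_cst; near=> n; rewrite fr min_l// lee_fin.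
  by near: n; exact: nbhs_infty_ger.
rewrite monotone_convergence//.
- apply: lime_le; last by near=> n; rewrite leNgt; apply/negP; exact: H.
  apply: ereal_nondecreasing_is_cvgn => m n mn; apply: ge0_le_integral => //.
  + by move=> x _; rewrite le_min f0 lee_fin ler0n.
  + by apply: measurable_mine.
  + by apply: measurable_mine.
  + by move=> x _; rewrite le_min ge_min lexx/= ge_min lee_fin ler_nat mn orbT.
- by move=> n; apply: measurable_mine.
- by move=> n x _; rewrite le_min f0 lee_fin ler0n.
- by move=> x _ m n mn; rewrite le_min ge_min lexx/= ge_min lee_fin ler_nat mn orbT.
Unshelve. all: by end_near. Qed.

Lemma prekopa_leindler1 (l s t : R) f g h : (0 < l)%R -> (l < 1)%R ->
  measurable_fun setT f -> measurable_fun setT g -> measurable_fun setT h ->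
  (forall x, 0 <= f x) -> (forall x, 0 <= g x) -> (forall x, 0 <= h x) ->
  (forall (u v s t : R), (0 < s)%R -> (0 < t)%R -> s%:E < f u -> t%:E < g v ->
     (s `^ (1 - l) * t `^ l)%:E <= h ((1 - l) * u + l * v)%R) ->
  (0 < s)%R -> (0 < t)%R -> s%:E < \int[leb]_x f x -> t%:E < \int[leb]_x g x ->
  (s `^ (1 - l) * t `^ l)%:E <= \int[leb]_x h x.
Proof.
move=> l0 l1 mf mg mh f0 g0 h0 fgh s0 t0 sf tg.
have [n sn] := trunc_integral mf f0 sf.
have [m tm] := trunc_integral mg g0 tg.
pose M := maxn n m.
apply: (@prekopa_leindler1_bounded l M%:R s t (fun x => mine (f x) M%:R%:E)
  (fun x => mine (g x) M%:R%:E)) => //.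
- by apply: measurable_mine.
- by apply: measurable_mine.
- by move=> x; rewrite le_min f0 lee_fin ler0n/= ge_min lexx orbT.
- by move=> x; rewrite le_min g0 lee_fin ler0n/= ge_min lexx orbT.
- by move=> u v s' t' s'0 t'0; rewrite !lt_min => /andP[? _] /andP[? _]; exact: fgh.
- apply: lt_le_trans sn _; apply: ge0_le_integral => //.
  + by move=> x _; rewrite le_min f0 lee_fin ler0n.
  + by apply: measurable_mine.
  + by apply: measurable_mine.
  + by move=> x _; rewrite le_min ge_min lexx/= ge_min lee_fin ler_nat leq_maxl orbT.
- apply: lt_le_trans tm _; apply: ge0_le_integral => //.
  + by move=> x _; rewrite le_min g0 lee_fin ler0n.
  + by apply: measurable_mine.
  + by apply: measurable_mine.
  + by move=> x _; rewrite le_min ge_min lexx/= ge_min lee_fin ler_nat leq_maxr orbT.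
Qed.

End prekopa_leindler1d.

Section lebesgue_rV_integral.
Context {R : realType}.
Local Open Scope ereal_scope.

Lemma cons_rV_ord0 n (p : measurableTypeR R * 'rV[R]_n) :
  cons_rV p ord0 ord0 = p.1.
Proof. by rewrite mxE; case: splitP => j; rewrite // ord1 mxE eqxx. Qed.

Lemma cons_rV_lift n (p : measurableTypeR R * 'rV[R]_n) (i : 'I_n) :
  cons_rV p ord0 (lift ord0 i) = p.2 ord0 i.
Proof.
rewrite mxE; case: splitP => j /=; first by rewrite ord1.
by rewrite /bump /= => -[/val_inj ->].
Qed.

Lemma cons_rV_comb n (a b : R) (p q : measurableTypeR R * 'rV[R]_n) :
  (a *: cons_rV p + b *: cons_rV q)%R =
  cons_rV ((a * p.1 + b * q.1)%R : measurableTypeR R, (a *: p.2 + b *: q.2)%R).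
Proof.
have combE m (x y : 'rV[R]_m) i : (a *: x + b *: y)%R ord0 i = (a * x ord0 i + b * y ord0 i)%R.
  by rewrite !mxE.
apply/rowP => i; rewrite combE; have [j ->|->] := unliftP ord0 i.
  by rewrite !cons_rV_lift combE.
by rewrite !cons_rV_ord0.
Qed.

Lemma measurable_cons_rV n : measurable_fun setT (@cons_rV R n).
Proof.
apply: measurable_fun_rV => i; have [j ->|->] := unliftP ord0 i.
- under eq_fun do rewrite cons_rV_lift.
  exact: (measurableT_comp (measurable_coord_rV j)).
- under eq_fun do rewrite cons_rV_ord0.
  exact: measurable_fst.
Qed.

Lemma integral_rVS n (f : 'rV[R]_n.+1 -> \bar R) : measurable_fun setT f ->
  (forall x, 0 <= f x) ->
  \int[lebesgue_rV n.+1]_x f x =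
  \int[lebesgue_measure]_a \int[lebesgue_rV n]_v f (@cons_rV R n (a, v)).
Proof.
move=> mf f0.
transitivity (\int[pushforward (@lebesgue_measure R \x lebesgue_rV n) (@cons_rV R n)]_x f x).
  by [].
rewrite ge0_integral_pushforward//; last exact: measurable_cons_rV.
rewrite preimage_setT fubini_tonelli1//.
  exact: (measurableT_comp mf (@measurable_cons_rV n)).
by move=> x; exact: f0.
Qed.

Lemma measurable_integral_cons_rV n (f : 'rV[R]_n.+1 -> \bar R) :
  measurable_fun setT f -> (forall x, 0 <= f x) ->
  measurable_fun (setT : set (measurableTypeR R))
    (fun a => \int[lebesgue_rV n]_v f (@cons_rV R n (a, v))).
Proof.
move=> mf f0.
apply: (@measurable_fun_fubini_tonelli_F _ _ _ _ R (lebesgue_rV n) (f \o @cons_rV R n)) => //.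
  exact: (measurableT_comp mf (@measurable_cons_rV n)).
by move=> x; exact: f0.
Qed.

Lemma integral_rV0 (f : 'rV[R]_0 -> \bar R) : measurable_fun setT f ->
  \int[lebesgue_rV 0]_x f x = f 0%R.
Proof. by move=> mf; rewrite /= integral_dirac// diracT mul1e. Qed.

(** Induction by splitting off the first coordinate: the induction hypothesis on slices is exactly
    the hypothesis of [prekopa_leindler1] for the partial integrals. *)
Theorem prekopa_leindler n (l s t : R) (f g h : 'rV[R]_n -> \bar R) :
  (0 < l)%R -> (l < 1)%R ->
  measurable_fun setT f -> measurable_fun setT g -> measurable_fun setT h ->
  (forall x, 0 <= f x) -> (forall x, 0 <= g x) -> (forall x, 0 <= h x) ->
  (forall u v (s t : R), (0 < s)%R -> (0 < t)%R -> s%:E < f u -> t%:E < g v ->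
     (s `^ (1 - l) * t `^ l)%:E <= h ((1 - l) *: u + l *: v)%R) ->
  (0 < s)%R -> (0 < t)%R ->
  s%:E < \int[lebesgue_rV n]_x f x -> t%:E < \int[lebesgue_rV n]_x g x ->
  (s `^ (1 - l) * t `^ l)%:E <= \int[lebesgue_rV n]_x h x.
Proof.
move=> l0 l1; elim: n s t f g h => [|n IH] s t f g h mf mg mh f0 g0 h0 fgh s0 t0.
  rewrite !integral_rV0// => sf tg.
  by have := fgh _ _ _ _ s0 t0 sf tg; rewrite !scaler0 addr0.
rewrite !integral_rVS// => sf tg.
apply: (prekopa_leindler1 l0 l1 _ _ _ _ _ _ _ s0 t0 sf tg).
- exact: measurable_integral_cons_rV.
- exact: measurable_integral_cons_rV.
- exact: measurable_integral_cons_rV.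
- by move=> x; exact: integral_ge0.
- by move=> x; exact: integral_ge0.
- by move=> x; exact: integral_ge0.
move=> a b s' t' s'0 t'0 sf' tg'.
have mcons (k : 'rV[R]_n.+1 -> \bar R) c : measurable_fun setT k ->
    measurable_fun setT (fun v => k (@cons_rV R n (c, v))).
  move=> mk; apply: (measurableT_comp mk).
  by apply: (measurableT_comp (@measurable_cons_rV n)); exact: measurable_pair1.
apply: (IH _ _ _ _ _ (mcons _ _ mf) (mcons _ _ mg) (mcons _ _ mh) _ _ _ _ s'0 t'0 sf' tg') => //.
move=> u v s2 t2 s20 t20 sf2 tg2.
by have := fgh _ _ _ _ s20 t20 sf2 tg2; rewrite cons_rV_comb.
Qed.

End lebesgue_rV_integral.

(** * Euclidean geometry on row vectors *)

Section euclidean.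
Context {R : realType} {d : nat}.
Implicit Types u v w : 'rV[R]_d.

Definition dot u v : R := \sum_(i < d) u ord0 i * v ord0 i.

Definition enorm u : R := Num.sqrt (sqnorm u).

Lemma sqnorm_ge0 u : 0 <= sqnorm u.
Proof. by apply: sumr_ge0 => i _; exact: sqr_ge0. Qed.

Lemma sqnormZ (a : R) u : sqnorm (a *: u) = a ^+ 2 * sqnorm u.
Proof. by rewrite /sqnorm mulr_sumr; apply: eq_bigr => i _; rewrite mxE exprMn. Qed.

Lemma sqnormN u : sqnorm (- u) = sqnorm u.
Proof. by rewrite -scaleN1r sqnormZ sqrrN expr1n mul1r. Qed.

Lemma sqnormBC u v : sqnorm (u - v) = sqnorm (v - u).
Proof. by rewrite -sqnormN opprB. Qed.

Lemma dotC u v : dot u v = dot v u.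
Proof. by apply: eq_bigr => i _; rewrite mulrC. Qed.

Lemma dotZr (a : R) u v : dot u (a *: v) = a * dot u v.
Proof. by rewrite /dot mulr_sumr; apply: eq_bigr => i _; rewrite mxE mulrCA. Qed.

Lemma dotDr u v w : dot u (v + w) = dot u v + dot u w.
Proof. by rewrite /dot -big_split; apply: eq_bigr => i _; rewrite mxE mulrDr. Qed.

Lemma dotDl u v w : dot (v + w) u = dot v u + dot w u.
Proof. by rewrite dotC dotDr !(dotC u). Qed.

Lemma dotZl (a : R) u v : dot (a *: u) v = a * dot u v.
Proof. by rewrite dotC dotZr dotC. Qed.

Lemma dotNr u v : dot u (- v) = - dot u v.
Proof. by rewrite -scaleN1r dotZr mulN1r. Qed.

Lemma dotBl u v w : dot (v - w) u = dot v u - dot w u.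
Proof. by rewrite dotDl (dotC (- w)) dotNr (dotC u). Qed.

Lemma dot_delta u (i : 'I_d) : dot u (delta_mx ord0 i) = u ord0 i.
Proof.
rewrite /dot (bigD1 i)//= mxE !eqxx mulr1 big1 ?addr0// => j ji.
by rewrite mxE (negbTE ji) andbF mulr0.
Qed.

Lemma sqnormD u v : sqnorm (u + v) = sqnorm u + 2 * dot u v + sqnorm v.
Proof.
rewrite /sqnorm /dot mulr_sumr -!big_split/=; apply: eq_bigr => i _.
by rewrite mxE; ring.
Qed.

Lemma sqnormB u v : sqnorm (u - v) = sqnorm u - 2 * dot u v + sqnorm v.
Proof. by rewrite sqnormD sqnormN dotNr mulrN. Qed.

(** The defect term is the strong convexity from which all quadratic costs originate; in
    [gibbs_talagrand] it absorbs the transport cost. *)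
Lemma sqnorm_convex (l : R) u v :
  sqnorm ((1 - l) *: u + l *: v) =
  (1 - l) * sqnorm u + l * sqnorm v - l * (1 - l) * sqnorm (u - v).
Proof.
rewrite /sqnorm !mulr_sumr -big_split/= -sumrB; apply: eq_bigr => i _.
by rewrite !mxE; ring.
Qed.

Lemma enorm_ge0 u : 0 <= enorm u.
Proof. exact: sqrtr_ge0. Qed.

Lemma sqr_enorm u : enorm u ^+ 2 = sqnorm u.
Proof. by rewrite sqr_sqrtr// sqnorm_ge0. Qed.

Lemma enormN u : enorm (- u) = enorm u.
Proof. by rewrite /enorm sqnormN. Qed.

Lemma enormBC u v : enorm (u - v) = enorm (v - u).
Proof. by rewrite -enormN opprB. Qed.

Lemma sqr_dot_le u v : dot u v ^+ 2 <= sqnorm u * sqnorm v.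
Proof.
have [v0|v0] := eqVneq (sqnorm v) 0.
  rewrite v0 mulr0 (_ : dot u v = 0) ?expr0n//.
  apply: big1 => i _.
  have /eqP := v0; rewrite psumr_eq0; last by move=> j _; exact: sqr_ge0.
  move=> /allP/(_ i); rewrite mem_index_enum => /(_ isT)/implyP/(_ isT).
  by rewrite sqrf_eq0 => /eqP ->; rewrite mulr0.
have v1 : 0 < sqnorm v by rewrite lt0r v0 sqnorm_ge0.
(* The part of [u] orthogonal to [v], scaled by [sqnorm v] to avoid a division. *)
have := sqnorm_ge0 (sqnorm v *: u - dot u v *: v).
rewrite sqnormB sqnormZ sqnormZ dotZl dotZr.
have -> : sqnorm v ^+ 2 * sqnorm u - 2 * (sqnorm v * (dot u v * dot u v)) +
  dot u v ^+ 2 * sqnorm v = sqnorm v * (sqnorm u * sqnorm v - dot u v ^+ 2) by ring.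
by rewrite pmulr_rge0// subr_ge0.
Qed.

Lemma dot_le_enorm u v : dot u v <= enorm u * enorm v.
Proof.
apply: le_trans (ler_norm _) _.
by rewrite -sqrtr_sqr /enorm -sqrtrM ?sqnorm_ge0// ler_wsqrtr// sqr_dot_le.
Qed.

Lemma enormD u v : enorm (u + v) <= enorm u + enorm v.
Proof.
rewrite -ler_sqr ?nnegrE ?enorm_ge0 ?addr_ge0 ?enorm_ge0//.
rewrite sqr_enorm sqnormD sqrrD !sqr_enorm lerD2r lerD2l -[leRHS]mulr_natl.
by rewrite ler_wpM2l// dot_le_enorm.
Qed.

Lemma enorm_triangle w u v : enorm (u - v) <= enorm (u - w) + enorm (w - v).
Proof. by apply: le_trans (enormD _ _); rewrite addrA subrK. Qed.

Lemma coord_le_norm u i : `|u ord0 i| <= `|u|.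
Proof.
by rewrite [`|u|]mx_normrE; apply: (le_bigmax _ (fun ij => `|u ij.1 ij.2|) (ord0, i)).
Qed.

(** The topology is that of the sup norm; continuity of Euclidean 1-Lipschitz functions goes through
    this comparison. *)
Lemma enorm_le_norm u : enorm u <= Num.sqrt d%:R * `|u|.
Proof.
rewrite -[X in _ * X]ger0_norm// -sqrtr_sqr -sqrtrM ?ler0n// ler_wsqrtr//.
rewrite /sqnorm -[d in d%:R]card_ord -sum1_card natr_sum mulr_suml ler_sum// => i _.
rewrite mul1r -real_normK ?num_real// ler_sqr ?nnegrE//.
exact: coord_le_norm.
Qed.

Lemma measurable_sqnormB v :
  measurable_fun setT (fun u => sqnorm (u - v)).
Proof.
apply: measurable_sum => i; apply: measurable_funX.
under eq_fun do rewrite !mxE.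
by apply: measurable_funB => //; exact: measurable_coord_rV.
Qed.

Lemma measurable_sqnorm : measurable_fun setT (fun u : 'rV[R]_d => sqnorm u).
Proof.
by apply: measurable_sum => i; apply: measurable_funX; exact: measurable_coord_rV.
Qed.

Lemma measurable_dot v : measurable_fun setT (fun u => dot u v).
Proof.
by apply: measurable_sum => i; apply: measurable_funM => //; exact: measurable_coord_rV.
Qed.

Lemma measurable_fun_continuous_rV (f : 'rV[R]_d -> R) :
  continuous f -> measurable_fun setT f.
Proof.
move=> cf; apply: (measurability _ (RGenOInfty.measurableE R)) => _ [_ [a ->] <-].
rewrite setTI; apply: sub_sigma_algebra.
by apply: open_comp; [move=> x _; exact: cf|exact: interval_open].
Qed.

Definition lipschitz1 (f : 'rV[R]_d -> R) := forall u v, f u <= f v + enorm (u - v).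

End euclidean.

(** * Gaussian mass, convex potentials and Gibbs weights *)

Section gaussian_mass.
Context {R : realType}.
Local Open Scope ereal_scope.

Lemma integral_prod_normal_pdf n (s : R) (x : 'rV[R]_n) :
  \int[lebesgue_rV n]_u (\prod_(i < n) normal_pdf (x ord0 i) s (u ord0 i))%:E = 1.
Proof.
have mprod m (z : 'rV[R]_m) : measurable_fun setT
    (fun u : 'rV[R]_m => (\prod_(i < m) normal_pdf (z ord0 i) s (u ord0 i))%:E).
  apply/measurable_EFinP; apply: measurable_prod => i _.
  by apply: (measurableT_comp (measurable_normal_pdf _ _)); exact: measurable_coord_rV.
have prod_ge0 m (z u : 'rV[R]_m) :
    (0 <= \prod_(i < m) normal_pdf (z ord0 i) s (u ord0 i))%R.
  by apply: prodr_ge0 => i _; exact: normal_pdf_ge0.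
elim: n x => [|n IH] x.
  by rewrite integral_rV0 ?big_ord0.
rewrite integral_rVS//; last by move=> u; rewrite lee_fin.
pose y : 'rV[R]_n := \row_i x ord0 (lift ord0 i).
rewrite -[RHS](integral_normal_pdf (x ord0 ord0) s); apply: eq_integral => a _.
under eq_integral => v _.
  rewrite big_ord_recl cons_rV_ord0 EFinM/=.
  under eq_bigr do rewrite cons_rV_lift/=.
  rewrite (_ : \prod_(i < n) _ = \prod_(i < n) normal_pdf (y ord0 i) s (v ord0 i))%R; last first.
    by apply: eq_bigr => i _; rewrite mxE.
  over.
rewrite /= ge0_integralZl_EFin//.
- by rewrite IH mule1.
- by move=> v _; rewrite lee_fin; exact: prod_ge0.
- exact: mprod.
- exact: normal_pdf_ge0.
Qed.

(** Against the zero measure the Gaussian density could not have integral 1. The positivity of the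
    normalizing constants rests on this. *)
Lemma lebesgue_rV_setT_neq0 n : lebesgue_rV n [set: 'rV[R]_n] != 0.
Proof.
apply/eqP => l0; have := integral_prod_normal_pdf 1%R (0 : 'rV[R]_n).
have -> : \int[lebesgue_rV n]_u
    (\prod_(i < n) normal_pdf ((0 : 'rV[R]_n) ord0 i) 1%R (u ord0 i))%:E = 0.
  apply: null_set_integral => //.
  apply/measurable_EFinP; apply: measurable_prod => i _.
  by apply: (measurableT_comp (measurable_normal_pdf _ _)); exact: measurable_coord_rV.
by move/eqP; rewrite eq_sym onee_eq0.
Qed.

Lemma prod_normal_pdf n (h : R) (x u : 'rV[R]_n) : (0 < h)%R ->
  (\prod_(i < n) normal_pdf (x ord0 i) (Num.sqrt h) (u ord0 i) =
   normal_peak (Num.sqrt h) ^+ n * expR (- (sqnorm (u - x) / (2 * h))))%R.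
Proof.
move=> h0; under eq_bigr do rewrite normal_pdfE ?gt_eqF ?sqrtr_gt0//.
rewrite big_split/= prodr_const card_ord; congr (_ * _)%R.
rewrite /normal_fun -expR_sum; congr expR.
rewrite /sqnorm mulr_suml -sumrN; apply: eq_bigr => i _.
rewrite !mxE sqr_sqrtr ?ltW// mulNr; congr (- (_ / _))%R; by rewrite mulr_natl.
Qed.

End gaussian_mass.

Section potential.
Context {R : realType} {d : nat}.
Notation E := 'rV[R]_d.
Notation leb := (@lebesgue_rV R d).

(** Integrability is asked only after multiplication by centred Gaussian weights, so that the record
    covers both the zero potential and [V]. Every variance is included because moving the centre of
    the weight costs a factor 2 in the variance. *)
Record potential := Potential {
  pot :> E -> R ;
  pot_measurable : measurable_fun setT pot ;
  pot_convex : forall (l : R) u v, 0 < l -> l < 1 ->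
    pot ((1 - l) *: u + l *: v) <= (1 - l) * pot u + l * pot v ;
  pot_lty : forall h : R, 0 < h ->
    (\int[leb]_x (expR (- pot x - sqnorm x / (2 * h)))%:E < +oo)%E }.

End potential.
Arguments potential : clear implicits.

Section gibbs_weight.
Context {R : realType} {d : nat}.
Notation E := 'rV[R]_d.
Notation leb := (@lebesgue_rV R d).
Variables (h : {posnum R}) (W : potential R d).
Implicit Types x y u : E.

Definition gw y u : R := backward_density h%:num W y u.

Lemma gw_gt0 y u : 0 < gw y u.
Proof. exact: expR_gt0. Qed.

Lemma measurable_gw2 : measurable_fun setT (fun p : E * E => gw p.1 p.2).
Proof.
apply: measurableT_comp => //; apply: measurable_funB.
  apply: measurableT_comp => //; apply: (measurableT_comp (pot_measurable W)).
  exact: measurable_snd.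
apply: measurable_funM => //; apply: measurable_sum => i; apply: measurable_funX.
under eq_fun do rewrite !mxE.
apply: measurable_funB.
  by apply: (measurableT_comp (measurable_coord_rV i)); exact: measurable_snd.
by apply: (measurableT_comp (measurable_coord_rV i)); exact: measurable_fst.
Qed.

Lemma measurable_gw y : measurable_fun setT (gw y).
Proof.
have -> : gw y = (fun p : E * E => gw p.1 p.2) \o pair y by [].
by apply: measurableT_comp; [exact: measurable_gw2|exact: measurable_pair1].
Qed.

Lemma measurable_gwE y : measurable_fun setT (fun u => (gw y u)%:E).
Proof. by apply/measurable_EFinP; exact: measurable_gw. Qed.

Lemma integral_gw_lty y : (\int[leb]_u (gw y u)%:E < +oo)%E.
Proof.
have h0 : 0 < h%:num by [].
have h2 : 0 < 2 * h%:num by rewrite mulr_gt0.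
have mQ : measurable_fun setT
    (fun u : E => (expR (- W u - sqnorm u / (2 * (2 * h%:num))))%:E).
  apply/measurable_EFinP; apply: measurableT_comp => //; apply: measurable_funB.
    by apply: measurableT_comp => //; exact: pot_measurable.
  by apply: measurable_funM => //; exact: measurable_sqnorm.
apply: (@le_lt_trans _ _ (\int[leb]_u ((expR (sqnorm y / (2 * h%:num)))%:E *
    (expR (- W u - sqnorm u / (2 * (2 * h%:num))))%:E)%E)%E).
  apply: ge0_le_integral => //.
  - by move=> u _; rewrite lee_fin expR_ge0.
  - exact: measurable_gwE.
  - exact: measurable_funeM.
  - move=> u _; rewrite -EFinM lee_fin -expRD ler_expR.
    have -> : sqnorm y / (2 * h%:num) + (- W u - sqnorm u / (2 * (2 * h%:num))) =
      - W u - (sqnorm u / 2 - sqnorm y) / (2 * h%:num) by field; rewrite gt_eqF.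
    rewrite lerD2l lerN2 ler_pM2r ?invr_gt0//.
    (* This says that [sqnorm (u - y)] is at least [sqnorm u / 2 - sqnorm y]. *)
    have := sqnorm_ge0 (u - 2 *: y).
    rewrite !sqnormB sqnormZ dotZr; lra.
rewrite ge0_integralZl_EFin//;
  do ?[by move=> u _; rewrite lee_fin expR_ge0 | exact: mQ | exact: expR_ge0].
by apply: lte_mul_pinfty; rewrite ?lee_fin ?expR_ge0//; exact: pot_lty.
Qed.

Lemma integral_gw_gt0 y : (0 < \int[leb]_u (gw y u)%:E)%E.
Proof.
rewrite lt0e integral_ge0 ?andbT//; last first.
  by move=> u _; rewrite lee_fin expR_ge0.
apply/eqP => i0.
have : \forall u \ae leb, setT u -> (gw y u)%:E = (cst 0%E : E -> \bar R) u.
  apply/(@ae_eq_integral_abs _ _ _ leb setT) => //.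
    exact: measurable_gwE.
  by rewrite -[RHS]i0; apply: eq_integral => u _; rewrite gee0_abs// lee_fin expR_ge0.
move=> [N [mN N0 HN]].
have : (leb setT <= leb N)%E.
  apply: le_measure; rewrite ?inE//= => u _; apply: HN => /= /(_ I) /eqP.
  by rewrite eqe gt_eqF// gw_gt0.
by rewrite [leRHS]N0 measure_le0 (negbTE (@lebesgue_rV_setT_neq0 R d)).
Qed.

Definition gZ y : R := fine (\int[leb]_u (gw y u)%:E)%E.

Lemma EFin_gZ y : (gZ y)%:E = (\int[leb]_u (gw y u)%:E)%E.
Proof.
by rewrite /gZ fineK// ge0_fin_numE ?integral_gw_lty// ltW// integral_gw_gt0.
Qed.

Lemma gZ_gt0 y : 0 < gZ y.
Proof. by rewrite -lte_fin EFin_gZ integral_gw_gt0. Qed.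

Lemma measurable_gZ : measurable_fun setT gZ.
Proof.
apply: (measurableT_comp (f := fine)) => //.
apply: (@measurable_fun_fubini_tonelli_F _ _ E E R leb (fun p => (gw p.1 p.2)%:E)).
  by apply/measurable_EFinP; exact: measurable_gw2.
by move=> p; rewrite lee_fin ltW// gw_gt0.
Qed.

Definition gibbs_density y u : R := gw y u / gZ y.

Lemma gibbs_density_ge0 y u : 0 <= gibbs_density y u.
Proof. by rewrite divr_ge0// ltW ?gw_gt0 ?gZ_gt0. Qed.

Lemma measurable_gibbs_density2 :
  measurable_fun setT (fun p : E * E => gibbs_density p.1 p.2).
Proof.
apply: measurable_funM; first exact: measurable_gw2.
have -> : (fun p : E * E => (gZ p.1)^-1) = (fun p => expR (- ln (gZ p.1))).
  by apply/funext => p; rewrite expRN lnK// posrE gZ_gt0.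
apply: measurableT_comp => //; apply: measurableT_comp => //.
apply: measurableT_comp => //.
by apply: (measurableT_comp measurable_gZ); exact: measurable_fst.
Qed.

End gibbs_weight.

(** * Bounded functions and Markov kernels *)

Section integral_mixture.
Local Open Scope ereal_scope.
Context d1 d2 (X : measurableType d1) (Y : measurableType d2) (R : realType).
Variables (mu : {measure set X -> \bar R}) (nu : {measure set Y -> \bar R}).
Variables (p : X -> R) (k : X -> {measure set Y -> \bar R}).
Hypotheses (p0 : forall x, (0 <= p x)%R) (mp : measurable_fun setT p).
Hypothesis mk : forall U, measurable U -> measurable_fun setT (k ^~ U).
Hypothesis nuE : forall U, measurable U -> nu U = \int[mu]_x ((p x)%:E * k x U).

Import HBNNSimple.

Let integral_mixture_nnsfun (f : {nnsfun Y >-> R}) :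
  \int[nu]_y (f y)%:E = \int[mu]_x ((p x)%:E * \int[k x]_y (f y)%:E).
Proof.
have mkf r : measurable_fun setT (fun x => k x (f @^-1` [set r])) by exact: mk.
have rk0 r x : 0 <= r%:E * k x (f @^-1` [set r]).
  have [r0|r0] := leP 0%R r; first by rewrite mule_ge0.
  by rewrite preimage_nnfun0// measure0 mule0.
rewrite integralT_nnsfun sintegralE.
under [in RHS]eq_integral => x _.
  rewrite integralT_nnsfun sintegralE ge0_mule_fsumr; last by move=> r; exact: rk0.
  over.
rewrite /= ge0_integral_fsum//; last 2 first.
- by move=> r; apply: emeasurable_funM; [exact/measurable_EFinP|exact: measurable_funeM].
- by move=> r x _; rewrite mule_ge0 ?lee_fin//; exact: rk0.
apply: eq_fsbigr => r _; rewrite nuE//.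
have [r0|r0] := leP 0%R r; last first.
  rewrite preimage_nnfun0// !integral0_eq ?mule0// => x _;
    by rewrite measure0 !mule0.
rewrite -ge0_integralZl_EFin//.
- by apply: eq_integral => x _; rewrite muleCA.
- by move=> x _; rewrite mule_ge0 ?lee_fin//.
- apply: emeasurable_funM => //; exact/measurable_EFinP.
Qed.

(** Used in two ways: with Dirac masses for [k] it integrates against the density [p], and with [p]
    equal to 1 it integrates against a mixture of the laws [k x]. *)
Lemma ge0_integral_mixture (f : Y -> \bar R) : measurable_fun setT f ->
  (forall y, 0 <= f y) ->
  \int[nu]_y f y = \int[mu]_x ((p x)%:E * \int[k x]_y f y).
Proof.
move=> mf f0; pose f_ := nnsfun_approx measurableT mf.
have cvgf y : (f_ n y)%:E @[n --> \oo] --> f y by exact: cvg_nnsfun_approx.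
have ndf y n m : (n <= m)%N -> (f_ n y)%:E <= (f_ m y)%:E.
  by move=> nm; rewrite lee_fin; exact/lefP/nd_nnsfun_approx.
have limE (m : {measure set Y -> \bar R}) :
    \int[m]_y f y = limn (fun n => \int[m]_y (f_ n y)%:E).
  rewrite -monotone_convergence//.
  - by apply: eq_integral => y _; apply/esym/cvg_lim => //; exact: cvgf.
  - by move=> n; exact/measurable_EFinP.
  - by move=> n y _; rewrite lee_fin.
  - by move=> y _ a b ab; exact: ndf.
have ndi (m : {measure set Y -> \bar R}) a b : (a <= b)%N ->
    \int[m]_y (f_ a y)%:E <= \int[m]_y (f_ b y)%:E.
  move=> ab; apply: ge0_le_integral => //.
  - by move=> y _; rewrite lee_fin.
  - exact/measurable_EFinP.
  - exact/measurable_EFinP.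
  - by move=> y _; exact: ndf.
rewrite limE; under eq_fun do rewrite integral_mixture_nnsfun.
rewrite -monotone_convergence//; last 3 first.
- move=> n; apply: emeasurable_funM; first exact/measurable_EFinP.
  apply: measurable_fun_integral_kernel => //; first by move=> z; rewrite lee_fin.
  exact/measurable_EFinP.
- by move=> n x _; rewrite mule_ge0 ?lee_fin// integral_ge0// => y _; rewrite lee_fin.
- by move=> x _ a b ab; rewrite lee_wpmul2l ?lee_fin// ndi.
apply: eq_integral => x _; rewrite limE.
have c : cvgn (fun n => \int[k x]_y (f_ n y)%:E).
  by apply: ereal_nondecreasing_is_cvgn => a b; exact: ndi.
by rewrite limeMl.
Qed.

End integral_mixture.

Section exp_inequalities.
Context {R : realType}.

Lemma expR_ge_quadratic (x : R) : 0 <= x -> 1 + x + x ^+ 2 / 2 <= expR x.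
Proof.
move=> x0; have nd : nondecreasing_seq (series (exp_coeff x)).
  apply/nondecreasing_seqP => n; rewrite /series /= big_nat_recr//= lerDl.
  by rewrite /exp_coeff divr_ge0// exprn_ge0.
have := @nondecreasing_cvgn_le _ _ nd (is_cvg_series_exp_coeff x) 3%N.
rewrite /series /= !big_nat_recr//= big_geq// /exp_coeff /= !add0r.
by rewrite expr0 expr1 !divr1.
Qed.

(** Since [q - q^-1] increases with [q], the exponential may be replaced by its quadratic Taylor
    polynomial, and the remaining difference is a perfect square. *)
Lemma sinh_ge (y : R) : 0 <= y -> 2 * y <= expR y - expR (- y).
Proof.
move=> y0; have qe := expR_ge_quadratic y0; set q := 1 + y + _ in qe.
have q0 : 0 < q by rewrite /q; nra.
have : expR (- y) <= q^-1 by rewrite expRN lef_pV2 ?posrE ?expR_gt0.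
suff : 2 * y <= q - q^-1 by lra.
rewrite -(ler_pM2r q0) mulrBl mulVf ?gt_eqF// -subr_ge0.
have -> : q * q - 1 - 2 * y * q = (y ^+ 2 / 2) ^+ 2 by rewrite /q; field.
exact: sqr_ge0.
Qed.

(** The square of [sinh_ge] at [x / 2]. It turns bounds on exponential moments into bounds on second
    moments. *)
Lemma cosh_ge (x : R) : 2 + x ^+ 2 <= expR x + expR (- x).
Proof.
wlog x0 : x / 0 <= x.
  move=> H; have [/H//|xn] := leP 0 x.
  by have := H (- x); rewrite sqrrN opprK (addrC (expR (- x))); apply; lra.
have y0 : 0 <= x / 2 by lra.
have := sinh_ge y0; set a := expR (x / 2); set b := expR (- (x / 2)) => ab.
have -> : expR x = a ^+ 2 by rewrite -expRM_natl; congr expR; lra.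
have -> : expR (- x) = b ^+ 2 by rewrite -expRM_natl; congr expR; lra.
have ab1 : a * b = 1 by rewrite /a /b -expRD subrr expR0.
have -> : a ^+ 2 + b ^+ 2 = (a - b) ^+ 2 + 2 * (a * b) by ring.
rewrite ab1 mulr1 addrC lerD2r.
have -> : x ^+ 2 = (2 * (x / 2)) ^+ 2 by field.
by rewrite ler_sqr// nnegrE; lra.
Qed.

End exp_inequalities.

Lemma integrable_scale d (T : measurableType d) (R : realType)
    (mu : {measure set T -> \bar R}) (c : R) (f : T -> R) :
  mu.-integrable setT (EFin \o f) ->
  mu.-integrable setT (EFin \o (fun x => c * f x)).
Proof.
move=> fi; apply: eq_integrable (integrableZl measurableT c fi) => //.
Qed.

Section bounded_measurable.
Context d {T : measurableType d} {R : realType}.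
Implicit Types (f g : T -> R) (P : probability T R).

(** A class of test functions that are integrable for every probability measure and stable under
    kernels, exponentials and, away from zero, logarithms; no integrability has to be tracked along
    the chain. *)
Definition bmeas f := measurable_fun setT f /\ exists M, forall x, `|f x| <= M.

Lemma bmeas_integrable P f : bmeas f -> P.-integrable setT (EFin \o f).
Proof.
move=> [mf [M fM]]; apply: measurable_bounded_integrable => //.
  exact: (le_lt_trans (probability_le1 P measurableT) (ltry _)).
by exists M; split; rewrite ?num_real// => y My x _; exact: le_trans (fM x) (ltW My).
Qed.

Lemma bmeas_cst (c : R) : bmeas (cst c).
Proof. by split; [exact: measurable_cst|exists `|c|]. Qed.

Lemma bmeasD f g : bmeas f -> bmeas g -> bmeas (fun x => f x + g x).
Proof.
move=> [mf [M fM]] [mg [N gN]]; split; first exact: measurable_funD.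
by exists (M + N) => x; apply: le_trans (ler_normD _ _) _; exact: lerD.
Qed.

Lemma bmeasM f g : bmeas f -> bmeas g -> bmeas (fun x => f x * g x).
Proof.
move=> [mf [M fM]] [mg [N gN]]; split; first exact: measurable_funM.
by exists (M * N) => x; rewrite normrM; apply: ler_pM.
Qed.

Lemma bmeasZ (c : R) f : bmeas f -> bmeas (fun x => c * f x).
Proof. by move=> mf; apply: bmeasM => //; exact: bmeas_cst. Qed.

Lemma bmeasB f g : bmeas f -> bmeas g -> bmeas (fun x => f x - g x).
Proof.
move=> mf mg; apply: (bmeasD mf).
by under eq_fun do rewrite -mulN1r; exact: bmeasZ.
Qed.

Lemma bmeasX f n : bmeas f -> bmeas (fun x => f x ^+ n).
Proof.
move=> mf; elim: n => [|n IH]; first by under eq_fun do rewrite expr0; exact: bmeas_cst.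
by under eq_fun do rewrite exprS; exact: bmeasM.
Qed.

Lemma bmeas_expR f : bmeas f -> bmeas (fun x => expR (f x)).
Proof.
move=> [mf [M fM]]; split; first exact: measurableT_comp.
exists (expR M) => x; rewrite ger0_norm ?expR_ge0// ler_expR.
by apply: le_trans (ler_norm _) _.
Qed.

Lemma bmeas_ln f (c : R) : 0 < c -> (forall x, c <= f x) -> bmeas f ->
  bmeas (fun x => ln (f x)).
Proof.
move=> c0 cf [mf [M fM]]; split; first exact: measurableT_comp.
have fx0 x : 0 < f x by apply: lt_le_trans (cf x).
exists (`|ln c| + `|ln M|) => x.
have M0 : 0 < M by apply: lt_le_trans (fM x); rewrite normr_gt0 gt_eqF.
have h1 : ln c <= ln (f x) by rewrite ler_ln ?posrE.
have h2 : ln (f x) <= ln M by rewrite ler_ln ?posrE//; apply: le_trans (ler_norm _) _.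
have := ler_norm (ln M); have := lerNnormlW (lexx `|ln c|).
have := normr_ge0 (ln c); have := normr_ge0 (ln M).
by rewrite ler_norml; move=> *; apply/andP; split; lra.
Qed.

Lemma bmeas_indic (A : set T) : measurable A -> bmeas (\1_A : T -> R).
Proof.
move=> mA; split; first exact: measurable_indic.
by exists 1 => x; rewrite indicE; case: (x \in A); rewrite ?normr1 ?normr0.
Qed.

Lemma bmeas_min f (c : R) : measurable_fun setT f -> (forall x, 0 <= f x) ->
  bmeas (fun x => Num.min (f x) c).
Proof.
move=> mf f0; split; first by apply: measurable_minr.
exists `|c| => x; have := f0 x; have [fc|fc] := leP (f x) c => fx0 //.
by rewrite ger0_norm// (le_trans fc)// ler_norm.
Qed.

End bounded_measurable.

Section expectation.
Context d {T : measurableType d} {R : realType} (P : probability T R).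
Implicit Types f g : T -> R.

Lemma Rint_cst (c : R) : \int[P]_x c = c.
Proof.
rewrite Rintegral_cst// -[RHS]mulr1; congr (_ * _).
by rewrite -[RHS]/(fine 1%E); congr fine; exact: probability_setT.
Qed.

Lemma integral_cst_prob (c : R) : (\int[P]_x c%:E = c%:E)%E.
Proof.
rewrite integral_cst// -[RHS]mule1; congr (_ * _)%E.
exact: probability_setT.
Qed.

Lemma RintD f g : bmeas f -> bmeas g ->
  \int[P]_x (f x + g x) = \int[P]_x f x + \int[P]_x g x.
Proof. by move=> mf mg; rewrite RintegralD//; exact: bmeas_integrable. Qed.

Lemma RintB f g : bmeas f -> bmeas g ->
  \int[P]_x (f x - g x) = \int[P]_x f x - \int[P]_x g x.
Proof. by move=> mf mg; rewrite RintegralB//; exact: bmeas_integrable. Qed.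

Lemma RintZ (c : R) f : bmeas f -> \int[P]_x (c * f x) = c * \int[P]_x f x.
Proof. by move=> mf; rewrite RintegralZl//; exact: bmeas_integrable. Qed.

Lemma le_Rint f g : bmeas f -> bmeas g -> (forall x, f x <= g x) ->
  \int[P]_x f x <= \int[P]_x g x.
Proof. by move=> mf mg fg; apply: le_Rintegral => //; exact: bmeas_integrable. Qed.

Lemma Rint_ge (c : R) f : bmeas f -> (forall x, c <= f x) -> c <= \int[P]_x f x.
Proof. by move=> mf cf; rewrite -(Rint_cst c); apply: le_Rint => //; exact: bmeas_cst. Qed.

Lemma Rint_le (c : R) f : bmeas f -> (forall x, f x <= c) -> \int[P]_x f x <= c.
Proof. by move=> mf cf; rewrite -[leRHS](Rint_cst c); apply: le_Rint => //; exact: bmeas_cst. Qed.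

Lemma EFin_Rint f : P.-integrable setT (EFin \o f) ->
  (\int[P]_x f x)%:E = (\int[P]_x (f x)%:E)%E.
Proof. by move=> fi; rewrite /Rintegral fineK//; exact: integrable_fin_num. Qed.

Lemma Rint_indic (A : set T) : measurable A -> (\int[P]_x \1_A x)%:E = P A.
Proof.
move=> mA; rewrite EFin_Rint; last exact/bmeas_integrable/bmeas_indic.
by rewrite integral_indic// setIT.
Qed.

Lemma Rint_sum (I : Type) (r : seq I) (F : I -> T -> R) :
  (forall i, P.-integrable setT (EFin \o F i)) ->
  \int[P]_u (\sum_(i <- r) F i u) = \sum_(i <- r) \int[P]_u F i u.
Proof.
move=> iF; elim: r => [|i r IH].
  by rewrite big_nil; under eq_Rintegral do rewrite big_nil; exact: Rint_cst.
rewrite big_cons -IH -RintegralD//.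
  by apply: eq_Rintegral => u _; rewrite big_cons.
elim: r {IH} => [|j r IH].
  have := bmeas_integrable P (bmeas_cst (0 : R)); apply: eq_integrable => // u _.
  by rewrite /= big_nil.
by apply: eq_integrable (integrableD measurableT (iF j) IH) => // u _; rewrite /= big_cons.
Qed.

(** The tangent of [expR] at the mean [m] has integral [expR m]. Integrable functions are allowed
    because a linear term occurs in [log_harnack_lower]. *)
Lemma jensen_expR f : P.-integrable setT (EFin \o f) ->
  P.-integrable setT (EFin \o (fun x => expR (f x))) ->
  expR (\int[P]_x f x) <= \int[P]_x expR (f x).
Proof.
move=> fi ei; set m := \int[P]_x f x.
have ci (c : R) : P.-integrable setT (EFin \o cst c).
  exact/bmeas_integrable/bmeas_cst.
have H : \int[P]_x (expR m * (f x + (1 - m))) = expR m.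
  rewrite RintegralZl//; last exact: (integrableD _ fi (ci _)).
  rewrite RintegralD//; last exact: ci.
  by rewrite Rint_cst -/m addrC subrK mulr1.
rewrite -[leLHS]H; apply: le_Rintegral => //.
  apply: integrable_scale.
  exact: (integrableD _ fi (ci _)).
move=> x _; have := expR_ge1Dx (f x - m).
rewrite -(ler_pM2l (expR_gt0 m)) -expRD [in leRHS]addrC subrK.
by apply: le_trans; rewrite ler_pM2l ?expR_gt0//; lra.
Qed.

Lemma jensen_expR_bmeas f : bmeas f -> expR (\int[P]_x f x) <= \int[P]_x expR (f x).
Proof.
move=> mf; apply: jensen_expR; first exact: bmeas_integrable.
exact/bmeas_integrable/bmeas_expR.
Qed.

Definition var f := \int[P]_x (f x - \int[P]_y f y) ^+ 2.

Lemma var_ge0 f : 0 <= var f.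
Proof. by apply: Rintegral_ge0 => x _; exact: sqr_ge0. Qed.

Lemma Rint_sqrB (c : R) f : bmeas f ->
  \int[P]_x (f x - c) ^+ 2 = \int[P]_x (f x ^+ 2) - 2 * c * \int[P]_x f x + c ^+ 2.
Proof.
move=> mf; under eq_Rintegral => x _.
  rewrite (_ : _ ^+ 2 = f x ^+ 2 - 2 * c * f x + c ^+ 2); last by ring.
  over.
have m2 : bmeas (fun x => f x ^+ 2) by exact: bmeasX.
have mc : bmeas (fun x => 2 * c * f x) by exact: bmeasZ.
have mcst : bmeas (fun _ : T => c ^+ 2) by exact: bmeas_cst.
have mB : bmeas (fun x => f x ^+ 2 - 2 * c * f x) by exact: bmeasB.
by rewrite RintD// RintB// RintZ// Rint_cst.
Qed.

Lemma varE f : bmeas f -> var f = \int[P]_x (f x ^+ 2) - (\int[P]_x f x) ^+ 2.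
Proof. by move=> mf; rewrite /var Rint_sqrB//; ring. Qed.

Lemma sqr_Rint_le f : bmeas f -> (\int[P]_x f x) ^+ 2 <= \int[P]_x (f x ^+ 2).
Proof. by move=> mf; rewrite -subr_ge0 -varE// var_ge0. Qed.

(** Adding the bounds at [a] and [- a] and applying [cosh_ge] bounds the second moment by
    [s / b * (expR b - 1)], where [b = a ^+ 2 * s / 2]; then [b] tends to 0. *)
Lemma subgaussian_second_moment g (s : R) : 0 < s -> measurable_fun setT g ->
  (forall a, (\int[P]_x (expR (a * g x))%:E <= (expR (a ^+ 2 * s / 2))%:E)%E) ->
  (\int[P]_x (g x ^+ 2)%:E <= s%:E)%E.
Proof.
move=> s0 mg H.
have mg2 : measurable_fun setT (fun x => (g x ^+ 2)%:E).
  by apply/measurable_EFinP; exact: measurable_funX.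
have me (a : R) : measurable_fun setT (fun x => (expR (a * g x))%:E).
  by apply/measurable_EFinP; apply: measurableT_comp => //; exact: measurable_funM.
have step b : 0 < b -> b < 1 -> (\int[P]_x (g x ^+ 2)%:E <= (s / (1 - b))%:E)%E.
  move=> b0 b1.
  pose a := Num.sqrt (2 * b / s).
  have a2 : a ^+ 2 = 2 * b / s by rewrite sqr_sqrtr// divr_ge0//; lra.
  have a2s : a ^+ 2 * s / 2 = b by rewrite a2; field; exact: lt0r_neq0.
  have a20 : 0 < a ^+ 2 by rewrite a2 divr_gt0//; lra.
  have : (\int[P]_x (2 + a ^+ 2 * g x ^+ 2)%:E <= (2 * expR b)%:E)%E.
    have := leeD (H a) (H (- a)); rewrite sqrrN a2s -EFinD.
    rewrite (_ : expR b + expR b = 2 * expR b); last by ring.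
    apply: le_trans.
    rewrite -ge0_integralD//; do ?by move=> x _; rewrite lee_fin expR_ge0.
    apply: ge0_le_integral => //.
    - by move=> x _; rewrite lee_fin; have := sqr_ge0 (g x); nra.
    - apply/measurable_EFinP; apply: measurable_funD => //.
      by apply: measurable_funM => //; exact: measurable_funX.
    - exact: emeasurable_funD.
    - by move=> x _; rewrite -EFinD lee_fin -exprMn mulNr; exact: cosh_ge.
  under eq_integral do rewrite EFinD EFinM.
  rewrite ge0_integralD//; last 2 first.
  - by move=> x _; rewrite -EFinM lee_fin mulr_ge0// ?sqr_ge0.
  - exact: measurable_funeM.
  rewrite integral_cst_prob ge0_integralZl_EFin//; last 2 first.
  - by move=> x _; rewrite lee_fin sqr_ge0.
  - exact: sqr_ge0.
  rewrite addeC -leeBrDr// -EFinB -lee_pdivlMl//.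
  move=> h; apply: le_trans h _; rewrite -EFinM lee_fin a2.
  have eb : expR b <= (1 - b)^-1.
    have := expR_ge1Dx (- b); rewrite expRN -(ler_pV2 (x := (expR b)^-1))
      ?inE ?unitf_gt0 ?invr_gt0 ?expR_gt0//= ?invrK//; lra.
  have -> : (2 * b / s)^-1 * (2 * expR b - 2) = s / b * (expR b - 1).
    by field; rewrite !gt_eqF.
  have sb0 : 0 < s / b by rewrite divr_gt0.
  apply: (@le_trans _ _ (s / b * ((1 - b)^-1 - 1))).
    by rewrite ler_pM2l// lerD2r.
  rewrite le_eqVlt; apply/orP; left; apply/eqP; field.
  by rewrite !gt_eqF//; lra.
apply/lee_addgt0Pr => e e0; rewrite -EFinD.
(* Chosen so that [s / (1 - b) = s + e]. *)
pose b := e / (s + e).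
have b0 : 0 < b by rewrite divr_gt0//; lra.
have b1 : b < 1 by rewrite ltr_pdivrMr; lra.
have := step b b0 b1; congr (_ <= _%:E)%E; rewrite /b.
by field; rewrite !gt_eqF//; lra.
Qed.

End expectation.

(** * Gibbs kernels *)

Section prekopa_log.
Context {R : realType} {d : nat}.
Notation E := 'rV[R]_d.
Notation leb := (@lebesgue_rV R d).

Lemma prekopa_ln (l : R) (f0 f1 f2 : E -> R) (I0 I1 I2 : R) : 0 < l -> l < 1 ->
  measurable_fun setT f0 -> measurable_fun setT f1 -> measurable_fun setT f2 ->
  (forall u v, (1 - l) * f0 u + l * f1 v <= f2 ((1 - l) *: u + l *: v)) ->
  0 < I0 -> 0 < I1 ->
  I0%:E = (\int[leb]_x (expR (f0 x))%:E)%E ->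
  I1%:E = (\int[leb]_x (expR (f1 x))%:E)%E ->
  I2%:E = (\int[leb]_x (expR (f2 x))%:E)%E ->
  (1 - l) * ln I0 + l * ln I1 <= ln I2.
Proof.
move=> l0 l1 mf0 mf1 mf2 f012 I00 I10 E0 E1 E2.
have l1' : 0 < 1 - l by lra.
have powE (x k : R) : 0 < x -> x `^ k = expR (k * ln x).
  by move=> x0; rewrite /powR gt_eqF.
(* The factor [r < 1] supplies the strict inequalities that [prekopa_leindler] asks for; it tends to
   1 at the end, as [expR (- e)]. *)
have key r : 0 < r -> r < 1 -> (r * I0) `^ (1 - l) * (r * I1) `^ l <= I2.
  move=> r0 r1; rewrite -lee_fin E2.
  have mE (f : E -> R) : measurable_fun setT f -> measurable_fun setT (fun x => (expR (f x))%:E).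
    by move=> mf; apply/measurable_EFinP; exact: measurableT_comp.
  apply: (prekopa_leindler l0 l1 (mE _ mf0) (mE _ mf1) (mE _ mf2)).
  - by move=> x; rewrite lee_fin expR_ge0.
  - by move=> x; rewrite lee_fin expR_ge0.
  - by move=> x; rewrite lee_fin expR_ge0.
  - move=> u v s t s0 t0; rewrite !lte_fin lee_fin => su tv.
    rewrite !powE// -expRD ler_expR; apply: le_trans (f012 u v).
    apply: lerD; rewrite ler_pM2l// -ler_expR lnK ?posrE// ltW//.
  - exact: mulr_gt0.
  - exact: mulr_gt0.
  - by rewrite -E0 lte_fin gtr_pMl.
  - by rewrite -E1 lte_fin gtr_pMl.
have key2 r : 0 < r -> r < 1 -> ln r + ((1 - l) * ln I0 + l * ln I1) <= ln I2.
  move=> r0 r1; have := key r r0 r1.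
  have rI0 : 0 < r * I0 by exact: mulr_gt0.
  have rI1 : 0 < r * I1 by exact: mulr_gt0.
  rewrite !powE// -expRD !lnM ?posrE//.
  have -> : (1 - l) * (ln r + ln I0) + l * (ln r + ln I1) =
    ln r + ((1 - l) * ln I0 + l * ln I1) by ring.
  move=> h; rewrite -[leLHS]expRK ler_ln ?posrE ?expR_gt0//.
  by apply: lt_le_trans h; exact: expR_gt0.
apply/ler_addgt0Pr => e e0.
have := key2 (expR (- e)) (expR_gt0 _).
rewrite expRK expR_lt1 oppr_lt0 => /(_ e0); lra.
Qed.

End prekopa_log.

Section gibbs_kernel.
Context {R : realType} {d : nat}.
Notation E := 'rV[R]_d.
Notation leb := (@lebesgue_rV R d).
Variables (h : {posnum R}) (W : potential R d).
Implicit Types x y u : E.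
Local Open Scope ereal_scope.

Definition gibbs_prob y (B : set E) : \bar R :=
  \int[leb]_(u in B) (gibbs_density h W y u)%:E.

Let measurable_density y : measurable_fun setT (fun u => (gibbs_density h W y u)%:E).
Proof.
apply/measurable_EFinP.
have -> : gibbs_density h W y = (fun p : E * E => gibbs_density h W p.1 p.2) \o pair y by [].
apply: measurableT_comp; [exact: measurable_gibbs_density2|exact: measurable_pair1].
Qed.

Let gibbs0 y : gibbs_prob y set0 = 0.
Proof. exact: integral_set0. Qed.

Let gibbs_ge0 y B : 0 <= gibbs_prob y B.
Proof. by apply: integral_ge0 => u _; rewrite lee_fin gibbs_density_ge0. Qed.

Let gibbs_sigma_additive y : semi_sigma_additive (gibbs_prob y).
Proof.
apply: semi_sigma_additive_nng_induced; first exact: measurable_density.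
by move=> u; rewrite lee_fin gibbs_density_ge0.
Qed.

HB.instance Definition _ y := isMeasure.Build _ _ _
  (gibbs_prob y) (gibbs0 y) (@gibbs_ge0 y) (@gibbs_sigma_additive y).

Let measurable_gibbs_prob B : measurable B -> measurable_fun setT (gibbs_prob ^~ B).
Proof.
move=> mB; rewrite (_ : gibbs_prob ^~ B = fun y =>
    \int[leb]_u ((gibbs_density h W y u)%:E * (\1_B u)%:E)); last first.
  apply/funext => y; rewrite /gibbs_prob integral_mkcond.
  by apply: eq_integral => u _; rewrite epatch_indic.
apply: (@measurable_fun_fubini_tonelli_F _ _ E E R leb
  (fun p => (gibbs_density h W p.1 p.2)%:E * (\1_B p.2)%:E)).
  apply: emeasurable_funM.
    by apply/measurable_EFinP; exact: measurable_gibbs_density2.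
  apply/measurable_EFinP; apply: measurableT_comp; last exact: measurable_snd.
  exact: measurable_indic.
by move=> p; rewrite mule_ge0// lee_fin ?gibbs_density_ge0.
Qed.

Lemma ge0_integral_gibbs_prob y (f : E -> \bar R) : measurable_fun setT f ->
  (forall u, 0 <= f u) ->
  \int[gibbs_prob y]_u f u = \int[leb]_u ((gibbs_density h W y u)%:E * f u).
Proof.
move=> mf f0.
rewrite (@ge0_integral_mixture _ _ E E R leb (gibbs_prob y) (gibbs_density h W y)
  (fun u => \d_u)) //.
- by under eq_integral do rewrite integral_dirac// diracT mul1e.
- by move=> u; exact: gibbs_density_ge0.
- by apply/measurable_EFinP; exact: measurable_density.
- by move=> U mU; exact: measurable_fun_dirac.
- move=> U mU; rewrite /= /gibbs_prob integral_mkcond.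
  by apply: eq_integral => u _; rewrite epatch_indic.
Qed.

Let integral_gibbs_prob_gw y (f : E -> R) : measurable_fun setT f ->
  (forall u, (0 <= f u)%R) ->
  \int[gibbs_prob y]_u (f u)%:E =
  (gZ h W y)^-1%:E * \int[leb]_u (f u * gw h W y u)%:E.
Proof.
move=> mf f0; rewrite ge0_integral_gibbs_prob//; last first.
  exact/measurable_EFinP.
rewrite -ge0_integralZl_EFin//.
- by apply: eq_integral => u _; rewrite -!EFinM /gibbs_density; congr EFin; ring.
- by move=> u _; rewrite lee_fin mulr_ge0// ltW// gw_gt0.
- by apply/measurable_EFinP; apply: measurable_funM => //; exact: measurable_gw.
- by rewrite invr_ge0 ltW// gZ_gt0.
Qed.

Let gibbs_prob_setT y : gibbs_prob y setT = 1.
Proof.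
rewrite -[LHS]mul1e -(@integral_cst _ _ _ (gibbs_prob y) _ measurableT 1%E).
rewrite [LHS](@integral_gibbs_prob_gw y (cst 1%R) (measurable_cst _) (fun=> ler01)).
under eq_integral do rewrite /cst mul1r.
by rewrite -EFin_gZ -EFinM mulVf// gt_eqF// gZ_gt0.
Qed.

HB.instance Definition _ y := Measure_isProbability.Build _ _ _
  (gibbs_prob y) (gibbs_prob_setT y).

Definition gibbs y : probability E R := gibbs_prob y.

Lemma measurable_gibbs B : measurable B -> measurable_fun setT (gibbs ^~ B).
Proof. exact: measurable_gibbs_prob. Qed.

Lemma integral_gibbs_gw y (f : E -> R) : measurable_fun setT f ->
  (forall u, (0 <= f u)%R) ->
  \int[gibbs y]_u (f u)%:E =
  (gZ h W y)^-1%:E * \int[leb]_u (f u * gw h W y u)%:E.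
Proof. exact: integral_gibbs_prob_gw. Qed.

Lemma gZ_integral_gibbs y (f : E -> R) : measurable_fun setT f ->
  (forall u, (0 <= f u)%R) ->
  (gZ h W y)%:E * \int[gibbs y]_u (f u)%:E = \int[leb]_u (f u * gw h W y u)%:E.
Proof.
move=> mf f0; rewrite integral_gibbs_gw// muleA -EFinM divff ?mul1e//.
by rewrite gt_eqF// gZ_gt0.
Qed.

Lemma law_of_density_gibbs y B : measurable B ->
  law_of_density (backward_density h%:num W y) B = gibbs y B.
Proof.
move=> mB; rewrite /law_of_density -EFin_gZ /gibbs/= /gibbs_prob.
rewrite inver gt_eqF ?gZ_gt0// muleC -ge0_integralZl_EFin//.
- by apply: eq_integral => u _; rewrite -EFinM /gibbs_density mulrC.
- by move=> u _; rewrite lee_fin expR_ge0.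
- by apply: measurable_funTS; apply/measurable_EFinP; exact: measurable_gw.
- by rewrite invr_ge0 ltW// gZ_gt0.
Qed.

End gibbs_kernel.

(** Locked, so that iterated operators are not unfolded into nested integrals. *)
HB.lock Definition kop {R : realType} {d} {T : measurableType d}
  (k : T -> probability T R) (f : T -> R) (x : T) : R := \int[k x]_u f u.

Section kernel_operator.
Context {R : realType} d {T : measurableType d}.
Variable k : T -> probability T R.
Hypothesis mk : forall B, measurable B -> measurable_fun setT (k ^~ B).
Implicit Types f g : T -> R.

Local Notation kop := (kop k).

Lemma kopE f x : kop f x = \int[k x]_u f u.
Proof. by rewrite kop.unlock. Qed.

Lemma bmeas_kop f : bmeas f -> bmeas (kop f).
Proof.
move=> mf; have [mf' [M fM]] := mf; split; last first.
  exists M => x; rewrite kopE ler_norml; apply/andP; split.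
    by apply: Rint_ge => // u; have := fM u; rewrite ler_norml => /andP[].
  by apply: Rint_le => // u; exact: le_trans (ler_norm _) _.
(* Shifting by the bound [M] makes the integrand nonnegative, as measurability of kernel integrals
   requires. *)
have -> : kop f = (fun x => fine (\int[k x]_u (f u + M)%:E) - M).
  apply/funext => x; rewrite kopE -[fine _]/(\int[k x]_u (f u + M)) RintD//; last exact: bmeas_cst.
  by rewrite Rint_cst addrK.
apply: measurable_funB => //; apply: (measurableT_comp (f := fine)) => //.
apply: (@measurable_fun_integral_kernel _ _ T T R k) => //.
- by move=> z; rewrite lee_fin -lerBlDr sub0r; have := fM z; rewrite ler_norml => /andP[].
- by apply/measurable_EFinP; exact: measurable_funD.
Qed.

Lemma kop_cst c x : kop (cst c) x = c.
Proof. by rewrite kopE; exact: Rint_cst. Qed.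

Lemma kop_le f g x : bmeas f -> bmeas g -> (forall u, f u <= g u) -> kop f x <= kop g x.
Proof. by rewrite !kopE; exact: le_Rint. Qed.

Lemma var_kop f x : var (k x) f = kop (fun u => (f u - kop f x) ^+ 2) x.
Proof. by rewrite !kopE. Qed.

Lemma var_kopE f x : bmeas f -> var (k x) f = kop (fun u => f u ^+ 2) x - kop f x ^+ 2.
Proof. by move=> mf; rewrite !kopE varE. Qed.

Lemma kopZ c f x : bmeas f -> kop (fun u => c * f u) x = c * kop f x.
Proof. by rewrite !kopE; exact: RintZ. Qed.

Lemma kopD f g x : bmeas f -> bmeas g -> kop (fun u => f u + g u) x = kop f x + kop g x.
Proof. by rewrite !kopE; exact: RintD. Qed.

Lemma EFin_kop f x : bmeas f -> (kop f x)%:E = (\int[k x]_u (f u)%:E)%E.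
Proof. by move=> mf; rewrite kopE; apply: EFin_Rint; exact: bmeas_integrable. Qed.

Lemma jensen_kop f x : bmeas f -> expR (kop f x) <= kop (fun u => expR (f u)) x.
Proof. by rewrite !kopE; exact: jensen_expR_bmeas. Qed.

Lemma ln_kop_expR_ge f x : bmeas f -> kop f x <= ln (kop (fun u => expR (f u)) x).
Proof.
move=> mf; rewrite -[leLHS]expRK ler_ln ?posrE ?expR_gt0//; first exact: jensen_kop.
by apply: lt_le_trans (jensen_kop x mf); exact: expR_gt0.
Qed.

End kernel_operator.

Section real_inequalities.
Context {R : realType}.

Lemma log_balance (zy k s zx J a : R) : 0 < zy -> 0 < k -> 0 < zx ->
  zy * k = expR (- s) * (zx * J) -> expR a <= J -> a - s + ln zx <= ln k + ln zy.
Proof.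
move=> zy0 k0 zx0 H aJ; have J0 : 0 < J by apply: lt_le_trans aJ; exact: expR_gt0.
have := congr1 (@ln R) H; rewrite !lnM ?posrE ?mulr_gt0 ?expR_gt0// expRK.
have : a <= ln J by rewrite -[leLHS]expRK ler_ln ?posrE ?expR_gt0.
lra.
Qed.

(** Here [A], [B], [C] stand for the values of a concave function at x - t v, x and x + v, and [b]
    for its slope at x in the direction v. *)
Lemma concave_tangent (A B C b s t : R) : 0 < t ->
  - (t * b) - t ^+ 2 * s + B <= A ->
  (1 - t / (1 + t)) * A + t / (1 + t) * C <= B -> C <= B + b + t * s.
Proof.
move=> t0 H; have t1 : 0 < 1 + t by lra.
rewrite -(ler_pM2r t1).
have -> : ((1 - t / (1 + t)) * A + t / (1 + t) * C) * (1 + t) = A + t * C.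
  by field; rewrite gt_eqF.
move=> H2; rewrite -(ler_pM2l t0).
have -> : t * (B + b + t * s) = t * B + t * b + t ^+ 2 * s by ring.
lra.
Qed.

Lemma log_harnack_arith (A H b s z zy : R) :
  A + b - s + z <= H + zy -> zy <= z + b -> A <= H + s.
Proof. lra. Qed.

Lemma transport_limit (F G D h : R) : 0 < h -> 0 <= D ->
  (forall s, 0 < s -> s * h < 1 -> F <= G + D / (2 * (s * h))) -> F <= G + D / 2.
Proof.
move=> h0 D0 H; apply/ler_addgt0Pr => e e0.
(* [r] is the value of [s * h], close enough to 1 for [D / (2 * r)] to exceed [D / 2] by at most
   [e]. *)
pose r := (1 + 2 * e / (D + 1))^-1.
have D1 : 0 < D + 1 by lra.
have q0 : 0 < 2 * e / (D + 1) by rewrite divr_gt0 ?mulr_gt0.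
have r0 : 0 < r by rewrite invr_gt0; lra.
have r1 : r < 1 by rewrite invf_lt1; lra.
have := H (r / h) (divr_gt0 r0 h0); rewrite divfK ?gt_eqF// => /(_ r1).
have -> : D / (2 * r) = D / 2 + D / (D + 1) * e.
  by rewrite /r; field; rewrite !gt_eqF//; lra.
have : D / (D + 1) <= 1 by rewrite ler_pdivrMr//; lra.
move: (D / (D + 1)) => w w1; nra.
Qed.

(** The bound is optimal at [t = r]; taking [t = r + e] keeps [t] positive when [r = 0]. *)
Lemma lipschitz_limit (F G r : R) : 0 <= r ->
  (forall t, 0 < t -> F <= G + t / 2 + r ^+ 2 / (2 * t)) -> F <= G + r.
Proof.
move=> r0 H; apply/ler_addgt0Pr => e e0.
have := H (r + e) (ltr_wpDl r0 e0).
have : r ^+ 2 / (2 * (r + e)) <= (r + e) / 2.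
  by rewrite ler_pdivrMr; [nra|lra].
lra.
Qed.

Lemma young_half (t r : R) : 0 < t -> r <= t / 2 + r ^+ 2 / (2 * t).
Proof.
move=> t0; rewrite -subr_ge0.
have -> : t / 2 + r ^+ 2 / (2 * t) - r = (r - t) ^+ 2 / (2 * t) by field; rewrite gt_eqF.
by rewrite divr_ge0 ?sqr_ge0// mulr_ge0// ltW.
Qed.

Lemma subgaussian_limit (M : R -> R) (h : R) : 0 < h -> M 0 = 1 ->
  (forall s tau, 0 < s -> s * h < 1 -> M (s * tau) <= expR (s * tau ^+ 2 / 2)) ->
  forall a, M a <= expR (a ^+ 2 * h / 2).
Proof.
move=> h0 M0 H a; apply/ler_addgt0Pr => e e0.
have [->|a0] := eqVneq a 0.
  by rewrite M0 expr0n/= !mul0r expR0; lra.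
have a20 : 0 < a ^+ 2 by rewrite exprn_even_gt0.
set B := expR (a ^+ 2 * h / 2).
have B0 : 0 < B by exact: expR_gt0.
have l0 : 0 < ln (1 + e / B) by rewrite ln_gt0// ltrDl divr_gt0.
(* [1/q] is slightly below [1/h], so that [a^2 q / 2] is slightly above [a^2 h / 2] *)
pose q := h + 2 * ln (1 + e / B) / a ^+ 2.
have qh : h < q by rewrite ltrDl divr_gt0// mulr_gt0.
have q0 : 0 < q by exact: lt_trans qh.
have qh1 : q^-1 * h < 1 by rewrite mulrC ltr_pdivrMr// mul1r.
have q0' : 0 < q^-1 by rewrite invr_gt0.
have := H _ (a * q) q0' qh1.
have -> : q^-1 * (a * q) = a by rewrite mulrCA mulVf ?mulr1 ?gt_eqF.
have -> : q^-1 * (a * q) ^+ 2 / 2 = a ^+ 2 * q / 2 by field; rewrite gt_eqF.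
have -> : a ^+ 2 * q / 2 = a ^+ 2 * h / 2 + ln (1 + e / B) by rewrite /q; field.
rewrite expRD lnK ?posrE; last by rewrite addr_gt0 ?divr_gt0.
by rewrite -/B mulrDr mulr1 mulrCA divff ?gt_eqF// mulr1.
Qed.

(** Young's inequality for [tau * r]: it makes [tau * f - tau ^+ 2 / 2] and [tau * f] an admissible
    pair in [gibbs_talagrand] when [f] is 1-Lipschitz. *)
Lemma scaled_lipschitz (tau r : R) : 0 <= r -> forall fu fv : R, fv <= fu + r -> fu <= fv + r ->
  tau * fu - tau ^+ 2 / 2 <= tau * fv + r ^+ 2 / 2.
Proof.
move=> r0 fu fv H1 H2.
have := sqr_ge0 (r - tau); have := sqr_ge0 (r + tau).
have [t0|t0] := leP 0 tau; nra.
Qed.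

Lemma exp_centered (a b m M : R) : 0 < M -> ln (expR (a * m - b) * M) <= a * m -> M <= expR b.
Proof.
move=> M0; rewrite lnM ?posrE ?expR_gt0// expRK => L.
rewrite -[leLHS]lnK ?posrE// ler_expR; lra.
Qed.

Lemma divide_bound (t A B D : R) : 0 < t -> t * A <= t * B + D / 2 -> A <= B + D / (2 * t).
Proof.
move=> t0 H; rewrite -(ler_pM2l t0) (_ : t * (B + _) = t * B + D / 2)//.
by field; rewrite gt_eqF.
Qed.

Lemma divide_bound2 (s h A B C D : R) : 0 < s -> 0 < h ->
  s * A <= C + D / (2 * h) -> C <= s * B -> A <= B + D / (2 * (s * h)).
Proof.
move=> s0 h0 H1 H2; rewrite -(ler_pM2l s0).
rewrite (_ : s * (B + _) = s * B + D / (2 * h)); last by field; rewrite !gt_eqF.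
by apply: le_trans H1 _; rewrite lerD2r.
Qed.

End real_inequalities.

Opaque gZ gibbs Rintegral.

Section gibbs_inequalities.
Context {R : realType} {d : nat}.
Notation E := 'rV[R]_d.
Notation leb := (@lebesgue_rV R d).
Variables (h : {posnum R}) (W : potential R d).
Implicit Types (x y u v : E) (f : E -> R).
Notation K := (kop (gibbs h W)).
Notation h' := (h%:num).

Let h0 : 0 < h'. Proof. by []. Qed.

Let lgw y u : R := - W u - sqnorm (u - y) / (2 * h').

Let measurable_lgw y : measurable_fun setT (lgw y).
Proof.
apply: measurable_funB; first by apply: measurableT_comp => //; exact: pot_measurable.
by apply: measurable_funM => //; exact: measurable_sqnormB.
Qed.

(** The unnormalized form of the expectation, to which [prekopa_ln] applies. *)
Let integral_exp_lgw f y : bmeas f ->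
  (gZ h W y * K (fun u => expR (f u)) y)%:E =
  (\int[leb]_u (expR (f u + lgw y u))%:E)%E.
Proof.
move=> mf; rewrite EFinM (EFin_kop (gibbs h W) y (bmeas_expR mf)).
rewrite gZ_integral_gibbs; [|by case: (bmeas_expR mf)|by move=> u; exact: expR_ge0].
by apply: eq_integral => u _; rewrite expRD.
Qed.

Let kop_exp_gt0 f y : bmeas f -> 0 < K (fun u => expR (f u)) y.
Proof.
by move=> mf; apply: lt_le_trans (jensen_kop _ _ mf); exact: expR_gt0.
Qed.

(** The weight is jointly log-concave in the centre and the point, and by Prekopa-Leindler
    integrating out the point preserves log-concavity. *)
Lemma gZ_log_concave (l : R) x y : 0 < l -> l < 1 ->
  (1 - l) * ln (gZ h W x) + l * ln (gZ h W y) <= ln (gZ h W ((1 - l) *: x + l *: y)).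
Proof.
move=> l0 l1; have l1' : 0 < 1 - l by lra.
apply: (prekopa_ln l0 l1 (measurable_lgw x) (measurable_lgw y)
  (measurable_lgw ((1 - l) *: x + l *: y))).
- move=> u v; rewrite /lgw.
  have -> : (1 - l) *: u + l *: v - ((1 - l) *: x + l *: y) =
    (1 - l) *: (u - x) + l *: (v - y).
    by rewrite !scalerBr opprD addrACA.
  rewrite sqnorm_convex.
  have := pot_convex W u v l0 l1; have := sqnorm_ge0 (u - x - (v - y)).
  set a := sqnorm (u - x); set b := sqnorm (v - y); set c := sqnorm _.
  move=> c0 Wl.
  have -> : (1 - l) * (- W u - a / (2 * h')) + l * (- W v - b / (2 * h')) =
    - ((1 - l) * W u + l * W v) - ((1 - l) * a + l * b) / (2 * h') by field; rewrite gt_eqF.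
  apply: lerD; first by rewrite lerN2.
  have lc : 0 <= l * (1 - l) * c by rewrite mulr_ge0// mulr_ge0// ltW.
  by rewrite lerN2 ler_pM2r ?invr_gt0 ?mulr_gt0//; lra.
- by apply: gZ_gt0.
- by apply: gZ_gt0.
- by apply: EFin_gZ.
- by apply: EFin_gZ.
- by apply: EFin_gZ.
Qed.

(* The dual form of Talagrand's transport inequality with constant [h]. *)
Lemma gibbs_talagrand (s : R) (f g : E -> R) y : 0 < s -> s * h' < 1 ->
  bmeas f -> bmeas g -> (forall u v, f u <= g v + sqnorm (u - v) / 2) ->
  ln (K (fun u => expR (s * f u)) y) <= s * K g y.
Proof.
move=> s0 sh mf mg fg.
pose l := s * h'; have l0 : 0 < l by rewrite mulr_gt0.
have l1 : l < 1 by []. have l1' : 0 < 1 - l by lra.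
have msf : bmeas (fun u => s * f u) by exact: bmeasZ.
(* With this multiple of [g], the combination [(1 - l) * (s * f u) + l * g' v] equals
   [s * (1 - l) * (f u - g v)], which the defect term of [sqnorm_convex] dominates because
   [l = s * h]. *)
pose g' u := - ((1 - l) / h') * g u.
have mg' : bmeas g' by exact: bmeasZ.
have I1 := integral_exp_lgw y msf.
have I2 := integral_exp_lgw y mg'.
have p1 := kop_exp_gt0 y msf.
have p2 := kop_exp_gt0 y mg'.
have Z0 := gZ_gt0 h W y.
have key : (1 - l) * ln (gZ h W y * K (fun u => expR (s * f u)) y) +
    l * ln (gZ h W y * K (fun u => expR (g' u)) y) <= ln (gZ h W y).
  apply: (prekopa_ln l0 l1 _ _ (measurable_lgw y) _ _ _ I1 I2 (EFin_gZ h W y)).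
  - by apply: measurable_funD => //; case: msf.
  - by apply: measurable_funD => //; case: mg'.
  - move=> u v; rewrite /lgw.
    have -> : (1 - l) *: u + l *: v - y = (1 - l) *: (u - y) + l *: (v - y).
      rewrite !scalerBr addrACA -opprD -scalerDl subrK scale1r//.
    rewrite sqnorm_convex (_ : u - y - (v - y) = u - v); last first.
      by rewrite opprB addrA subrK.
    have := pot_convex W u v l0 l1; have := fg u v.
    set a := sqnorm (u - y); set b := sqnorm (v - y); set c := sqnorm (u - v).
    move=> fgc Wl.
    have -> : (1 - l) * (s * f u + (- W u - a / (2 * h'))) +
        l * (g' v + (- W v - b / (2 * h'))) =
      - ((1 - l) * W u + l * W v) +
      (s * (1 - l) * (f u - g v) - ((1 - l) * a + l * b) / (2 * h')).
      by rewrite /g' /l; field; rewrite gt_eqF.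
    apply: lerD; first by rewrite lerN2.
    have -> : - (((1 - l) * a + l * b - l * (1 - l) * c) / (2 * h')) =
      s * (1 - l) * (c / 2) - ((1 - l) * a + l * b) / (2 * h').
      by rewrite /l; field; rewrite gt_eqF.
    rewrite lerD2r ler_pM2l ?mulr_gt0//; lra.
  - exact: mulr_gt0.
  - exact: mulr_gt0.
rewrite !lnM ?posrE// in key.
(* Jensen's inequality replaces the exponential moment of [g'] by the mean of [g]. *)
have := ln_kop_expR_ge (gibbs h W) y mg'.
rewrite /g' kopZ// -/g' => jg.
have lh : l * (- ((1 - l) / h') * K g y) = - ((1 - l) * (s * K g y)).
  by rewrite /l; field; rewrite gt_eqF.
rewrite -(ler_pM2l l1').
have := ler_wpM2l (ltW l0) jg; rewrite lh; move: key.
move: (ln (gZ h W y)) (ln (K _ y)) (ln (K _ y)) (K g y) => Z A B G; lra.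
Qed.

(** Whatever the potential, the laws centred at [x] and at [x + v] are exponential tilts of each
    other by a linear function. *)
Let gw_tilt x v u : gw h W (x + v) u =
  expR (dot (u - x) v / h' - sqnorm v / (2 * h')) * gw h W x u.
Proof.
rewrite /gw /backward_density -expRD; congr expR.
have -> : u - (x + v) = (u - x) - v by rewrite opprD addrA.
by rewrite (sqnormB (u - x)); field; rewrite gt_eqF.
Qed.

Let lin x v u := dot (u - x) v / h'.

Let measurable_lin x v : measurable_fun setT (lin x v).
Proof.
apply: measurable_funM => //; under eq_fun do rewrite dotBl.
by apply: measurable_funB => //; exact: measurable_dot.
Qed.

Lemma gibbs_mgf x v :
  (\int[gibbs h W x]_u (expR (dot (u - x) v / h'))%:E =
   (expR (sqnorm v / (2 * h')) * gZ h W (x + v) / gZ h W x)%:E)%E.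
Proof.
rewrite integral_gibbs_gw; last 2 first.
- by apply: measurableT_comp => //; exact: measurable_lin.
- by move=> u; exact: expR_ge0.
have -> : (\int[leb]_u (expR (dot (u - x) v / h') * gw h W x u)%:E =
    \int[leb]_u ((expR (sqnorm v / (2 * h')))%:E * (gw h W (x + v) u)%:E))%E.
  apply: eq_integral => u _; rewrite gw_tilt -EFinM; congr EFin.
  rewrite [RHS]mulrA -[in RHS]expRD; congr (expR _ * _).
  by rewrite [RHS]addrC subrK.
rewrite ge0_integralZl_EFin ?expR_ge0//.
- by rewrite -EFin_gZ -!EFinM mulrC.
- by move=> u _; rewrite lee_fin ltW// gw_gt0.
- exact: measurable_gwE.
Qed.

Let integrable_exp_lin x v (f : E -> R) : bmeas f ->
  (gibbs h W x).-integrable setT (EFin \o (fun u => expR (f u + lin x v u))).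
Proof.
move=> [mf [M fM]]; apply/integrableP; split.
  by apply/measurable_EFinP; apply: measurableT_comp => //; exact: measurable_funD.
apply: (@le_lt_trans _ _ (\int[gibbs h W x]_u ((expR M)%:E * (expR (lin x v u))%:E))%E).
  apply: ge0_le_integral => //.
  - apply/measurable_EFinP; apply: measurableT_comp => //.
    by apply: measurableT_comp => //; exact: measurable_funD.
  - apply: measurable_funeM; apply/measurable_EFinP; exact: measurableT_comp.
  - move=> u _; rewrite /= lee_fin ger0_norm ?expR_ge0// expRD ler_pM2r ?expR_gt0//.
    by rewrite ler_expR; apply: le_trans (ler_norm _) _.
rewrite ge0_integralZl_EFin//;
  do ?[exact: expR_ge0 | by apply/measurable_EFinP; exact: measurableT_comp].
by rewrite gibbs_mgf -EFinM ltry.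
Qed.

(** A number is dominated by the sum of its exponential and that of its opposite, and both
    exponential moments are finite by [gibbs_mgf]. *)
Lemma integrable_gibbs_lin x v :
  (gibbs h W x).-integrable setT (EFin \o (fun u => dot (u - x) v / h')).
Proof.
have m0 : bmeas (cst 0 : E -> R) by exact: bmeas_cst.
have i1 := integrable_exp_lin x v m0.
have i2 := integrable_exp_lin x (- v) m0.
apply: (le_integrable measurableT _ _ (integrableD measurableT i1 i2)).
  by apply/measurable_EFinP; exact: measurable_lin.
move=> u _; rewrite /= /cst !add0r lee_fin.
have := @cosh_ge R (lin x v u); have := expR_gt0 (lin x v u).
have := expR_gt0 (- lin x v u).
have -> : lin x (- v) u = - lin x v u by rewrite /lin dotNr mulNr.
have := expR_ge1Dx (- lin x v u); have := expR_ge1Dx (lin x v u).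
rewrite -/(lin x v u); move: (lin x v u) => a e1 e2 e3 e4 ch.
rewrite [leRHS]ger0_norm; last by lra.
by rewrite ler_norml; apply/andP; split; lra.
Qed.
(* Jensen's inequality after a change of measure from [gibbs x] to [gibbs (x + v)]. *)
Let log_harnack_lower f x v : bmeas f ->
  K f x + \int[gibbs h W x]_u (dot (u - x) v / h') - sqnorm v / (2 * h') +
    ln (gZ h W x) <=
  ln (K (fun u => expR (f u)) (x + v)) + ln (gZ h W (x + v)).
Proof.
move=> mf.
have Zx := gZ_gt0 h W x. have Zy := gZ_gt0 h W (x + v).
have mfl : measurable_fun setT (fun u => expR (f u + lin x v u)).
  by apply: measurableT_comp => //; apply: measurable_funD => //; case: mf.
have ifl := integrable_exp_lin x v mf.
pose J := \int[gibbs h W x]_u expR (f u + lin x v u).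
have EJ : J%:E = (\int[gibbs h W x]_u (expR (f u + lin x v u))%:E)%E.
  exact: EFin_Rint.
have H : gZ h W (x + v) * K (fun u => expR (f u)) (x + v) =
    expR (- (sqnorm v / (2 * h'))) * (gZ h W x * J).
  apply: EFin_inj; rewrite integral_exp_lgw// 2!EFinM EJ.
  rewrite (gZ_integral_gibbs _ _ _ mfl); last by move=> u; exact: expR_ge0.
  rewrite -ge0_integralZl_EFin; last 4 first.
  - exact: measurableT.
  - by move=> u _; rewrite lee_fin mulr_ge0 ?expR_ge0// ltW// gw_gt0.
  - by apply/measurable_EFinP; apply: measurable_funM => //; exact: measurable_gw.
  - exact: expR_ge0.
  apply: eq_integral => u _; rewrite -EFinM; congr EFin.
  rewrite expRD -[expR (lgw (x + v) u)]/(gw h W (x + v) u) gw_tilt.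
  by rewrite !expRD /lin; ring.
have JJ : expR (K f x + \int[gibbs h W x]_u (dot (u - x) v / h')) <= J.
  have il := integrable_gibbs_lin x v.
  have if_ := bmeas_integrable (gibbs h W x) mf.
  have -> : K f x + \int[gibbs h W x]_u (dot (u - x) v / h') =
      \int[gibbs h W x]_u (f u + lin x v u) by rewrite RintegralD// kopE.
  by apply: jensen_expR => //; exact: (integrableD measurableT if_ il).
exact: (log_balance Zy (kop_exp_gt0 (x + v) mf) Zx H JJ).
Qed.

(** The case of the zero function: [ln Z] stays above its affine approximation at [x] up to a
    quadratic error. *)
Let ln_gZ_ge x v :
  \int[gibbs h W x]_u (dot (u - x) v / h') - sqnorm v / (2 * h') + ln (gZ h W x) <=
  ln (gZ h W (x + v)).
Proof.
have H := log_harnack_lower x v (bmeas_cst (0 : R)).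
have e0 : K (cst 0) x = 0 by exact: kop_cst.
have e1 : K (fun u => expR ((cst 0 : E -> R) u)) (x + v) = 1.
  transitivity (K (cst 1) (x + v)); last exact: kop_cst.
  by congr (kop _ _ _); apply: funext => u; rewrite /cst expR0.
by rewrite e0 e1 ln1 2!add0r in H.
Qed.

(* By concavity, [ln Z] lies below its tangent at [x]. *)
Let ln_gZ_le x v : ln (gZ h W (x + v)) <=
  ln (gZ h W x) + \int[gibbs h W x]_u (dot (u - x) v / h').
Proof.
set b := Rintegral _ _ _; pose s2 := sqnorm v / (2 * h').
have s20 : 0 <= s2 by rewrite divr_ge0 ?sqnorm_ge0// mulr_ge0.
(* No derivative is taken: [x] lies between [x - t v] and [x + v], the value at [x - t v] is bounded
   below by [ln_gZ_ge], and concavity then bounds the value at [x + v]. The error vanishes with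
   [t]. *)
have upper t : 0 < t -> ln (gZ h W (x + v)) <= ln (gZ h W x) + b + t * s2.
  move=> t0.
  have t1 : 0 < 1 + t by lra.
  have l0 : 0 < t / (1 + t) by rewrite divr_gt0.
  have l1 : t / (1 + t) < 1 by rewrite ltr_pdivrMr//; lra.
  have Zz : - (t * b) - t ^+ 2 * s2 + ln (gZ h W x) <= ln (gZ h W (x + - (t *: v))).
    have -> : - (t * b) = \int[gibbs h W x]_u (dot (u - x) (- (t *: v)) / h').
      rewrite -mulNr /b -RintegralZl//; last exact: integrable_gibbs_lin.
      by apply: eq_Rintegral => u _; rewrite dotNr dotZr; ring.
    have -> : t ^+ 2 * s2 = sqnorm (- (t *: v)) / (2 * h').
      by rewrite sqnormN sqnormZ mulrA.
    exact: ln_gZ_ge.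
  have xE : (1 - t / (1 + t)) *: (x + - (t *: v)) + (t / (1 + t)) *: (x + v) = x.
    by apply/rowP => i; rewrite !mxE; field; rewrite gt_eqF.
  have := gZ_log_concave (x + - (t *: v)) (x + v) l0 l1.
  by rewrite xE; exact: concave_tangent.
apply/ler_addgt0Pr => e e0.
pose t := e / (s2 + 1).
have s21 : 0 < s2 + 1 by rewrite ltr_wpDl.
have t0 : 0 < t by rewrite divr_gt0.
have ts : t * s2 <= e.
  by rewrite /t mulrAC ler_pdivrMr// ler_pM2l// lerDl.
by apply: le_trans (upper t t0) _; rewrite lerD2l.
Qed.

(** The unknown mean of the linear function occurs both in the Jensen bound and in the tangent bound
    on [ln Z]; it cancels and leaves the quadratic term. *)
Lemma gibbs_log_harnack f x y : bmeas f ->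
  K f x <= ln (K (fun u => expR (f u)) y) + sqnorm (x - y) / (2 * h').
Proof.
move=> mf; have yE : y = x + (y - x) by rewrite addrC subrK.
have H1 := log_harnack_lower x (y - x) mf.
have H2 := ln_gZ_le x (y - x).
rewrite -yE -(sqnormBC x y) in H1 H2.
exact: (log_harnack_arith H1 H2).
Qed.

(** By Kantorovich duality, two such laws are at Wasserstein-2 distance at most that of their
    centres. The log-Harnack inequality passes from [x] to [y], the Talagrand inequality at [y]
    passes from [f] to [g], and [s * h] then tends to 1. *)
Lemma gibbs_transport_contraction (t : R) f g x y : 0 < t -> bmeas f -> bmeas g ->
  (forall u v, f u <= g v + sqnorm (u - v) / (2 * t)) ->
  K f x <= K g y + sqnorm (x - y) / (2 * t).
Proof.
move=> t0 mf mg fg.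
have mtf : bmeas (fun u => t * f u) by exact: bmeasZ.
have mtg : bmeas (fun u => t * g u) by exact: bmeasZ.
have mul_half r : t * (r / (2 * t)) = r / 2 by field; rewrite gt_eqF.
have tfg u v : t * f u <= t * g v + sqnorm (u - v) / 2.
  by rewrite -(mul_half (sqnorm _)) -mulrDr ler_pM2l.
apply: divide_bound t0 _.
have K1f := kopZ (gibbs h W) t x mf.
have K1g := kopZ (gibbs h W) t y mg.
rewrite -K1f -K1g.
apply: transport_limit h0 (sqnorm_ge0 _) _ => s s0 sh.
have H1 := gibbs_talagrand y s0 sh mtf mtg tfg.
have H2 := @gibbs_log_harnack (fun u => s * (t * f u)) x y (bmeasZ s mtf).
have K2 := kopZ (gibbs h W) s x mtf.
rewrite K2 in H2.
exact: divide_bound2 s0 h0 H2 H1.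
Qed.

(** A distance is the infimum over [t] of [t / 2] plus a quadratic cost, so the Lipschitz property
    is a family of quadratic ones. *)
Lemma gibbs_lipschitz f : bmeas f -> lipschitz1 f -> lipschitz1 (K f).
Proof.
move=> mf lf x y; apply: lipschitz_limit (enorm_ge0 _) _ => t t0.
have mc : bmeas (cst (t / 2) : E -> R) by exact: bmeas_cst.
have mg : bmeas (fun u => f u + t / 2) by exact: bmeasD.
have H u v : f u <= (f v + t / 2) + sqnorm (u - v) / (2 * t).
  by apply: le_trans (lf u v) _; rewrite -addrA lerD2l -sqr_enorm young_half.
have := gibbs_transport_contraction x y t0 mf mg H.
by rewrite (kopD (gibbs h W) y mf mc) (kop_cst (gibbs h W) (t / 2) y) sqr_enorm.
Qed.

(** The Talagrand inequality, applied to a Lipschitz function against a multiple of itself, bounds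
    its centred exponential moments by those of a Gaussian of variance [h]. *)
Lemma gibbs_var f x : bmeas f -> lipschitz1 f -> var (gibbs h W x) f <= h'.
Proof.
move=> mf lf; rewrite var_kop; set m := K f x.
have mm : bmeas (cst m : E -> R) by exact: bmeas_cst.
pose g u := f u - m.
have mg : bmeas g by exact: bmeasB.
have mexp a : bmeas (fun u => expR (a * g u)) by apply: bmeas_expR; exact: bmeasZ.
have step (s tau : R) : 0 < s -> s * h' < 1 ->
    K (fun u => expR (s * tau * g u)) x <= expR (s * tau ^+ 2 / 2).
  move=> s0 sh.
  pose F u := tau * f u - tau ^+ 2 / 2.
  have mtf : bmeas (fun u => tau * f u) by exact: bmeasZ.
  have mF : bmeas F by apply: bmeasB => //; exact: bmeas_cst.
  have H u v : F u <= tau * f v + sqnorm (u - v) / 2.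
    rewrite /F -sqr_enorm; have := lf u v; have := lf v u.
    rewrite (enormBC v u); move: (enorm (u - v)) (enorm_ge0 (u - v)) (f u) (f v).
    exact: scaled_lipschitz.
  have := gibbs_talagrand x s0 sh mF mtf H.
  rewrite (kopZ (gibbs h W) tau x mf) -/m.
  have -> : (fun u => expR (s * F u)) =
      (fun u => expR (s * tau * m - s * tau ^+ 2 / 2) * expR (s * tau * g u)).
    by apply: funext => u; rewrite -expRD; congr expR; rewrite /F /g; field.
  rewrite (kopZ (gibbs h W) _ x (mexp (s * tau))).
  have := kop_exp_gt0 x (bmeasZ (s * tau) mg).
  rewrite (mulrA s tau m); exact: exp_centered.
have M0 : K (fun u => expR (0 * g u)) x = 1.
  transitivity (K (cst 1) x); last exact: kop_cst.
  by congr (kop _ _ _); apply: funext => u; rewrite mul0r expR0.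
have : (\int[gibbs h W x]_u (g u ^+ 2)%:E <= h'%:E)%E.
  apply: subgaussian_second_moment => //; first by case: mg.
  move=> a; rewrite -(EFin_kop (gibbs h W) x (mexp a)) lee_fin.
  exact: (subgaussian_limit (M := fun a => K (fun u => expR (a * g u)) x)).
by rewrite -(EFin_kop (gibbs h W) x (bmeasX 2 mg)) lee_fin.
Qed.

End gibbs_inequalities.

Transparent gZ gibbs Rintegral.

(** * Gaussian smoothing *)

Section zero_potential.
Context {R : realType} {d : nat}.
Notation E := 'rV[R]_d.
Notation leb := (@lebesgue_rV R d).

Let zero_convex (l : R) (u v : E) : 0 < l -> l < 1 ->
  (cst 0 : E -> R) ((1 - l) *: u + l *: v) <=
  (1 - l) * (cst 0 : E -> R) u + l * (cst 0 : E -> R) v.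
Proof. by move=> _ _; rewrite /cst !mulr0 addr0. Qed.

Lemma gaussian_weight (h : R) (x u : E) : 0 < h ->
  expR (- (cst 0 : E -> R) u - sqnorm (u - x) / (2 * h)) =
  (normal_peak (Num.sqrt h) ^+ d)^-1 *
    \prod_(i < d) normal_pdf (x ord0 i) (Num.sqrt h) (u ord0 i).
Proof.
move=> h0; rewrite prod_normal_pdf// mulrA mulVf ?mul1r ?/cst ?oppr0 ?add0r//.
by rewrite expf_neq0// gt_eqF// normal_peak_gt0// gt_eqF// sqrtr_gt0.
Qed.

Lemma integral_gaussian_weight (h : R) (x : E) : 0 < h ->
  (\int[leb]_u (expR (- (cst 0 : E -> R) u - sqnorm (u - x) / (2 * h)))%:E =
  ((normal_peak (Num.sqrt h) ^+ d)^-1)%:E)%E.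
Proof.
move=> h0; under eq_integral do rewrite gaussian_weight// EFinM.
rewrite ge0_integralZl_EFin//.
- by rewrite integral_prod_normal_pdf mule1.
- by move=> u _; rewrite lee_fin prodr_ge0// => i _; exact: normal_pdf_ge0.
- apply/measurable_EFinP; apply: measurable_prod => i _.
  by apply: (measurableT_comp (measurable_normal_pdf _ _)); exact: measurable_coord_rV.
- by rewrite invr_ge0 exprn_ge0// normal_peak_ge0.
Qed.

Let zero_lty (h : R) : 0 < h ->
  (\int[leb]_x (expR (- (cst 0 : E -> R) x - sqnorm x / (2 * h)))%:E < +oo)%E.
Proof.
move=> h0; have := @integral_gaussian_weight h 0 h0.
by under eq_integral do rewrite subr0; move=> ->; exact: ltry.
Qed.

Let zero_measurable : measurable_fun setT (cst 0 : E -> R).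
Proof. exact: measurable_cst. Qed.

Definition zero_potential : potential R d :=
  Potential zero_measurable zero_convex zero_lty.

Lemma gaussian_gibbs (h : {posnum R}) (x : E) B : measurable B ->
  gaussian h%:num x B = gibbs h zero_potential x B.
Proof.
move=> mB; rewrite -law_of_density_gibbs// /law_of_density /backward_density.
rewrite integral_gaussian_weight// inver invr_eq0 expf_eq0 andbC.
rewrite gt_eqF ?normal_peak_gt0 ?gt_eqF ?sqrtr_gt0//= invrK muleC.
rewrite /gaussian -ge0_integralZl_EFin//.
- apply: eq_integral => u _; rewrite gaussian_weight// -EFinM mulVKf//.
  by rewrite expf_neq0// gt_eqF// normal_peak_gt0// gt_eqF// sqrtr_gt0.
- apply: measurable_funTS; apply/measurable_EFinP; apply: measurableT_comp => //.
  by apply: measurable_funB => //; apply: measurable_funM => //; exact: measurable_sqnormB.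
- by rewrite exprn_ge0// normal_peak_ge0.
Qed.

Lemma gZ_zero_potential (h : {posnum R}) (x : E) :
  gZ h zero_potential x = gZ h zero_potential 0.
Proof. by rewrite /gZ /gw /backward_density/= !integral_gaussian_weight. Qed.

End zero_potential.

Section exponentially_bounded.
Context {R : realType} {d : nat}.
Notation E := 'rV[R]_d.
Notation leb := (@lebesgue_rV R d).
Implicit Types (m f : E -> R) (x u v : E).

Definition norm1 u : R := \sum_(i < d) `|u ord0 i|.

Lemma norm1_ge0 u : 0 <= norm1 u.
Proof. by apply: sumr_ge0. Qed.

Lemma measurable_norm1 : measurable_fun setT norm1.
Proof.
by apply: measurable_sum => i; apply: measurableT_comp => //; exact: measurable_coord_rV.
Qed.

Lemma dot_le_norm1 u v : `|dot u v| <= `|v| * norm1 u.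
Proof.
apply: le_trans (ler_norm_sum _ _ _) _; rewrite /norm1 mulr_sumr ler_sum// => i _.
by rewrite normrM mulrC ler_wpM2r// coord_le_norm.
Qed.

(** Completing the square in each coordinate, for which the l1 norm is convenient. *)
Lemma norm1_le_sqnorm (c k : R) u : 0 < k -> c * norm1 u <= sqnorm u / k + k * c ^+ 2 / 4 *+ d.
Proof.
move=> k0; rewrite -[d in _ *+ d]card_ord -sumr_const /norm1 /sqnorm mulr_sumr mulr_suml.
rewrite -big_split ler_sum//= => i _.
rewrite -subr_ge0 -real_normK ?num_real//.
have -> : `|u ord0 i| ^+ 2 / k + k * c ^+ 2 / 4 - c * `|u ord0 i| =
  k * (`|u ord0 i| / k - c / 2) ^+ 2 by field; rewrite gt_eqF.
by rewrite mulr_ge0 ?sqr_ge0// ltW.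
Qed.

(** At most exponential growth: a class that contains linear functions and their exponentials, is
    closed under products, and is integrable for every Gaussian law. Differentiation in the centre
    does not leave it. *)
Definition ebound m := measurable_fun setT m /\
  exists C c, 0 <= c /\ forall u, `|m u| <= C * expR (c * norm1 u).

Lemma ebound_bmeas m : bmeas m -> ebound m.
Proof.
move=> [mm [M mM]]; split => //; exists M, 0; split => // u.
by rewrite mul0r expR0 mulr1.
Qed.

Lemma eboundM m1 m2 : ebound m1 -> ebound m2 -> ebound (fun u => m1 u * m2 u).
Proof.
move=> [mm1 [C1 [c1 [c10 H1]]]] [mm2 [C2 [c2 [c20 H2]]]]; split; first exact: measurable_funM.
exists (C1 * C2), (c1 + c2); split=> [|u]; first exact: addr_ge0.
by rewrite normrM mulrDl expRD mulrACA; apply: ler_pM.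
Qed.

Lemma eboundD m1 m2 : ebound m1 -> ebound m2 -> ebound (fun u => m1 u + m2 u).
Proof.
move=> [mm1 [C1 [c1 [c10 H1]]]] [mm2 [C2 [c2 [c20 H2]]]]; split; first exact: measurable_funD.
have C0 (C c : R) (m : E -> R) : (forall u, `|m u| <= C * expR (c * norm1 u)) -> 0 <= C.
  move=> H; have := le_trans (normr_ge0 _) (H 0).
  by rewrite pmulr_lge0// expR_gt0.
exists (C1 + C2), (c1 + c2); split=> [|u]; first exact: addr_ge0.
have n0 := norm1_ge0 u.
apply: le_trans (ler_normD _ _) _; rewrite mulrDl; apply: lerD.
  apply: le_trans (H1 u) _; rewrite ler_wpM2l ?(C0 _ _ _ H1)// ler_expR.
  by rewrite ler_wpM2r// lerDl.
apply: le_trans (H2 u) _; rewrite ler_wpM2l ?(C0 _ _ _ H2)// ler_expR.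
by rewrite ler_wpM2r// lerDr.
Qed.

Lemma ebound_exp m (c : R) : 0 <= c -> measurable_fun setT m ->
  (forall u, m u <= c * norm1 u) -> ebound (fun u => expR (m u)).
Proof.
move=> c0 mm H; split; first exact: measurableT_comp.
by exists 1, c; split => // u; rewrite mul1r ger0_norm ?expR_ge0// ler_expR.
Qed.

Lemma ebound_norm1 : ebound norm1.
Proof.
split; first exact: measurable_norm1.
exists 1, 1; split => // u; rewrite mul1r mul1r ger0_norm ?norm1_ge0//.
by apply: le_trans (expR_ge1Dx _); rewrite lerDr.
Qed.

Lemma ebound_norm m : ebound m -> ebound (fun u => `|m u|).
Proof.
move=> [mm [C [c [c0 H]]]]; split; first exact: measurableT_comp.
by exists C, c; split => // u; rewrite normr_id.
Qed.

Lemma ebound_cst (c : R) : ebound (cst c).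
Proof. exact/ebound_bmeas/bmeas_cst. Qed.

Lemma ebound_dot v : ebound (fun u => dot u v).
Proof.
split; first exact: measurable_dot.
exists `|v|, 1; split => // u; apply: le_trans (dot_le_norm1 _ _) _.
rewrite ler_wpM2l// mul1r; apply: le_trans (expR_ge1Dx _).
by rewrite lerDr.
Qed.

Lemma ebound_coord i : ebound (fun u => u ord0 i).
Proof. by under eq_fun do rewrite -dot_delta; exact: ebound_dot. Qed.

End exponentially_bounded.

Section gaussian_integrals.
Context {R : realType} {d : nat}.
Notation E := 'rV[R]_d.
Notation leb := (@lebesgue_rV R d).
Variable h : {posnum R}.
Notation h' := (h%:num).
Notation G := (gibbs h (@zero_potential R d)).
Implicit Types (m f : E -> R) (x u v : E).

Lemma integrable_ebound m x : ebound m -> (G x).-integrable setT (EFin \o m).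
Proof.
move=> [mm [C [c [c0 H]]]]; apply/integrableP; split; first exact/measurable_EFinP.
apply: (@le_lt_trans _ _ (\int[G x]_u ((C * expR (c * norm1 u))%:E))%E).
  apply: ge0_le_integral => //.
  - by apply/measurable_EFinP; exact: measurableT_comp.
  - apply/measurable_EFinP; apply: measurable_funM => //; apply: measurableT_comp => //.
    by apply: measurable_funM => //; exact: measurable_norm1.
  - by move=> u _; rewrite /= lee_fin.
have C0 : 0 <= C.
  by have := le_trans (normr_ge0 _) (H 0); rewrite pmulr_lge0// expR_gt0.
have mn : measurable_fun setT (fun u : E => C * expR (c * norm1 u)).
  apply: measurable_funM => //; apply: measurableT_comp => //.
  by apply: measurable_funM => //; exact: measurable_norm1.
rewrite integral_gibbs_gw//; last by move=> u; rewrite mulr_ge0 ?expR_ge0.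
apply: lte_mul_pinfty; rewrite ?lee_fin ?invr_ge0 ?(ltW (gZ_gt0 _ _ _))//.
have mz : measurable_fun setT
    (fun u : E => (expR (- (cst 0 : E -> R) u - sqnorm u / (2 * (4 * h'))))%:E).
  apply/measurable_EFinP; apply: measurableT_comp => //; apply: measurable_funB.
    by apply: measurableT_comp => //; exact: measurable_cst.
  by apply: measurable_funM => //; exact: measurable_sqnorm.
(* Recentring at 0 leaves the exponent [sqnorm u / (4 * h')]. One half of it absorbs the exponential
   growth; the other half is a Gaussian weight of variance [4 * h']. *)
have h8 : 0 < 8 * h' by rewrite mulr_gt0.
have := fun u => @norm1_le_sqnorm R d c (8 * h') u h8.
move: (_ *+ d) => e He.
pose B := C * expR (e + sqnorm x / (2 * h')).
apply: (@le_lt_trans _ _ (\int[leb]_u (B%:E *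
    (expR (- (cst 0 : E -> R) u - sqnorm u / (2 * (4 * h'))))%:E)%E)%E); last first.
  rewrite ge0_integralZl_EFin//.
  - apply: lte_mul_pinfty => //; first by rewrite lee_fin mulr_ge0// expR_ge0.
    by apply: (@pot_lty _ _ (@zero_potential R d)); rewrite mulr_gt0.
  - by rewrite mulr_ge0// expR_ge0.
apply: ge0_le_integral => //.
- by move=> u _; rewrite lee_fin mulr_ge0 ?expR_ge0// mulr_ge0// expR_ge0.
- by apply/measurable_EFinP; apply: measurable_funM => //; exact: measurable_gw.
- exact: measurable_funeM.
move=> u _; rewrite -EFinM lee_fin /B /gw /backward_density /= /cst oppr0 !add0r.
rewrite -!mulrA ler_wpM2l// -!expRD ler_expR.
have := He u.
have : 0 <= sqnorm (u - 2 *: x) by exact: sqnorm_ge0.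
rewrite !sqnormB sqnormZ dotZr.
move: (sqnorm u) (sqnorm x) (dot u x) (norm1 u) => a b k n H1 H2.
rewrite -subr_ge0.
have -> : e + b / (2 * h') - a / (2 * (4 * h')) - (c * n - (a - 2 * k + b) / (2 * h')) =
  (a / (8 * h') + e - c * n) + (a - 2 * (2 * k) + 2 ^+ 2 * b) / (4 * h').
  by field; rewrite gt_eqF.
by rewrite addr_ge0 ?subr_ge0// divr_ge0// mulr_ge0.
Qed.

End gaussian_integrals.

Section exp_taylor.
Context {R : realType}.

Lemma expRB1_le (z : R) : `|expR z - 1| <= `|z| * expR `|z|.
Proof.
have e1 := expR_ge1Dx z; have e2 := expR_ge1Dx (- z).
have p1 := expR_gt0 z.
have pq : expR z * expR (- z) = 1 by rewrite -expRD subrr expR0.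
have h1 : expR z * (1 - z) <= 1 by rewrite -[leRHS]pq ler_wpM2l// ltW.
have [z0|z0] := ger0P z.
  by rewrite ger0_norm; [nra|lra].
rewrite ler0_norm; last by rewrite subr_le0 -expR0 ler_expR ltW.
have h2 : 1 <= expR (- z) by lra.
have : 0 <= - z * (expR (- z) - 1) by rewrite mulr_ge0; lra.
lra.
Qed.

Lemma expR_taylor1 (z : R) : `|expR z - 1 - z| <= z ^+ 2 * expR `|z|.
Proof.
have e1 := expR_ge1Dx z; have e2 := expR_ge1Dx (- z).
rewrite ger0_norm; last by lra.
have p1 := expR_gt0 z.
have pq : expR z * expR (- z) = 1 by rewrite -expRD subrr expR0.
have h1 : expR z - 1 <= z * expR z.
  have : expR z * (1 - z) <= 1 by rewrite -[leRHS]pq ler_wpM2l// ltW.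
  lra.
have z2 := sqr_ge0 z.
have [z0|z0] := ger0P z.
  have : z * (expR z - 1) <= z * (z * expR z) by rewrite ler_wpM2l.
  by rewrite mulrA -expr2; lra.
have h2 : 1 <= expR (- z) by lra.
have h3 : - z * (1 - expR z) <= - z * - z by apply: ler_wpM2l; lra.
have h4 : z ^+ 2 <= z ^+ 2 * expR (- z) by rewrite ler_peMr.
rewrite expr2 in h4 *; lra.
Qed.

End exp_taylor.

Section smooth_calculus.
Context {R : realType} {d : nat}.
Notation E := 'rV[R]_d.
Implicit Types (f g : E -> R) (x v : E).

(** The criterion by which integrals are differentiated below: an explicit remainder takes the place
    of dominated convergence. *)
Lemma is_derive_quadratic_bound f x v (D C : R) :
  (forall t, `|t| <= 1 -> `|f (t *: v + x) - f x - t * D| <= C * t ^+ 2) ->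
  is_derive x v f D.
Proof.
move=> H; have C0 : 0 <= C.
  by have := le_trans (normr_ge0 _) (H 1 _); rewrite normr1 expr1n mulr1; apply.
have cv : (t^-1 *: ((f \o shift x) (t *: v) - f x)) @[t --> 0^'] --> D.
  apply/cvgrPdist_lt => e e0; near=> t.
  have t0 : t != 0 by near: t; exact: nbhs_dnbhs_neq.
  have t1 : `|t| <= 1.
    near: t; apply: dnbhs0_le => //.
  have te : `|t| < e / (C + 1).
    near: t; apply: dnbhs0_lt; rewrite divr_gt0//; lra.
  rewrite /= distrC.
  have -> : t^-1 *: (f (t *: v + x) - f x) - D = t^-1 * (f (t *: v + x) - f x - t * D).
    by rewrite /GRing.scale/= [RHS]mulrBr mulrA mulVf// mul1r.
  rewrite normrM normfV; apply: (@le_lt_trans _ _ (C * `|t|)).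
    rewrite ler_pdivrMl ?normr_gt0//; apply: le_trans (H t t1) _.
    by rewrite -real_normK ?num_real// expr2 mulrCA.
  rewrite ltr_pdivlMr in te; last by lra.
  by have := normr_ge0 t; nra.
by apply: DeriveDef; [exact: cvgP cv|exact: cvg_lim cv].
Unshelve. all: by end_near. Qed.

Lemma Ck_ext n f g : f =1 g -> Ck n f -> Ck n g.
Proof. by move=> /funext ->. Qed.

Lemma CkW n f : Ck n.+1 f -> Ck n f.
Proof.
elim: n f => [f [] //|n IH f [cf H]]; split => // i.
by have [df ckf] := H i; split => //; exact: IH.
Qed.

Lemma CkD n f g : Ck n f -> Ck n g -> Ck n (fun x => f x + g x).
Proof.
elim: n f g => [f g cf cg|n IH f g ckf ckg].
  by move=> x; apply: (@continuousD _ _ _ f g); [exact: cf|exact: cg].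
have [cf Hf] := ckf; have [cg Hg] := ckg; split.
  by move=> x; apply: (@continuousD _ _ _ f g); [exact: cf|exact: cg].
move=> i; have [df cdf] := Hf i; have [dg cdg] := Hg i; split.
  by move=> x; apply: (@derivableD _ _ _ f g).
apply: Ck_ext (IH _ _ cdf cdg) => x.
by rewrite /partial (@deriveD _ _ _ f g).
Qed.

Lemma CkM n f g : Ck n f -> Ck n g -> Ck n (fun x => f x * g x).
Proof.
elim: n f g => [f g cf cg|n IH f g ckf ckg].
  by move=> x; apply: (@continuousM _ _ f g); [exact: cf|exact: cg].
have [cf Hf] := ckf; have [cg Hg] := ckg; split.
  by move=> x; apply: (@continuousM _ _ f g); [exact: cf|exact: cg].
move=> i; have [df cdf] := Hf i; have [dg cdg] := Hg i; split.
  by move=> x; apply: (@derivableM _ _ f g).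
apply: Ck_ext (CkD (IH _ _ (CkW ckf) cdg) (IH _ _ (CkW ckg) cdf)) => x.
by rewrite /partial (@deriveM _ _ f g).
Qed.

Lemma Ck_cst n (c : R) : Ck n (cst c : E -> R).
Proof.
elim: n c => [c|n IH c]; first by move=> x; exact: cst_continuous.
split => [x|i]; first exact: cst_continuous.
split => [x|]; first exact: derivable_cst.
apply: Ck_ext (IH 0) => x; by rewrite /partial derive_cst.
Qed.

Lemma CkV n f : (forall x, f x != 0) -> Ck n f -> Ck n (fun x => (f x)^-1).
Proof.
move=> f0; elim: n f f0 => [f f0 cf x|n IH f f0 ckf].
  by apply: (@continuousV _ _ f) => //; exact: cf.
have [cf Hf] := ckf; split.
  by move=> x; apply: (@continuousV _ _ f) => //; exact: cf.
move=> i; have [df cdf] := Hf i; split.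
  by move=> x; apply: (@derivableV _ _ f).
have ckV := IH f f0 (CkW ckf).
apply: Ck_ext (CkM (Ck_cst n (-1)) (CkM (CkM ckV ckV) cdf)) => x.
rewrite /partial (@deriveV _ _ f)// /cst mulN1r /GRing.scale/= mulNr.
by congr (- (_ * _)); rewrite -expr2 exprVn.
Qed.

End smooth_calculus.

(** The Gaussian law at [x] is a tilt of the law at 0, so expectations under it are quotients of
    such transforms, in which [x] occurs only in the exponential. *)
HB.lock Definition laplace {R : realType} {d : nat} (h : {posnum R})
    (m : 'rV[R]_d -> R) (x : 'rV[R]_d) : R :=
  \int[gibbs h (@zero_potential R d) 0]_u (m u * expR (dot u x / h%:num)).

Section laplace_transform.
Context {R : realType} {d : nat}.
Notation E := 'rV[R]_d.
Variable h : {posnum R}.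
Notation h' := (h%:num).
Notation G := (gibbs h (@zero_potential R d)).
Notation leb := (@lebesgue_rV R d).
Implicit Types (m f : E -> R) (x u v : E).

Lemma ebound_tilt x : ebound (fun u => expR (dot u x / h')).
Proof.
apply: (@ebound_exp _ _ _ (`|x| / h')); first by rewrite divr_ge0.
  by apply: measurable_funM => //; exact: measurable_dot.
move=> u; rewrite mulrAC ler_pM2r ?invr_gt0//.
by apply: le_trans (ler_norm _) (dot_le_norm1 _ _).
Qed.

Local Notation laplace := (laplace h).

Lemma laplaceE m x : laplace m x = \int[G 0]_u (m u * expR (dot u x / h')).
Proof. by rewrite laplace.unlock. Qed.

Let imt m x : ebound m ->
  (G 0).-integrable setT (EFin \o (fun u => m u * expR (dot u x / h'))).
Proof. by move=> mm; apply: integrable_ebound; apply: eboundM => //; exact: ebound_tilt. Qed.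

(* Coefficients of the quadratic, respectively linear, remainder of [laplace m] near [x]. *)
Let rest2 m x v : R :=
  \int[G 0]_u (`|m u| * expR (dot u x / h') *
    ((dot u v / h') ^+ 2 * expR (`|v| / h' * norm1 u))).

Let rest1 m x : R :=
  \int[G 0]_u (`|m u| * expR (dot u x / h') *
    (norm1 u / h' * expR (h'^-1 * norm1 u))).

Let ebound_expn (c : R) : 0 <= c -> ebound (fun u : E => expR (c * norm1 u)).
Proof.
move=> c0; apply: (@ebound_exp _ _ _ c) => //.
by apply: measurable_funM => //; exact: measurable_norm1.
Qed.

Let ebound_dotv v : ebound (fun u : E => dot u v / h').
Proof. by apply: eboundM; [exact: ebound_dot|exact: ebound_cst]. Qed.

(** The Taylor bound [expR_taylor1] is integrated; for [|t| <= 1] the remainder is dominated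
    uniformly in [t]. *)
Lemma laplace_expansion m x v t : ebound m -> `|t| <= 1 ->
  `|laplace m (t *: v + x) - laplace m x
    - t * laplace (fun u => m u * (dot u v / h')) x| <= rest2 m x v * t ^+ 2.
Proof.
move=> mm t1.
have mv : ebound (fun u => m u * (dot u v / h')) by apply: eboundM.
have i1 := imt (t *: v + x) mm. have i2 := imt x mm. have i3 := imt x mv.
rewrite !laplaceE -RintegralZl// -RintegralB// -RintegralB//; last first.
  - exact: integrable_scale.
  - exact: (integrableB measurableT i1 i2).
set F := fun u => _.
have eF : ebound F.
  apply: eboundD; last first.
    under eq_fun do rewrite -mulN1r; apply: eboundM; first exact: ebound_cst.
    by apply: eboundM; [exact: ebound_cst|apply: eboundM => //; exact: ebound_tilt].
  apply: eboundD; first by apply: eboundM => //; exact: ebound_tilt.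
  under eq_fun do rewrite -mulN1r; apply: eboundM; first exact: ebound_cst.
  by apply: eboundM => //; exact: ebound_tilt.
apply: le_trans (le_normr_Rintegral measurableT (integrable_ebound h 0 eF)) _.
have eR : ebound (fun u => `|m u| * expR (dot u x / h') *
    ((dot u v / h') ^+ 2 * expR (`|v| / h' * norm1 u))).
  apply: eboundM; first by apply: eboundM; [exact: ebound_norm|exact: ebound_tilt].
  apply: eboundM; last by apply: ebound_expn; rewrite divr_ge0.
  by under eq_fun do rewrite expr2; apply: eboundM.
rewrite mulrC /rest2 -RintegralZl//; last exact: integrable_ebound.
apply: le_Rintegral => //.
- by apply: integrable_ebound; exact: ebound_norm.
- by apply: integrable_scale; exact: integrable_ebound.
move=> u _; rewrite /F dotDr dotZr mulrDl expRD.
set a := expR (dot u x / h'); set s := dot u v / h'.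
have -> : t * dot u v / h' = t * s by rewrite /s mulrA.
have -> : m u * (expR (t * s) * a) - m u * a - t * (m u * s * a) =
  m u * a * (expR (t * s) - 1 - t * s) by ring.
have a0 : 0 <= a by exact: expR_ge0.
rewrite !normrM (ger0_norm a0).
rewrite [leRHS]mulrCA ler_wpM2l ?mulr_ge0//.
apply: le_trans (expR_taylor1 _) _; rewrite exprMn -[leLHS]mulrA.
rewrite ler_wpM2l ?sqr_ge0//; rewrite ler_wpM2l ?sqr_ge0// ler_expR.
rewrite normrM -[leRHS]mul1r; apply: ler_pM => //.
rewrite /s normrM [`|h'^-1|]ger0_norm ?invr_ge0// mulrAC ler_pM2r ?invr_gt0//.
exact: dot_le_norm1.
Qed.

Lemma is_derive_laplace m x v : ebound m ->
  is_derive x v (laplace m) (laplace (fun u => m u * (dot u v / h')) x).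
Proof.
move=> mm; apply: (@is_derive_quadratic_bound _ _ _ _ _ _ (rest2 m x v)) => t t1.
exact: laplace_expansion.
Qed.

(** Directional derivatives alone do not give continuity, which [Ck] demands at every order. *)
Lemma continuous_laplace m : ebound m -> continuous (laplace m).
Proof.
move=> mm x; pose C := rest1 m x.
have eR : ebound (fun u => `|m u| * expR (dot u x / h') *
    (norm1 u / h' * expR (h'^-1 * norm1 u))).
  apply: eboundM; first by apply: eboundM; [exact: ebound_norm|exact: ebound_tilt].
  apply: eboundM; last by apply: ebound_expn; rewrite invr_ge0.
  by apply: eboundM; [exact: ebound_norm1|exact: ebound_cst].
have H y : `|y - x| <= 1 -> `|laplace m y - laplace m x| <= `|y - x| * C.
  move=> yx; have i1 := imt y mm. have i2 := imt x mm.
  rewrite !laplaceE -RintegralB//.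
  set F := fun u => _.
  have eF : ebound F.
    apply: eboundD; first by apply: eboundM => //; exact: ebound_tilt.
    under eq_fun do rewrite -mulN1r; apply: eboundM; first exact: ebound_cst.
    by apply: eboundM => //; exact: ebound_tilt.
  apply: le_trans (le_normr_Rintegral measurableT (integrable_ebound h 0 eF)) _.
  rewrite /C /rest1 -RintegralZl//; last exact: integrable_ebound.
  apply: le_Rintegral => //.
  - by apply: integrable_ebound; exact: ebound_norm.
  - by apply: integrable_scale; exact: integrable_ebound.
  move=> u _; rewrite /F; have -> : dot u y = dot u x + dot u (y - x).
    by rewrite -dotDr addrC subrK.
  rewrite mulrDl expRD.
  set a := expR (dot u x / h'); set s := dot u (y - x) / h'.
  have -> : m u * (a * expR s) - m u * a = m u * a * (expR s - 1) by ring.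
  have a0 : 0 <= a by exact: expR_ge0.
  rewrite !normrM (ger0_norm a0).
  rewrite [leRHS]mulrCA ler_wpM2l ?mulr_ge0//.
  have sn : `|s| <= `|y - x| * (norm1 u / h').
    rewrite /s normrM [`|h'^-1|]ger0_norm ?invr_ge0// mulrA ler_pM2r ?invr_gt0//.
    exact: dot_le_norm1.
  apply: le_trans (expRB1_le _) _; rewrite mulrA; apply: ler_pM => //.
  rewrite ler_expR; apply: le_trans sn _.
  rewrite mulrC [leRHS]mulrC -[leRHS]mulr1; apply: ler_pM => //.
  by rewrite divr_ge0// norm1_ge0.
have C0 : 0 <= C.
  apply: Rintegral_ge0 => u _; rewrite mulr_ge0// mulr_ge0 ?expR_ge0//.
  by rewrite divr_ge0// norm1_ge0.
apply/(@cvgrPdist_lt _ _ _ _ (nbhs_filter x)) => e e0.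
have C1 : 0 < C + 1 by lra.
apply: (iffRL (@nbhs_normP R E x (fun y => `|laplace m x - laplace m y| < e))).
exists (Num.min 1 (e / (C + 1))) => [|y].
  by rewrite /= lt_min ltr01 divr_gt0.
rewrite /ball_/= distrC lt_min ltr_pdivlMr// => /andP[/ltW y1 ye].
rewrite distrC; apply: le_lt_trans (H y y1) _.
by have := normr_ge0 (y - x); nra.
Qed.

(** A partial derivative is again a transform, of [m] times a linear function. *)
Lemma Ck_laplace n m : ebound m -> Ck n (laplace m).
Proof.
elim: n m => [m mm|n IH m mm]; first by move=> x; exact: continuous_laplace.
split; first exact: continuous_laplace.
move=> i; split=> [x|].
  by have [] := is_derive_laplace x (delta_mx ord0 i) mm.
have me : ebound (fun u => m u * (dot u (delta_mx ord0 i) / h')) by apply: eboundM.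
apply: Ck_ext (IH _ me) => x; rewrite /partial.
by have [_ ->] := is_derive_laplace x (delta_mx ord0 i) mm.
Qed.

Lemma integral_tilt m x : ebound m ->
  \int[G x]_u m u = expR (- (sqnorm x / (2 * h'))) * laplace m x.
Proof.
have pos k : ebound k -> (forall u, 0 <= k u) ->
    \int[G x]_u k u = expR (- (sqnorm x / (2 * h'))) * laplace k x.
  move=> mk k0; have ik := integrable_ebound h x mk.
  have e1 := EFin_Rint ik. have e2 := EFin_Rint (imt x mk).
  rewrite -laplaceE in e2.
  have mkt : measurable_fun setT (fun u => k u * expR (dot u x / h')).
    have [] // : ebound (fun u => k u * expR (dot u x / h')).
      by apply: eboundM => //; exact: ebound_tilt.
  have kt0 u : 0 <= k u * expR (dot u x / h') by rewrite mulr_ge0 ?expR_ge0.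
  have i1 := @integral_gibbs_gw _ _ h (@zero_potential R d) x k mk.1 k0.
  have i2 := @integral_gibbs_gw _ _ h (@zero_potential R d) 0 _ mkt kt0.
  apply: EFin_inj; rewrite EFinM e1 e2; apply: (etrans i1).
  rewrite (gZ_zero_potential h x); apply: esym.
  transitivity ((expR (- (sqnorm x / (2 * h'))))%:E *
      ((gZ h (@zero_potential R d) 0)^-1%:E *
       \int[leb]_u (k u * expR (dot u x / h') * gw h (@zero_potential R d) 0 u)%:E))%E.
    by congr (_ * _)%E.
  rewrite muleCA; congr (_ * _)%E.
  rewrite -ge0_integralZl_EFin//.
  - apply: eq_integral => u _; rewrite -EFinM; congr EFin.
    rewrite /gw /backward_density subr0 mulrCA !mulrA -!mulrA; congr (_ * _).
    by rewrite -!expRD; congr expR; rewrite /= /cst sqnormB; field; rewrite gt_eqF.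
  - by move=> u _; rewrite lee_fin mulr_ge0 ?(ltW (gw_gt0 _ _ _ _))// mulr_ge0// expR_ge0.
  - by apply/measurable_EFinP; apply: measurable_funM => //; exact: measurable_gw.
(* The signed case, as a difference of two nonnegative functions of the class. *)
move=> mm; pose mp u := `|m u|; pose mq u := `|m u| - m u.
have emp : ebound mp by exact: ebound_norm.
have emq : ebound mq.
  apply: eboundD => //; under eq_fun do rewrite -mulN1r.
  by apply: eboundM => //; exact: ebound_cst.
have mq0 u : 0 <= mq u by rewrite /mq subr_ge0 ler_norm.
have mE u : m u = mp u - mq u by rewrite /mp /mq opprB addrC subrK.
have -> : \int[G x]_u m u = \int[G x]_u mp u - \int[G x]_u mq u.
  rewrite -RintegralB//; [|exact: integrable_ebound..].
  by apply: eq_Rintegral => u _; exact: mE.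
rewrite (pos _ emp) ?(pos _ emq)//; last by move=> u; exact: normr_ge0.
rewrite -mulrBr !laplaceE -RintegralB//; [|exact: imt..].
by congr (_ * _); apply: eq_Rintegral => u _; rewrite -mulrBl -mE.
Qed.

Lemma laplace1_gt0 x : 0 < laplace (cst 1) x.
Proof.
have := @integral_tilt (cst 1) x (ebound_cst 1); rewrite Rint_cst => e1.
by rewrite -(pmulr_rgt0 _ (expR_gt0 (- (sqnorm x / (2 * h'))))) -e1 ltr01.
Qed.

Lemma integral_laplace m x : ebound m -> \int[G x]_u m u = laplace m x / laplace (cst 1) x.
Proof.
move=> mm; rewrite integral_tilt//.
have := @integral_tilt (cst 1) x (ebound_cst 1); rewrite Rint_cst => e1.
have l0 := laplace1_gt0 x.
by apply: (mulIf (lt0r_neq0 l0)); rewrite divfK ?gt_eqF// mulrAC -e1 mul1r.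
Qed.

Notation Q := (kop G).

Lemma kop_laplace f : bmeas f -> Q f = (fun x => laplace f x * (laplace (cst 1) x)^-1).
Proof.
by move=> mf; apply/funext => x; rewrite kopE integral_laplace//; exact: ebound_bmeas.
Qed.

Lemma smooth_gaussian_kop f : bmeas f -> smooth (Q f).
Proof.
move=> mf n; rewrite kop_laplace//; apply: CkM.
  by apply: Ck_laplace; exact: ebound_bmeas.
apply: CkV; first by move=> x; rewrite gt_eqF// laplace1_gt0.
exact/Ck_laplace/ebound_cst.
Qed.

(** The quotient rule: under an exponential tilt the derivative of a mean is the covariance with the
    tilting function. *)
Lemma partial_gaussian_kop f x i : bmeas f ->
  partial i (Q f) x =
  \int[G x]_u (f u * (u ord0 i / h')) - Q f x * \int[G x]_u (u ord0 i / h').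
Proof.
move=> mf; have ef := ebound_bmeas mf.
have el : ebound (fun u : E => dot u (delta_mx ord0 i) / h') by exact: ebound_dotv.
have efl : ebound (fun u => f u * (dot u (delta_mx ord0 i) / h')) by exact: eboundM.
have L0 := laplace1_gt0 x.
have d1 := is_derive_laplace x (delta_mx ord0 i) ef.
have d2 := is_derive_laplace x (delta_mx ord0 i) (ebound_cst 1).
have [df1 df2] := d1. have [dg1 dg2] := d2.
have Lneq : laplace (cst 1) x != 0 by rewrite gt_eqF.
have dV : derivable (fun y => (laplace (cst 1) y)^-1) x (delta_mx ord0 i).
  exact: derivableV.
under eq_Rintegral do rewrite -dot_delta.
under [in X in _ - _ * X]eq_Rintegral do rewrite -dot_delta.
rewrite kopE !integral_laplace// kop_laplace// /partial.
rewrite (@deriveM _ _ (laplace f) (fun y => (laplace (cst 1) y)^-1))// deriveV//.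
rewrite df2 dg2 /GRing.scale/=.
have -> : laplace (fun u => cst 1 u * (dot u (delta_mx ord0 i) / h')) x =
   laplace (fun u => dot u (delta_mx ord0 i) / h') x.
  by rewrite !laplaceE; apply: eq_Rintegral => u _; rewrite /cst mul1r.
by field.
Qed.

End laplace_transform.

Section gaussian_gradient.
Context {R : realType} {d : nat}.
Notation E := 'rV[R]_d.
Variable h : {posnum R}.
Notation h' := (h%:num).
Notation G := (gibbs h (@zero_potential R d)).
Notation Q := (kop G).
Implicit Types (m f : E -> R) (x u v : E).

(** For the zero potential the normalizing constant does not depend on the centre, so the
    exponential moments are explicit. *)
Lemma gaussian_second_moment x v :
  \int[G x]_u ((dot (u - x) v / h') ^+ 2) <= sqnorm v / h'.
Proof.
have el : ebound (fun u => dot (u - x) v / h').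
  apply: eboundM; last exact: ebound_cst.
  under eq_fun do rewrite dotBl; apply: eboundD; first exact: ebound_dot.
  exact: ebound_cst.
have [v0|v0] := eqVneq (sqnorm v) 0.
  have d0 u : dot u v = 0.
    by apply/eqP; rewrite -sqrf_eq0 eq_le sqr_ge0 andbT -(mulr0 (sqnorm u)) -v0 sqr_dot_le.
  under eq_Rintegral do rewrite d0 mul0r expr0n.
  by rewrite Rint_cst v0 mul0r.
have v1 : 0 < sqnorm v by rewrite lt0r v0 sqnorm_ge0.
have el2 : ebound (fun u => (dot (u - x) v / h') ^+ 2).
  by under eq_fun do rewrite expr2; exact: eboundM.
rewrite -lee_fin EFin_Rint; last exact: integrable_ebound.
apply: subgaussian_second_moment; [by rewrite divr_gt0|by case: el|move=> a].
have e1 : (fun u => (expR (a * (dot (u - x) v / h')))%:E) =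
    (fun u => (expR (dot (u - x) (a *: v) / h'))%:E).
  by apply/funext => u; rewrite dotZr mulrA.
rewrite e1 (gibbs_mgf h (@zero_potential R d) x (a *: v)) lee_fin.
rewrite (gZ_zero_potential h (x + _)) (gZ_zero_potential h x) mulfK ?gt_eqF ?gZ_gt0//.
by rewrite sqnormZ ler_expR le_eqVlt; apply/orP; left; apply/eqP; field; rewrite gt_eqF.
Qed.

(* Bessel's inequality in [L^2] of the Gaussian law, for the linear functions. *)
Lemma sqnorm_gradient_gaussian f x : bmeas f ->
  h' * sqnorm (gradient (Q f) x) <= var (G x) f.
Proof.
move=> mf; set v := gradient (Q f) x; have ef := ebound_bmeas mf.
have ec (i : 'I_d) : ebound (fun u : E => u ord0 i / h').
  by apply: eboundM; [exact: ebound_coord|exact: ebound_cst].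
have ecf (i : 'I_d) : ebound (fun u : E => f u * (u ord0 i / h')).
  exact: eboundM.
have ed : ebound (fun u : E => dot u v / h').
  by apply: eboundM; [exact: ebound_dot|exact: ebound_cst].
set m := Q f x.
have vE : sqnorm v = \int[G x]_u (f u * (dot u v / h')) - m * \int[G x]_u (dot u v / h').
  have dotE u : dot u v / h' = \sum_i v ord0 i * (u ord0 i / h').
    by rewrite /dot mulr_suml; apply: eq_bigr => i _; rewrite mulrAC mulrC.
  have fdotE u : f u * (dot u v / h') = \sum_i v ord0 i * (f u * (u ord0 i / h')).
    by rewrite dotE mulr_sumr; apply: eq_bigr => i _; rewrite mulrCA.
  under eq_Rintegral do rewrite fdotE.
  under [in X in _ - _ * X]eq_Rintegral do rewrite dotE.
  rewrite Rint_sum; last by move=> i; apply: integrable_scale; exact: integrable_ebound.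
  rewrite Rint_sum; last by move=> i; apply: integrable_scale; exact: integrable_ebound.
  rewrite mulr_sumr -sumrB /sqnorm; apply: eq_bigr => i _.
  rewrite RintegralZl//; last exact: integrable_ebound.
  rewrite RintegralZl//; last exact: integrable_ebound.
  by rewrite mulrCA -mulrBr -partial_gaussian_kop// expr2 [in X in _ * X]mxE.
pose l u := dot (u - x) v / h'.
have lE u : l u = dot u v / h' - dot x v / h' by rewrite /l dotBl mulrBl.
have el : ebound l.
  rewrite (_ : l = fun u => dot u v / h' - dot x v / h'); last by apply/funext.
  by apply: eboundD => //; exact: ebound_cst.
have eg : ebound (fun u => f u - m).
  by apply: eboundD => //; exact: ebound_cst.
have egl : ebound (fun u => (f u - m) * l u) by exact: eboundM.
have eg2 : ebound (fun u => (f u - m) ^+ 2).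
  by under eq_fun do rewrite expr2; exact: eboundM.
have el2 : ebound (fun u => l u ^+ 2).
  by under eq_fun do rewrite expr2; exact: eboundM.
have covE : \int[G x]_u ((f u - m) * l u) = sqnorm v.
  rewrite vE; set c := dot x v / h'.
  have mE : \int[G x]_u f u = m by rewrite /m kopE.
  have -> : \int[G x]_u ((f u - m) * l u) =
      \int[G x]_u (f u * (dot u v / h') - (c * f u + (m * (dot u v / h') - m * c))).
    by apply: eq_Rintegral => u _; rewrite lE -/c; ring.
  have efd : ebound (fun u => f u * (dot u v / h')) by exact: eboundM.
  have i1 := integrable_ebound h x efd.
  have i2 := integrable_scale c (integrable_ebound h x ef).
  have i3 := integrable_scale m (integrable_ebound h x ed).
  have i4 := integrable_ebound h x (ebound_cst (m * c)).
  have i5 := integrableB measurableT i3 i4.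
  have i6 := integrableD measurableT i2 i5.
  rewrite RintegralB// RintegralD// RintegralB// RintegralZl//; last exact: integrable_ebound.
  rewrite RintegralZl//; last exact: integrable_ebound.
  by rewrite mE Rint_cst; ring.
have varE' : var (G x) f = \int[G x]_u ((f u - m) ^+ 2) by rewrite /var /m kopE.
(* [h' * l] is the linear function with slope [v]. Its covariance with [f] is [h' * sqnorm v] and
   its second moment is at most that, so expanding the square gives the claim. *)
have : 0 <= \int[G x]_u ((f u - m - h' * l u) ^+ 2) by apply: Rintegral_ge0 => u _; exact: sqr_ge0.
have -> : \int[G x]_u ((f u - m - h' * l u) ^+ 2) =
    \int[G x]_u ((f u - m) ^+ 2 - ((2 * h') * ((f u - m) * l u) - h' ^+ 2 * (l u ^+ 2))).
  by apply: eq_Rintegral => u _; ring.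
have i1 := integrable_ebound h x eg2.
have i2 := integrable_scale (2 * h') (integrable_ebound h x egl).
have i3 := integrable_scale (h' ^+ 2) (integrable_ebound h x el2).
have i4 := integrableB measurableT i2 i3.
rewrite RintegralB// RintegralB// RintegralZl//; last exact: integrable_ebound.
rewrite RintegralZl//; last exact: integrable_ebound.
rewrite covE -varE'.
have := gaussian_second_moment x v; rewrite -/(l _).
have h0 : 0 < h' by [].
move: (var _ _) (Rintegral _ _ _) (sqnorm v) => V S s S1 H.
have H2 : h' ^+ 2 * S <= h' * s.
  have -> : h' * s = h' ^+ 2 * (s / h') by field; rewrite gt_eqF.
  by rewrite ler_pM2l ?exprn_gt0.
lra.
Qed.

End gaussian_gradient.

(** * The proximal chain *)

Section harnack.
Context {R : realType} {d : nat}.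
Notation E := 'rV[R]_d.
Implicit Types (f g : E -> R) (x y z : E) (T : (E -> R) -> E -> R).

(** Preserving lower bounds keeps functions away from 0, so that their logarithms remain bounded. *)
Definition stable T := forall f, bmeas f ->
  bmeas (T f) /\ forall c, (forall u, c <= f u) -> forall x, c <= T f x.

Definition log_harnack (t : R) T := forall f c, 0 < c -> (forall u, c <= f u) ->
  bmeas f -> forall x y, T (fun u => ln (f u)) x <= ln (T f y) + sqnorm (x - y) / (2 * t).

Lemma stable_gibbs (h : {posnum R}) (W : potential R d) : stable (kop (gibbs h W)).
Proof.
move=> f mf; split; first by apply: bmeas_kop => //; exact: measurable_gibbs.
by move=> c cf x; rewrite kopE; exact: Rint_ge.
Qed.

Lemma stable_comp T1 T2 : stable T1 -> stable T2 -> stable (fun f => T1 (T2 f)).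
Proof.
move=> s1 s2 f mf; have [m2 c2] := s2 f mf; have [m1 c1] := s1 _ m2.
by split => // c cf; apply: c1; exact: c2.
Qed.

Lemma stable_iter n T : stable T -> stable (iter n T).
Proof.
move=> sT; elim: n => [f mf|n IH]; first by split.
exact: (stable_comp sT IH).
Qed.

Lemma log_harnack_gibbs (h : {posnum R}) (W : potential R d) :
  log_harnack h%:num (kop (gibbs h W)).
Proof.
move=> f c c0 cf mf x y.
have fE : f = (fun u => expR (ln (f u))).
  by apply/funext => u; rewrite lnK// posrE (lt_le_trans c0).
have := gibbs_log_harnack h W x y (bmeas_ln c0 cf mf).
by rewrite -fE.
Qed.

Lemma segment_bound (h t D : R) : 0 < h -> 0 < t ->
  (t / (h + t)) ^+ 2 * D / (2 * t) + (h / (h + t)) ^+ 2 * D / (2 * h) = D / (2 * (h + t)).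
Proof. by move=> h0 t0; field; rewrite !gt_eqF// addr_gt0. Qed.

(** The path from [x] to [y] goes through a point [z] of the segment: the kernel transports the
    Harnack cost of [T] along [x - z], and its own log-Harnack inequality covers [z - y]. Lengths in
    the ratio t to h minimize the total cost and make the parameters add. *)
Lemma log_harnack_gibbs_comp (h : {posnum R}) (W : potential R d) t T :
  0 < t -> stable T -> log_harnack t T ->
  log_harnack (h%:num + t) (fun f => kop (gibbs h W) (T f)).
Proof.
move=> t0 sT hT f c c0 cf mf x y.
have h0 : 0 < h%:num by [].
have mlf := bmeas_ln c0 cf mf.
have [mTl _] := sT _ mlf. have [mT cT] := sT _ mf.
have mlT := bmeas_ln c0 (cT _ cf) mT.
pose z := y + (h%:num / (h%:num + t)) *: (x - y).
have ht : h%:num + t != 0 by rewrite gt_eqF// addr_gt0.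
have xz : x - z = (t / (h%:num + t)) *: (x - y).
  by apply/rowP => i; rewrite !mxE; field.
have zy : z - y = (h%:num / (h%:num + t)) *: (x - y).
  by rewrite /z addrAC subrr add0r.
have H1 := gibbs_transport_contraction h W x z t0 mTl mlT (hT f c c0 cf mf).
have := log_harnack_gibbs h W c0 (cT _ cf) mT z y.
rewrite xz sqnormZ in H1; rewrite zy sqnormZ => H2.
rewrite -(segment_bound _ h0 t0).
move: H1 H2; move: (kop _ _ _) (kop _ _ _) (ln _) (_ / _) (_ / _); move=> *; lra.
Qed.

End harnack.

Section laws.
Context {R : realType} d {T : measurableType d}.
Implicit Types (mu nu : probability T R) (f : T -> R).
Variable k : T -> probability T R.
Hypothesis mk : forall B, measurable B -> measurable_fun setT (k ^~ B).

Lemma Rint_mixture mu nu f :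
  (forall B, measurable B -> nu B = (\int[mu]_x k x B)%E) -> bmeas f ->
  \int[nu]_y f y = \int[mu]_x kop k f x.
Proof.
move=> nuE mf; have [mf' [M fM]] := mf.
have mkf := bmeas_kop mk mf.
have mc : bmeas (cst M : T -> R) by exact: bmeas_cst.
pose g y := f y + M.
have mg : bmeas g by exact: bmeasD.
have g0 y : 0 <= g y by rewrite /g -lerBlDr sub0r; have := fM y; rewrite ler_norml => /andP[].
have mkg := bmeas_kop mk mg.
suff H : \int[nu]_y g y = \int[mu]_x kop k g x.
  apply: (addIr M).
  have -> : \int[nu]_y f y + M = \int[nu]_y g y by rewrite RintD// Rint_cst.
  have -> : \int[mu]_x kop k f x + M = \int[mu]_x (kop k f x + M) by rewrite RintD// Rint_cst.
  by rewrite H; apply: eq_Rintegral => x _; rewrite kopD// kop_cst.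
apply: EFin_inj; rewrite (EFin_Rint (bmeas_integrable nu mg)) (EFin_Rint (bmeas_integrable mu mkg)).
rewrite (@ge0_integral_mixture _ _ T T R mu nu (cst 1) k)//.
- by apply: eq_integral => x _; rewrite mul1e EFin_kop.
- by move=> U mU; apply: etrans (nuE U mU) _; apply: eq_integral => x _; rewrite mul1e.
- by apply/measurable_EFinP; case: mg.
Qed.

Lemma var_mixture mu nu f :
  (forall B, measurable B -> nu B = (\int[mu]_x k x B)%E) -> bmeas f ->
  var nu f = \int[mu]_x var (k x) f + var mu (kop k f).
Proof.
move=> nuE mf; have mkf := bmeas_kop mk mf.
have mkf2 := bmeas_kop mk (bmeasX 2 mf).
rewrite !varE// (Rint_mixture nuE mf) (Rint_mixture nuE (bmeasX 2 mf)).
have -> : \int[mu]_x var (k x) f = \int[mu]_x (kop k (fun u => f u ^+ 2) x - kop k f x ^+ 2).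
  by apply: eq_Rintegral => x _; rewrite var_kopE.
rewrite RintB//; last exact: bmeasX.
by ring.
Qed.

End laws.

Lemma variance_var {R : realType} d {T : measurableType d} (mu : probability T R)
  (f : T -> R) : bmeas f -> (variance mu f = (var mu f)%:E)%E.
Proof.
move=> mf; rewrite /variance unlock unlock /var EFin_Rint; last first.
  by apply: bmeas_integrable; apply: bmeasX; apply: bmeasB => //; exact: bmeas_cst.
by apply: eq_integral => x _; rewrite expr2.
Qed.

Section proximal_operator.
Context {R : realType} {d : nat}.
Notation E := 'rV[R]_d.
Notation leb := (@lebesgue_rV R d).
Variables (h : {posnum R}) (V : potential R d) (pi : probability E R).
Notation h' := (h%:num).
Hypothesis piE : forall A, measurable A -> pi A = (\int[leb]_(x in A) (expR (- V x))%:E)%E.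
Notation O := (@zero_potential R d).
Notation Q := (kop (gibbs h O)).
Notation S := (kop (gibbs h V)).
Implicit Types (f g : E -> R) (x y : E).

Definition proximal_op f : E -> R := Q (S f).
Notation P := proximal_op.

Lemma stable_proximal : stable P.
Proof. by apply: stable_comp; exact: stable_gibbs. Qed.

Lemma stable_proximal_iter n : stable (iter n P).
Proof. exact/stable_iter/stable_proximal. Qed.

Lemma bmeas_iter n f : bmeas f -> bmeas (iter n P f).
Proof. by move=> mf; have [] := stable_proximal_iter n mf. Qed.

Lemma log_harnack_proximal n : log_harnack (2 * n.+1%:R * h') (iter n.+1 P).
Proof.
have h0 : 0 < h' by [].
elim: n => [|n IH].
  have -> : 2 * 1%:R * h' = h' + h' by ring.
  have H := log_harnack_gibbs_comp h O h0 (stable_gibbs h V) (log_harnack_gibbs h V).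
  exact: H.
have -> : 2 * n.+2%:R * h' = h' + (h' + 2 * n.+1%:R * h').
  by rewrite -[n.+2%:R]natr1; ring.
have t0 : 0 < 2 * n.+1%:R * h' by rewrite !mulr_gt0.
have sS : stable (fun f => S (iter n.+1 P f)).
  by apply: stable_comp; [exact: stable_gibbs|exact: stable_proximal_iter].
have H1 := log_harnack_gibbs_comp h V t0 (stable_proximal_iter n.+1) IH.
have H2 := log_harnack_gibbs_comp h O (addr_gt0 h0 t0) sS H1.
exact: H2.
Qed.

Lemma lipschitz_iter n f : bmeas f -> lipschitz1 f -> lipschitz1 (iter n P f).
Proof.
move=> mf lf; elim: n => [//|n IH]; rewrite iterS.
have mn := bmeas_iter n mf.
apply: gibbs_lipschitz; first by have [] := stable_gibbs h V mn.
exact: gibbs_lipschitz.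
Qed.

Lemma integral_pi (F : E -> \bar R) : measurable_fun setT F -> (forall x, (0 <= F x)%E) ->
  (\int[pi]_x F x = \int[leb]_x ((expR (- V x))%:E * F x))%E.
Proof.
move=> mF F0.
rewrite (@ge0_integral_mixture _ _ E E R leb pi (fun x => expR (- V x)) (fun x => \d_x))//.
- by apply: eq_integral => u _; rewrite integral_dirac// diracT mul1e.
- apply: measurableT_comp => //; apply: measurableT_comp => //; exact: pot_measurable.
- by move=> U mU; exact: measurable_fun_dirac.
- move=> U mU; apply: etrans (piE mU) _; rewrite [LHS]integral_mkcond.
  by apply: eq_integral => u _; rewrite epatch_indic.
Qed.

Let swap (F : E * E -> R) : measurable_fun setT F -> (forall p, 0 <= F p) ->
  (\int[leb]_x \int[leb]_y (F (x, y))%:E = \int[leb]_y \int[leb]_x (F (x, y))%:E)%E.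
Proof.
move=> mF F0; apply: (@fubini_tonelli _ _ E E R leb leb (fun p => (F p)%:E)).
  exact/measurable_EFinP.
by move=> p; rewrite lee_fin.
Qed.

(** Two factorizations of one joint density: [Q] and [S] are, up to normalization, its conditional
    laws, and [pi] is its first marginal. *)
Let weight x y : expR (- V x) * gw h O x y = gw h V y x.
Proof.
rewrite /gw /backward_density -expRD; congr expR.
by rewrite /= /cst oppr0 add0r sqnormBC.
Qed.

(** Invariance of a two-block Gibbs sampler: integrate the joint density over [x] first, replace
    [S f] by [f] there, and integrate over [y] first again. *)
Lemma proximal_invariant_ge0 f : bmeas f -> (forall x, 0 <= f x) ->
  \int[pi]_x P f x = \int[pi]_x f x.
Proof.
move=> mf f0.
have [mg cg] := stable_gibbs h V mf; have g0 := cg 0 f0.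
have [mQ cQ] := stable_gibbs h O mg; have Q0 := cQ 0 g0.
have mfE : measurable_fun setT (fun x => (f x)%:E) by apply/measurable_EFinP; case: mf.
have mQE : measurable_fun setT (fun x => (P f x)%:E) by apply/measurable_EFinP; case: mQ.
apply: EFin_inj; rewrite (EFin_Rint (bmeas_integrable pi mf)) (EFin_Rint (bmeas_integrable pi mQ)).
rewrite (integral_pi mfE); last by move=> x; rewrite lee_fin.
rewrite (integral_pi mQE); last by move=> x; rewrite lee_fin Q0.
pose c := (gZ h O 0)^-1.
have c0 : 0 <= c by rewrite invr_ge0 ltW// gZ_gt0.
have mV2 : measurable_fun setT (fun p : E * E => gw h V p.2 p.1).
  have -> : (fun p : E * E => gw h V p.2 p.1) =
    (fun p : E * E => gw h V p.1 p.2) \o (fun p : E * E => (p.2, p.1)) by [].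
  apply: measurableT_comp; first exact: measurable_gw2.
  by apply/measurable_fun_pair; [exact: measurable_snd|exact: measurable_fst].
have gwV0 x y : 0 <= gw h V y x by rewrite ltW// gw_gt0.
have step1 x : ((expR (- V x))%:E * (P f x)%:E =
    \int[leb]_y (c * (S f y * gw h V y x))%:E)%E.
  have i1 := @integral_gibbs_gw _ _ h O x (S f) mg.1 g0.
  rewrite (EFin_kop (gibbs h O) x mg) i1 (gZ_zero_potential h x) muleA -EFinM.
  rewrite -ge0_integralZl_EFin; last 4 first.
  - exact: measurableT.
  - by move=> y _; rewrite lee_fin mulr_ge0// ltW// gw_gt0.
  - by apply/measurable_EFinP; apply: measurable_funM; [case: mg|exact: measurable_gw].
  - by rewrite mulr_ge0// expR_ge0.
  apply: eq_integral => y _; rewrite -EFinM; congr EFin.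
  by rewrite -weight -/c; ring.
have step2 y : (\int[leb]_x (c * (S f y * gw h V y x))%:E =
    \int[leb]_x (c * (f x * gw h V y x))%:E)%E.
  have i1 := gZ_integral_gibbs h V y mf.1 f0.
  under eq_integral do rewrite EFinM EFinM.
  rewrite ge0_integralZl_EFin//; last 2 first.
  - by move=> x _; rewrite -EFinM lee_fin mulr_ge0.
  - by apply: measurable_funeM; exact: measurable_gwE.
  rewrite ge0_integralZl_EFin//; last 2 first.
  - by move=> x _; rewrite lee_fin.
  - exact: measurable_gwE.
  under [RHS]eq_integral do rewrite EFinM.
  rewrite ge0_integralZl_EFin//; last 2 first.
  - by move=> x _; rewrite lee_fin mulr_ge0.
  - apply/measurable_EFinP; apply: (measurable_funM mf.1 _); exact: measurable_gw.
  by congr (_ * _)%E; rewrite -i1 (EFin_kop (gibbs h V) y mf) -EFin_gZ muleC.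
have step3 x : (\int[leb]_y (c * (f x * gw h V y x))%:E =
    (expR (- V x))%:E * (f x)%:E)%E.
  have E3 y : c * (f x * gw h V y x) = (c * (f x * expR (- V x))) * gw h O x y.
    by rewrite -weight !mulrA.
  under eq_integral do rewrite E3 EFinM.
  rewrite ge0_integralZl_EFin//; last 3 first.
  - by move=> y _; rewrite lee_fin ltW// gw_gt0.
  - exact: measurable_gwE.
  - by rewrite mulr_ge0// mulr_ge0// expR_ge0.
  rewrite -EFin_gZ (gZ_zero_potential h x) -!EFinM; congr EFin.
  by rewrite mulrAC /c mulVf ?mul1r 1?mulrC// gt_eqF// gZ_gt0.
under eq_integral do rewrite step1.
rewrite (swap (F := fun p => c * (S f p.2 * gw h V p.2 p.1))); last 2 first.
- apply: measurable_funM => //; apply: measurable_funM => //.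
  by apply: (measurableT_comp mg.1); exact: measurable_snd.
- by move=> p; rewrite mulr_ge0// mulr_ge0//.
under eq_integral do rewrite step2.
rewrite -(swap (F := fun p => c * (f p.1 * gw h V p.2 p.1))); last 2 first.
- apply: measurable_funM => //; apply: measurable_funM => //.
  by apply: (measurableT_comp mf.1); exact: measurable_fst.
- by move=> p; rewrite mulr_ge0// mulr_ge0//.
by apply: eq_integral => x _; rewrite step3.
Qed.

End proximal_operator.

Lemma measurable_sqnorm_gradient {R : realType} {d : nat} (f : 'rV[R]_d -> R) :
  smooth f -> measurable_fun setT (fun x => sqnorm (gradient f x)).
Proof.
move=> sf; rewrite /sqnorm; apply: measurable_sum => i.
under eq_fun do rewrite /gradient mxE.
apply: measurable_funX; apply: measurable_fun_continuous_rV.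
by have [_ /(_ i)[_]] := sf 1%N.
Qed.

Lemma contraction_arith {R : realType} (h C a v w : R) : 0 < h -> 0 <= C ->
  a <= C * (h^-1 * (w - a)) -> w <= v -> a <= C / (C + h) * v.
Proof.
move=> h0 C0 H wv; have Ch : 0 < C + h by rewrite ltr_wpDl.
rewrite mulrAC ler_pdivlMr//.
have : h * a <= C * (w - a).
  apply: le_trans (ler_wpM2l (ltW h0) H) _.
  by rewrite le_eqVlt; apply/orP; left; apply/eqP; field; rewrite gt_eqF.
have : C * (w - a) <= C * (v - a) by rewrite ler_wpM2l// lerD2r.
lra.
Qed.

Section proximal_contraction.
Context {R : realType} {d : nat}.
Notation E := 'rV[R]_d.
Notation leb := (@lebesgue_rV R d).
Variables (h : {posnum R}) (V : potential R d) (pi : probability E R).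
Notation h' := (h%:num).
Hypothesis piE : forall A, measurable A -> pi A = (\int[leb]_(x in A) (expR (- V x))%:E)%E.
Notation O := (@zero_potential R d).
Notation Q := (kop (gibbs h O)).
Notation S := (kop (gibbs h V)).
Notation P := (proximal_op h V).
Implicit Types (f g : E -> R).

Lemma bmeas_gibbs (W : potential R d) f : bmeas f -> bmeas (kop (gibbs h W) f).
Proof. by move=> mf; apply: bmeas_kop => //; exact: measurable_gibbs. Qed.

Lemma proximal_invariant f : bmeas f -> \int[pi]_x P f x = \int[pi]_x f x.
Proof.
move=> mf; have [_ [M fM]] := mf.
have mc : bmeas (cst M : E -> R) by exact: bmeas_cst.
pose g x := f x + M.
have mg : bmeas g by exact: bmeasD.
have g0 x : 0 <= g x by rewrite /g -lerBlDr sub0r; have := fM x; rewrite ler_norml => /andP[].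
have mS := bmeas_gibbs V mf. have mP := bmeas_gibbs O mS.
have PE : P g = (fun x => P f x + M).
  apply/funext => x; rewrite /proximal_op.
  have -> : S g = (fun y => S f y + M).
    by apply/funext => y; rewrite /g (kopD _ _ mf mc) kop_cst.
  by rewrite (kopD _ _ mS mc) kop_cst.
have := proximal_invariant_ge0 h piE mg g0.
rewrite PE (RintD _ mP mc) (RintD _ mf mc).
exact: addIr.
Qed.

Lemma var_gibbs_le_energy (mu : probability E R) C g : 0 <= C -> poincare_inequality mu C ->
  bmeas g -> var mu (Q g) <= C * (h'^-1 * \int[mu]_x var (gibbs h O x) g).
Proof.
move=> C0 pC mg; have sQ := smooth_gaussian_kop h mg.
have mQ := bmeas_gibbs O mg; have mQ2 := bmeas_gibbs O (bmeasX 2 mg).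
have mvar : bmeas (fun x => var (gibbs h O x) g).
  rewrite (_ : (fun _ => _) = (fun x => Q (fun u => g u ^+ 2) x - Q g x ^+ 2)).
    by apply: bmeasB => //; exact: bmeasX.
  by apply/funext => x; rewrite var_kopE.
have := pC _ sQ; rewrite (variance_var mu mQ) => H.
rewrite -lee_fin; apply: le_trans H _; rewrite EFinM lee_wpmul2l// ?lee_fin//.
have mv' : bmeas (fun x => h'^-1 * var (gibbs h O x) g) by exact: bmeasZ.
rewrite -(RintZ mu _ mvar) (EFin_Rint (bmeas_integrable mu mv')).
apply: ge0_le_integral => //.
- by move=> x _; rewrite lee_fin sqnorm_ge0.
- by apply/measurable_EFinP; exact: measurable_sqnorm_gradient.
- by apply/measurable_EFinP; case: mv'.
- move=> x _; rewrite lee_fin -(ler_pM2l (x := h'))// mulrA mulfV ?mul1r//.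
  exact: sqnorm_gradient_gaussian.
Qed.

(** The variance of [S f] under [pi Q] is the mean conditional variance plus the variance of [P f].
    The Poincare inequality bounds the second part by [C / h] times the first, and the total is at
    most the variance of [f], by Jensen's inequality and invariance. *)
Lemma var_proximal C f : 0 <= C -> poincare_inequality pi C -> bmeas f ->
  var pi (P f) <= C / (C + h') * var pi f.
Proof.
move=> C0 pC mf.
have mS := bmeas_gibbs V mf; have mS2 := bmeasX 2 mS.
have mf2 := bmeasX 2 mf; have mSf2 := bmeas_gibbs V mf2.
have mP := bmeas_gibbs O mS; have mP2 := bmeasX 2 mP.
have mQ2 := bmeas_gibbs O mS2; have mPf2 := bmeas_gibbs O mSf2.
have H := var_gibbs_le_energy C0 pC mS.
set m := \int[pi]_x f x.
have vP : var pi (P f) = \int[pi]_x (P f x ^+ 2) - m ^+ 2.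
  by rewrite (varE pi mP) (proximal_invariant mf).
have vI : \int[pi]_x var (gibbs h O x) (S f) =
    \int[pi]_x Q (fun u => S f u ^+ 2) x - \int[pi]_x (P f x ^+ 2).
  rewrite -(RintB pi mQ2 mP2); apply: eq_Rintegral => x _.
  by rewrite (var_kopE _ _ mS).
have le2 : \int[pi]_x Q (fun u => S f u ^+ 2) x <= \int[pi]_x (f x ^+ 2).
  rewrite -(proximal_invariant mf2); apply: le_Rint => // x.
  apply: kop_le => // u; rewrite !kopE; exact: sqr_Rint_le.
apply: (contraction_arith (w := \int[pi]_x Q (fun u => S f u ^+ 2) x - m ^+ 2)) => //.
- apply: le_trans H _; rewrite vI vP.
  rewrite le_eqVlt; apply/orP; left; apply/eqP.
  by congr (_ * (_ * _)); rewrite opprB addrA subrK.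
- by rewrite (varE pi mf) lerD2r.
Qed.

Lemma var_proximal_iter C n f : 0 <= C -> poincare_inequality pi C -> bmeas f ->
  var pi (iter n P f) <= (C / (C + h')) ^+ n * var pi f.
Proof.
move=> C0 pC mf; elim: n => [|n IH]; first by rewrite expr0 mul1r.
rewrite iterS exprS -mulrA.
apply: le_trans (var_proximal C0 pC (bmeas_iter h V n mf)) _.
by rewrite ler_wpM2l// divr_ge0// addr_ge0.
Qed.

Lemma integral_proximal_iter n f : bmeas f -> \int[pi]_x iter n P f x = \int[pi]_x f x.
Proof.
move=> mf; elim: n => [//|n IH]; rewrite -IH.
exact: (proximal_invariant (bmeas_iter h V n mf)).
Qed.

End proximal_contraction.

Section chain.
Context {R : realType} {d : nat}.
Notation E := 'rV[R]_d.
Variables (h : {posnum R}) (V : potential R d).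
Variables mu nu : nat -> probability E R.
Notation h' := (h%:num).
Notation O := (@zero_potential R d).
Notation Q := (kop (gibbs h O)).
Notation S := (kop (gibbs h V)).
Notation P := (proximal_op h V).
Hypothesis nuE : forall k B, measurable B -> nu k B = (\int[mu k]_x gibbs h O x B)%E.
Hypothesis muE : forall k B, measurable B -> mu k.+1 B = (\int[nu k]_y gibbs h V y B)%E.
Implicit Types f : E -> R.

Lemma Rint_chain k n f : bmeas f -> \int[mu (k + n)]_x f x = \int[mu k]_x iter n P f x.
Proof.
elim: n f => [|n IH] f mf; first by rewrite addn0.
have mS := bmeas_gibbs h V mf.
rewrite addnS iterSr -(IH _ (bmeas_gibbs h O mS)).
rewrite (Rint_mixture (measurable_gibbs h V) (muE (k + n)) mf).
exact: (Rint_mixture (measurable_gibbs h O) (nuE (k + n)) mS).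
Qed.

Let var_mixture_le (W : potential R d) (m1 m2 : probability E R) f :
  (forall B, measurable B -> m2 B = (\int[m1]_x gibbs h W x B)%E) ->
  bmeas f -> lipschitz1 f -> var m2 f <= h' + var m1 (kop (gibbs h W) f).
Proof.
move=> mE mf lf; rewrite (var_mixture (measurable_gibbs h W) mE mf) lerD2r.
have mk := bmeas_gibbs h W mf. have mk2 := bmeas_gibbs h W (bmeasX 2 mf).
apply: Rint_le => [|x]; last exact: gibbs_var.
rewrite (_ : (fun _ => _) =
    (fun x => kop (gibbs h W) (fun u => f u ^+ 2) x - kop (gibbs h W) f x ^+ 2)).
  by apply: bmeasB => //; exact: bmeasX.
by apply/funext => x; rewrite var_kopE.
Qed.

(** Law of total variance along the chain, read backwards: each half-step contributes at most [h]
    and hands a 1-Lipschitz function to the preceding law. *)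
Lemma var_chain_iter k f : bmeas f -> lipschitz1 f ->
  var (mu k) f <= 2 * k%:R * h' + var (mu 0) (iter k P f).
Proof.
elim: k f => [|k IH] f mf lf; first by rewrite mulr0 mul0r add0r.
have mS := bmeas_gibbs h V mf; have lS := gibbs_lipschitz h V mf lf.
have mP := bmeas_gibbs h O mS; have lP := gibbs_lipschitz h O mS lS.
have H1 := var_mixture_le (muE (k)) mf lf.
have H2 := var_mixture_le (nuE (k)) mS lS.
have H3 := IH _ mP lP.
rewrite iterSr -natr1.
move: H1 H2 H3; rewrite -/(P f).
move: (var _ _) (var _ _) (var _ _) (var _ _) => a b c e; lra.
Qed.

(** After at least one step the function left under [mu 0] has the form [Q g] with [g] 1-Lipschitz;
    its energy is at most the variance of [g] divided by [h], that is, at most 1. *)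
Lemma var_chain C k f : 0 <= C -> poincare_inequality (mu 0) C -> bmeas f -> lipschitz1 f ->
  var (mu k.+1) f <= 2 * k.+1%:R * h' + C.
Proof.
move=> C0 pC mf lf; apply: le_trans (var_chain_iter k.+1 mf lf) _; rewrite lerD2l.
have mk := bmeas_iter h V k mf; have lk := lipschitz_iter h V k mf lf.
have mS := bmeas_gibbs h V mk; have lS := gibbs_lipschitz h V mk lk.
have mQ := bmeas_gibbs h O mS; have mQ2 := bmeas_gibbs h O (bmeasX 2 mS).
rewrite iterS; apply: le_trans (var_gibbs_le_energy h C0 pC mS) _.
rewrite -[leRHS]mulr1 ler_wpM2l// mulrC ler_pdivrMr// mul1r.
apply: Rint_le => [|x]; last exact: gibbs_var.
rewrite (_ : (fun _ => _) =
    (fun x => Q (fun u => S (iter k P f) u ^+ 2) x - Q (S (iter k P f)) x ^+ 2)).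
  by apply: bmeasB => //; exact: bmeasX.
by apply/funext => x; rewrite var_kopE.
Qed.

End chain.

Section sampler_laws.
Context {R : realType} {d : nat} {dT} {T : measurableType dT} (P : probability T R).
Notation E := 'rV[R]_d.
Variables (h : {posnum R}) (V : potential R d) (mu0 : probability E R).
Variables (X Y : nat -> {RV P >-> E}).
Hypothesis XY : proximal_sampler V mu0 h%:num X Y.
Notation O := (@zero_potential R d).

Let conditional_distribution G (Z W : {RV P >-> E}) (K : E -> set E -> \bar R)
    (L : E -> probability E R) :
  (forall z B, measurable B -> K z B = L z B) ->
  (forall B, measurable B -> measurable_fun setT (L ^~ B)) ->
  conditional_law P G W (fun w => K (Z w)) ->
  forall B, measurable B -> distribution P W B = (\int[distribution P Z]_z L z B)%E.
Proof.
(* The conditional law is integrated over the whole space, which leaves a relation between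
   successive marginals. *)
move=> KL mL H B mB; have [_ /(_ setT)] := H B mB.
rewrite setTI => HT.
transitivity (P (W @^-1` B)); first by [].
rewrite HT; last exact: (@measurableT _ (g_sigma_algebraType G)).
rewrite ge0_integral_pushforward//; last exact: mL.
by apply: eq_integral => w _; exact: KL.
Qed.

Lemma distribution_forward k B : measurable B ->
  distribution P (Y k) B = (\int[distribution P (X k)]_x gibbs h O x B)%E.
Proof.
have [_ H _] := XY; move: B.
apply: (@conditional_distribution _ (X k) (Y k) (gaussian h%:num) (gibbs h O) _ _ (H k)).
- by move=> z A mA; exact: gaussian_gibbs.
- exact: measurable_gibbs.
Qed.

Lemma distribution_backward k B : measurable B ->
  distribution P (X k.+1) B = (\int[distribution P (Y k)]_y gibbs h V y B)%E.
Proof.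
have [_ _ H] := XY; move: B.
apply: (@conditional_distribution _ (Y k) (X k.+1)
  (fun y => law_of_density (backward_density h%:num V y)) (gibbs h V) _ _ (H k)).
- by move=> z A mA; exact: law_of_density_gibbs.
- exact: measurable_gibbs.
Qed.

End sampler_laws.

(** * The mixing window *)

Section distance_to_set.
Context {R : realType} {d : nat}.
Notation E := 'rV[R]_d.
Implicit Types (f : E -> R) (x y : E).

Lemma lipschitz1_continuous f : lipschitz1 f -> continuous f.
Proof.
move=> lf x; apply/(@cvgrPdist_lt _ _ _ _ (nbhs_filter x)) => e e0.
(* The added 1 keeps the divisor positive in dimension 0. *)
have s0 : 0 < Num.sqrt d%:R + 1 :> R by rewrite ltr_wpDl// sqrtr_ge0.
apply: (iffRL (@nbhs_normP R E x _)); exists (e / (Num.sqrt d%:R + 1)) => /=.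
  by rewrite divr_gt0.
move=> y; rewrite /ball_ /= ltr_pdivlMr// => xy.
have H u v : f u - f v <= Num.sqrt d%:R * `|u - v|.
  by rewrite lerBlDl; apply: le_trans (lf u v) _; rewrite lerD2l; exact: enorm_le_norm.
apply: le_lt_trans xy.
apply: (@le_trans _ _ (Num.sqrt d%:R * `|x - y|)).
  by rewrite ler_norml H andbT lerNl opprB distrC H.
by rewrite mulrC ler_wpM2l// lerDl.
Qed.

Definition set_dist (A : set E) x : R := inf [set enorm (x - y) | y in A].

Variable A : set E.
Hypothesis A0 : A !=set0.

Let has_inf_dist x : has_inf [set enorm (x - y) | y in A].
Proof.
split; first by have [y Ay] := A0; exists (enorm (x - y)), y.
by exists 0 => _ [y _ <-]; exact: enorm_ge0.
Qed.

Lemma set_dist_ge0 x : 0 <= set_dist A x.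
Proof.
by apply: lb_le_inf; [have [] := has_inf_dist x|move=> _ [y _ <-]; exact: enorm_ge0].
Qed.

Lemma set_dist_le x y : A y -> set_dist A x <= enorm (x - y).
Proof. by move=> Ay; apply: ge_inf; [have [] := has_inf_dist x|exists y]. Qed.

Lemma le_set_dist x (u : R) : (forall y, A y -> u <= enorm (x - y)) -> u <= set_dist A x.
Proof.
by move=> H; apply: lb_le_inf; [have [] := has_inf_dist x|move=> _ [y Ay <-]; exact: H].
Qed.

Lemma set_dist_lipschitz1 : lipschitz1 (set_dist A).
Proof.
move=> x z; rewrite -lerBlDr; apply: le_set_dist => y Ay; rewrite lerBlDr addrC.
by apply: le_trans (set_dist_le x Ay) _; exact: enorm_triangle.
Qed.

Lemma set_dist_eq0 x : A x -> set_dist A x = 0.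
Proof.
move=> Ax; apply/eqP; rewrite eq_le set_dist_ge0 andbT.
apply: le_trans (set_dist_le x Ax) _.
by rewrite subrr /enorm /sqnorm big1 ?sqrtr0// => i _; rewrite mxE expr0n.
Qed.

(** Truncation brings the distance into the class [bmeas] without spoiling the Lipschitz bound. *)
Definition trunc_dist (M : R) x : R := Num.min (set_dist A x) M.

Lemma trunc_dist_bmeas M : bmeas (trunc_dist M).
Proof.
apply: bmeas_min; last exact: set_dist_ge0.
by apply: measurable_fun_continuous_rV; apply: lipschitz1_continuous; exact: set_dist_lipschitz1.
Qed.

Lemma trunc_dist_lipschitz1 M : lipschitz1 (trunc_dist M).
Proof.
move=> x y; rewrite /trunc_dist; have := set_dist_lipschitz1 x y; have := enorm_ge0 (x - y).
by case: (leP (set_dist A x) M); case: (leP (set_dist A y) M) => *; lra.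
Qed.

Lemma trunc_dist_eq0 M x : 0 <= M -> A x -> trunc_dist M x = 0.
Proof. by move=> M0 Ax; rewrite /trunc_dist set_dist_eq0// min_l. Qed.

Lemma le_trunc_dist (c t : R) x : 0 < t -> 0 <= c ->
  (forall y, A y -> c <= sqnorm (x - y) / t) ->
  forall M, c * t <= M ^+ 2 -> 0 <= M -> c <= trunc_dist M x ^+ 2 / t.
Proof.
move=> t0 c0 H M cM M0; have ct0 : 0 <= c * t by rewrite mulr_ge0// ltW.
rewrite ler_pdivlMr//.
have uM : Num.sqrt (c * t) <= M by rewrite -(ler_sqr _ _) ?nnegrE ?sqrtr_ge0// sqr_sqrtr.
have ud : Num.sqrt (c * t) <= set_dist A x.
  apply: le_set_dist => y Ay; rewrite -(ler_sqr _ _) ?nnegrE ?sqrtr_ge0 ?enorm_ge0//.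
  by rewrite sqr_sqrtr// sqr_enorm -ler_pdivlMr// H.
rewrite -[leLHS]sqr_sqrtr//; rewrite (ler_sqr _ _) ?nnegrE ?sqrtr_ge0//.
  by rewrite /trunc_dist le_min ud uM.
by rewrite /trunc_dist le_min set_dist_ge0.
Qed.

End distance_to_set.

(** By Cauchy-Schwarz on the complement of [A], the squared mean of [r] is at most [1 - a] times its
    second moment, so the variance is at least [a] times the second moment. The constant [c] is the
    optimal one in that Cauchy-Schwarz inequality. *)
Lemma second_moment_vanishing {R : realType} d (T : measurableType d) (mu : probability T R)
  (A : set T) (r : T -> R) (a v : R) : measurable A -> bmeas r -> (forall x, A x -> r x = 0) ->
  0 < a -> a < 1 -> a <= \int[mu]_x \1_A x -> var mu r <= v ->
  \int[mu]_x (r x ^+ 2) <= v / a.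
Proof.
move=> mA mr rA a0 a1 aA vr.
set m := \int[mu]_x r x; set S := \int[mu]_x _.
have q0 : 0 < 1 - a by rewrite subr_gt0.
pose c := m / (1 - a).
have mr2 := bmeasX 2 mr.
have mI : bmeas (\1_A : T -> R) by exact: bmeas_indic.
have m1 : bmeas (fun x => (2 * c) * r x) by exact: bmeasZ.
have m2 : bmeas (fun x => c ^+ 2 * (\1_A x : R)) by exact: bmeasZ.
have mc : bmeas (cst (c ^+ 2) : T -> R) by exact: bmeas_cst.
have H : 0 <= \int[mu]_x (r x ^+ 2 - (2 * c) * r x + c ^+ 2 - c ^+ 2 * \1_A x).
  apply: Rint_ge => [|x].
    by apply: bmeasB => //; apply: bmeasD => //; exact: bmeasB.
  rewrite indicE; case: (boolP (x \in A)) => [/set_mem Ax|_].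
    by rewrite rA// expr0n/= mulr0 subr0 add0r mulr1 subrr.
  by rewrite mulr0 subr0 (_ : _ + _ = (r x - c) ^+ 2) ?sqr_ge0//; ring.
rewrite RintB// in H; last by apply: bmeasD => //; exact: bmeasB.
rewrite RintD// in H; last exact: bmeasB.
rewrite RintB// Rint_cst (RintZ mu (2 * c) mr) (RintZ mu (c ^+ 2) mI) -/m -/S in H.
rewrite (varE mu mr) -/m -/S in vr.
have c2 : c ^+ 2 * a <= c ^+ 2 * \int[mu]_x \1_A x by rewrite ler_wpM2l// sqr_ge0.
have mE : m = c * (1 - a) by rewrite /c divfK// gt_eqF.
rewrite ler_pdivlMr//.
move: H c2 vr; rewrite mE; move: (\int[mu]_x \1_A x) => z.
clearbody c S; clear -q0 a0 a1; nra.
Qed.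

Section escape.
Context {R : realType} {d : nat}.
Notation E := 'rV[R]_d.
Variables (h : {posnum R}) (V : potential R d).
Notation h' := (h%:num).
Notation P := (proximal_op h V).
Implicit Types (f : E -> R) (mu : probability E R).

Lemma kop_affine (k : E -> probability E R) f (a b : R) x : bmeas f ->
  kop k (fun u => a + b * f u) x = a + b * kop k f x.
Proof.
move=> mf; have mc : bmeas (cst a : E -> R) by exact: bmeas_cst.
have mb := bmeasZ b mf.
by rewrite (kopD k x mc mb) kop_cst (kopZ k b x mf).
Qed.

Lemma proximal_iter_affine n f (a b : R) : bmeas f ->
  iter n P (fun u => a + b * f u) = (fun x => a + b * iter n P f x).
Proof.
move=> mf; elim: n => [//|n IH]; rewrite !iterS IH; apply/funext => x.
have mn := bmeas_iter h V n mf; have mS := bmeas_gibbs h V mn.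
rewrite /proximal_op -(kop_affine _ a b x mS); congr (kop _ _ x).
by apply/funext => y; rewrite (kop_affine _ a b y mn).
Qed.

Lemma proximal_iter_ge0 n f : bmeas f -> (forall u, 0 <= f u) -> forall x, 0 <= iter n P f x.
Proof. by move=> mf; have [_] := stable_proximal_iter h V n mf; exact. Qed.

Lemma proximal_iter_le1 n f : bmeas f -> (forall u, f u <= 1) -> forall x, iter n P f x <= 1.
Proof.
move=> mf f1 x; have m1 : bmeas (fun u => 1 + (-1) * f u).
  by apply: bmeasD; [exact: bmeas_cst|exact: bmeasZ].
have : 0 <= iter n P (fun u => 1 + (-1) * f u) x.
  by apply: proximal_iter_ge0 => // u; rewrite mulN1r subr_ge0.
by rewrite proximal_iter_affine// mulN1r subr_ge0.
Qed.

(** The log-Harnack inequality is applied to the function equal to 1 on [D] and to [expR (- L)]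
    elsewhere. Its logarithm is affine in the indicator, and its image at [y] is at most
    [2 * expR (- L)]. *)
Lemma harnack_indic n (D : set E) (L : R) x y : measurable D -> 0 <= L ->
  iter n.+1 P \1_D y <= expR (- L) ->
  L * iter n.+1 P \1_D x <= ln 2 + sqnorm (x - y) / (2 * (2 * n.+1%:R * h')).
Proof.
move=> mD L0; have mI : bmeas (\1_D : E -> R) by exact: bmeas_indic.
have e0 : 0 < expR (- L) by exact: expR_gt0.
have e1 : expR (- L) <= 1 by rewrite -expR0 ler_expR oppr_le0.
pose f u : R := expR (- L) + (1 - expR (- L)) * \1_D u.
have mf : bmeas f by apply: bmeasD; [exact: bmeas_cst|exact: bmeasZ].
have cf u : expR (- L) <= f u.
  by rewrite /f lerDl mulr_ge0 ?subr_ge0// indicE ler0n.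
have lnf : (fun u => ln (f u)) = (fun u => - L + L * \1_D u).
  apply/funext => u; rewrite /f indicE; case: (u \in D).
    by rewrite !mulr1 addrC subrK addNr ln1.
  by rewrite !mulr0 !addr0 expRK.
have := log_harnack_proximal h V n e0 cf mf x y.
rewrite lnf (proximal_iter_affine n.+1 _ _ mI) (proximal_iter_affine n.+1 _ _ mI).
have py0 : 0 <= iter n.+1 P \1_D y by apply: proximal_iter_ge0 => // u; rewrite indicE ler0n.
move: py0; move: (iter n.+1 P \1_D y) (iter n.+1 P \1_D x) => p q.
move: (sqnorm _ / _) => s p0 H pe.
have : ln (expR (- L) + (1 - expR (- L)) * p) <= ln 2 - L.
  have -> : ln 2 - L = ln (2 * expR (- L)) by rewrite lnM ?posrE// expRK.
  rewrite ler_ln ?posrE ?mulr_gt0//; last first.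
    by rewrite ltr_wpDr// mulr_ge0// subr_ge0.
  move: p0 e0 e1 pe; move: (expR _) => e *; nra.
lra.
Qed.

Lemma escape_bound mu n (D : set E) (L a v : R) : measurable D -> 0 <= L ->
  0 < a -> a < 1 -> (forall f, bmeas f -> lipschitz1 f -> var mu f <= v) ->
  a <= \int[mu]_x \1_[set y | iter n.+1 P \1_D y <= expR (- L)] x ->
  L * \int[mu]_x iter n.+1 P \1_D x <= ln 2 + v / a / (2 * (2 * n.+1%:R * h')).
Proof.
move=> mD L0 a0 a1 vmu; set p := iter n.+1 P \1_D; set A := [set y | _] => aA.
have mI : bmeas (\1_D : E -> R) by exact: bmeas_indic.
have mp : bmeas p by exact: bmeas_iter.
have p1 x : p x <= 1 by apply: proximal_iter_le1 => // u; rewrite indicE lern1 leq_b1.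
have mA : measurable A.
  rewrite /A -[X in measurable X]setTI -[X in _ `&` X]/(p @^-1` [set` `]-oo, expR (- L)]]).
  by apply: mp.1.
have A0 : A !=set0.
  apply/set0P/negP => /eqP A0; move: aA; rewrite A0.
  have -> : (\1_set0 : E -> R) = cst 0 by apply/funext => x; rewrite indicE in_set0.
  by rewrite Rint_cst leNgt a0.
set t := 2 * (2 * n.+1%:R * h').
have t0 : 0 < t by rewrite !mulr_gt0.
have Lt0 : 0 <= L * t by rewrite mulr_ge0// ltW.
(* Since [p <= 1], the quantity to be bounded never exceeds [L = M ^+ 2 / t], so truncating the
   distance at [M] loses nothing. *)
pose M := Num.sqrt (L * t); have M0 : 0 <= M by exact: sqrtr_ge0.
pose r := trunc_dist A M.
have mr : bmeas r by exact: trunc_dist_bmeas.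
have lr : lipschitz1 r by exact: trunc_dist_lipschitz1.
have ln20 : 0 <= ln 2 :> R by rewrite ln_ge0// ler1n.
have rA x : A x -> r x = 0 by exact: trunc_dist_eq0.
have ptw x : L * p x <= ln 2 + t^-1 * r x ^+ 2.
  rewrite -lerBlDl; have [c0|c0] := leP 0 (L * p x - ln 2); last first.
    by apply: le_trans (ltW c0) _; rewrite mulr_ge0 ?sqr_ge0// invr_ge0 ltW.
  rewrite [leRHS]mulrC; apply: (le_trunc_dist A0) => //.
    move=> y Ay; rewrite lerBlDl; exact: harnack_indic.
  rewrite /M sqr_sqrtr// ler_pM2r//.
  have := ler_wpM2l L0 (p1 x); rewrite mulr1; move: ln20; clear; lra.
have mr2 := bmeasX 2 mr; have mr3 := bmeasZ t^-1 mr2.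
have mc : bmeas (cst (ln 2) : E -> R) by exact: bmeas_cst.
have mR : bmeas (fun x => ln 2 + t^-1 * r x ^+ 2) by exact: bmeasD.
rewrite -(RintZ mu L mp); apply: le_trans (le_Rint mu (bmeasZ L mp) mR ptw) _.
rewrite (RintD mu mc mr3) Rint_cst (RintZ mu t^-1 mr2) lerD2l mulrC.
rewrite ler_pM2r ?invr_gt0//.
by apply: (second_moment_vanishing mA) => //; exact: vmu.
Qed.

End escape.

(** The base of the power is [1 - 1 / (1 + C / h)]. *)
Lemma contraction_factor_le {R : realType} (C h : R) m : 0 <= C -> 0 < h ->
  (C / (C + h)) ^+ m <= expR (- (m%:R / (1 + C / h))).
Proof.
move=> C0 h0; have Ch : 0 < C + h by rewrite ltr_wpDl.
rewrite -mulrN expRM_natl; apply: lerXn2r; rewrite ?nnegrE ?expR_ge0// ?divr_ge0 ?(ltW Ch)//.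
apply: le_trans (expR_ge1Dx _); rewrite le_eqVlt; apply/orP; left; apply/eqP.
by field; rewrite !gt_eqF// addrC.
Qed.

(** Origin of the logarithm: Chebyshev's inequality costs [e ^+ 2], and the complement of the good
    set may have mass [e / 2]. *)
Lemma threshold_le {R : realType} (L q r e : R) : 0 < e -> L <= q - ln (2 / e ^+ 3) ->
  r <= expR (- q) -> r / e ^+ 2 <= expR (- L) * (e / 2).
Proof.
move=> e0 Lq rq; have e3 : 0 < 2 / e ^+ 3 by rewrite divr_gt0// exprn_gt0.
have : 2 / e ^+ 3 * r <= expR (- L).
  apply: le_trans (ler_wpM2l (ltW e3) rq) _.
  by rewrite -{1}(lnK e3) -expRD ler_expR; lra.
move=> H; have e20 : 0 <= e / 2 by rewrite divr_ge0// ltW.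
apply: le_trans (ler_wpM2r e20 H).
rewrite le_eqVlt; apply/orP; left; apply/eqP.
by field; rewrite gt_eqF.
Qed.

Lemma bernoulli_var_le {R : realType} (b : R) : b - b ^+ 2 <= 4^-1.
Proof. by have := sqr_ge0 (b - 2^-1); nra. Qed.

Lemma sqr_dist_ge {R : realType} (e b p : R) : 0 < e -> p < b - e / 2 ->
  (e / 2) ^+ 2 <= (p - b) ^+ 2.
Proof.
move=> e0 H; rewrite -[leRHS]sqrrN opprB ler_sqr ?nnegrE; lra.
Qed.

Lemma rescale_le {R : realType} (e v p r : R) :
  v <= r / 4 -> (e / 2) ^+ 2 * p <= v -> p * e ^+ 2 <= r.
Proof. by rewrite exprMn; lra. Qed.

Section window.
Context {R : realType} {d : nat}.
Notation E := 'rV[R]_d.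
Notation leb := (@lebesgue_rV R d).
Variables (h : {posnum R}) (V : potential R d) (pi : probability E R).
Variables mu nu : nat -> probability E R.
Notation h' := (h%:num).
Notation O := (@zero_potential R d).
Notation P := (proximal_op h V).
Hypothesis piE : forall A, measurable A -> pi A = (\int[leb]_(x in A) (expR (- V x))%:E)%E.
Hypothesis nuE : forall k B, measurable B -> nu k B = (\int[mu k]_x gibbs h O x B)%E.
Hypothesis muE : forall k B, measurable B -> mu k.+1 B = (\int[nu k]_y gibbs h V y B)%E.
Variables (C C0 eps : R).
Hypotheses (C_ge0 : 0 <= C) (C0_ge0 : 0 <= C0) (eps_gt0 : 0 < eps) (eps_lt : eps < 2^-1).
Hypotheses (pC : poincare_inequality pi C) (pC0 : poincare_inequality (mu 0) C0).
Implicit Types (f : E -> R) (B : set E).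

Let indic B : measurable B -> bmeas (\1_B : E -> R).
Proof. exact: bmeas_indic. Qed.

Let indic_ge0 B (u : E) : (0 : R) <= \1_B u.
Proof. by rewrite indicE ler0n. Qed.

Let indic_le1 B (u : E) : \1_B u <= 1 :> R.
Proof. by rewrite indicE lern1 leq_b1. Qed.

Let var_indic B : measurable B -> var pi \1_B <= 4^-1.
Proof.
move=> mB; have mI := indic mB; rewrite varE//.
have -> : \int[pi]_x (\1_B x ^+ 2) = \int[pi]_x \1_B x :> R.
  by apply: eq_Rintegral => x _; rewrite indicE; case: (x \in B); rewrite ?expr1n ?expr0n.
exact: bernoulli_var_le.
Qed.

Let level_set_measurable f (c : R) : bmeas f -> measurable [set x | f x < c].
Proof.
move=> mf; rewrite -[X in measurable X]setTI.
by rewrite -[X in _ `&` X]/(f @^-1` [set` `]-oo, c[]); apply: mf.1.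
Qed.

Lemma window_step (k n m : nat) (L : R) : 0 < L ->
  (forall A, measurable A -> \int[pi]_x \1_A x - (1 - eps) <= \int[mu k.+1]_x \1_A x) ->
  L <= m%:R / (1 + C / h') - ln (2 / eps ^+ 3) ->
  ln 2 + (2 * k.+1%:R + C0 / h') / (2 * n.+1%:R * eps) <= L * (eps / 2) ->
  forall B, measurable B ->
    \int[pi]_x \1_B x - eps <= \int[mu (k.+1 + n.+1 + m)]_x \1_B x.
Proof.
move=> L0 Hk hL hn B mB; set b := \int[pi]_x \1_B x.
have mI := indic mB; pose phi := iter m P \1_B.
have mphi : bmeas phi by exact: bmeas_iter.
have phi0 x : 0 <= phi x by apply: proximal_iter_ge0.
pose D := [set x | phi x < b - eps / 2].
have mD : measurable D by exact: level_set_measurable.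
have mID := indic mD; set piD := \int[pi]_x \1_D x.
pose q := m%:R / (1 + C / h').
have rq : (C / (C + h')) ^+ m <= expR (- q) by exact: contraction_factor_le.
set rho := _ ^+ m in rq.
have rho0 : 0 <= rho by rewrite /rho exprn_ge0// divr_ge0// addr_ge0.
have b_phi : \int[pi]_x phi x = b by exact: integral_proximal_iter.
have vphi : var pi phi <= rho / 4.
  apply: le_trans (var_proximal_iter h piE m C_ge0 pC mI) _.
  by rewrite ler_wpM2l// var_indic.
(* The 1/4 from the gap [eps / 2] cancels the 1/4 from the variance of an indicator. *)
have chebyshev : piD <= rho / eps ^+ 2.
  have mc : bmeas (cst b : E -> R) by exact: bmeas_cst.
  have m2 : bmeas (fun x => (phi x - b) ^+ 2) by apply: bmeasX; exact: bmeasB.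
  have : (eps / 2) ^+ 2 * piD <= var pi phi.
    rewrite /var b_phi -(RintZ pi ((eps / 2) ^+ 2) mID).
    apply: le_Rint => //; first exact: bmeasZ.
    move=> x; rewrite indicE; case: (boolP (x \in D)) => [/set_mem|_].
      by rewrite /D /= mulr1; exact: sqr_dist_ge.
    by rewrite mulr0 sqr_ge0.
  by rewrite ler_pdivlMr ?exprn_gt0//; move: vphi; exact: rescale_le.
pose p := iter n.+1 P \1_D.
have mp : bmeas p by exact: bmeas_iter.
have p0 x : 0 <= p x by apply: proximal_iter_ge0.
have b_p : \int[pi]_x p x = piD by exact: integral_proximal_iter.
have thr := threshold_le eps_gt0 hL rq.
pose A := [set y | p y <= expR (- L)].
have mA : measurable A.
  rewrite /A -[X in measurable X]setTI -[X in _ `&` X]/(p @^-1` [set` `]-oo, expR (- L)]]).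
  by apply: mp.1.
have mIA := indic mA.
(* Markov's inequality for [p], whose mean under [pi] is [piD]. *)
have piA : 1 - eps / 2 <= \int[pi]_x \1_A x.
  have m1 : bmeas (fun x => 1 - (\1_A x : R)).
    by apply: bmeasB => //; exact: bmeas_cst.
  have : expR (- L) * (1 - \int[pi]_x \1_A x) <= piD.
    rewrite -b_p.
    have -> : 1 - \int[pi]_x \1_A x = \int[pi]_x (1 - \1_A x).
      by rewrite (RintB pi (bmeas_cst 1) mIA) Rint_cst.
    rewrite -(RintZ pi (expR (- L)) m1); apply: le_Rint => //; first exact: bmeasZ.
    move=> x; rewrite indicE; case: (boolP (x \in A)) => [_|xA]; first by rewrite subrr mulr0.
    rewrite subr0 mulr1 ltW// ltNge; apply/negP => xp; move/negP: xA; apply.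
    exact/mem_set.
  move=> /le_trans /(_ (le_trans chebyshev thr)).
  by rewrite ler_pM2l ?expR_gt0//; lra.
have muA : eps / 2 <= \int[mu k.+1]_x \1_A x.
  apply: le_trans (Hk A mA); move: piA; lra.
have e21 : eps / 2 < 1 by move: eps_lt eps_gt0; lra.
have e20 : 0 < eps / 2 by rewrite divr_gt0.
have vmu f : bmeas f -> lipschitz1 f -> var (mu k.+1) f <= 2 * k.+1%:R * h' + C0.
  by move=> mf lf; exact: (var_chain nuE muE k C0_ge0 pC0 mf lf).
have muD : \int[mu (k.+1 + n.+1)]_x \1_D x <= eps / 2.
  rewrite (Rint_chain nuE muE k.+1 n.+1 mID).
  have := escape_bound mD (ltW L0) e20 e21 vmu muA.
  have -> : (2 * k.+1%:R * h' + C0) / (eps / 2) / (2 * (2 * n.+1%:R * h')) =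
      (2 * k.+1%:R + C0 / h') / (2 * n.+1%:R * eps).
    by field; rewrite !gt_eqF.
  move=> /le_trans /(_ hn); rewrite ler_pM2l//.
rewrite (Rint_chain nuE muE (k.+1 + n.+1) m mI) -/phi.
have mc : bmeas (cst (b - eps / 2) : E -> R) by exact: bmeas_cst.
have b1 : b <= 1 by apply: Rint_le.
(* On [D] the lower bound for [phi] is at most 0 because [b <= 1]; off [D] it is the definition of
   [D]. *)
apply: (@le_trans _ _ (\int[mu (k.+1 + n.+1)]_x ((b - eps / 2) - \1_D x))).
  rewrite (RintB _ mc mID) Rint_cst; move: muD; lra.
apply: le_Rint => //; first exact: bmeasB.
move=> x; rewrite indicE; case: (boolP (x \in D)) => [_|xD].
  apply: le_trans (phi0 x); rewrite subr_le0 (le_trans _ b1)// lerBlDr lerDl ltW//.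
by rewrite subr0 leNgt; apply/negP => xp; move/negP: xD; apply; exact/mem_set.
Qed.

End window.

(** * Test functions, choice of the numbers of steps, and mixing times *)

Section log_concave_potential.
Context {R : realType} {d : nat}.
Notation E := 'rV[R]_d.
Variables (pi : probability E R) (V : E -> R).
Hypothesis hpi : log_concave_with_potential pi V.

Let mV : measurable_fun setT V.
Proof. by have [_ [cV _] _] := hpi; exact: measurable_fun_continuous_rV. Qed.

Let convV (l : R) u v : 0 < l -> l < 1 ->
  V ((1 - l) *: u + l *: v) <= (1 - l) * V u + l * V v.
Proof.
move=> l0 l1; have [H _ _] := hpi.
(* In the library's convex combination the first point carries the weight [l], hence the order [v],
   [u]. *)
have := H (Itv01 (ltW l0) (ltW l1)) v u (mem_set I) (mem_set I).
by rewrite [X in _ <= X -> _]addrC [X in V X]addrC.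
Qed.

Let ltyV (h : R) : 0 < h ->
  (\int[lebesgue_rV d]_x (expR (- V x - sqnorm x / (2 * h)))%:E < +oo)%E.
Proof.
move=> h0; have [_ _ H] := hpi.
apply: (@le_lt_trans _ _ 1%E); last exact: ltry.
have mV2 : measurable_fun setT (fun x => expR (- V x)).
  by apply: measurableT_comp => //; apply: measurableT_comp => //; exact: mV.
have <- : pi setT = 1%E by exact: probability_setT.
rewrite H//; apply: ge0_le_integral => //.
- apply/measurable_EFinP; apply: measurableT_comp => //; apply: measurable_funB.
    by apply: measurableT_comp => //; exact: mV.
  apply: measurable_funM => //; rewrite /sqnorm; apply: measurable_sum => i.
  by apply: measurable_funX; exact: measurable_coord_rV.
- exact/measurable_EFinP.
- move=> x _; rewrite lee_fin ler_expR gerDl oppr_le0 divr_ge0 ?sqnorm_ge0//.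
  by rewrite mulr_ge0// ltW.
Qed.

Definition log_concave_potential : potential R d := Potential mV convV ltyV.

End log_concave_potential.

(** The law of X_0 is only known to agree with the initial measure on measurable sets. *)
Lemma eq_poincare {R : realType} {d : nat} (m1 m2 : probability 'rV[R]_d R) (C : R) :
  (forall B, measurable B -> m1 B = m2 B) ->
  poincare_inequality m1 C -> poincare_inequality m2 C.
Proof.
move=> m12 H f sf.
have I f' : (\int[m2]_x f' x = \int[m1]_x f' x)%E.
  by apply: eq_measure_integral => A mA _; apply: esym; exact: m12.
have := H f sf; rewrite /variance !unlock.
by rewrite !I.
Qed.

Lemma sum_ltn_min N t : (\sum_(j < N) (j < t) = minn N t)%N.
Proof.
elim: N => [|N IH]; first by rewrite big_ord0 min0n.
rewrite big_ord_recr/= IH; case: (ltnP N t) => Nt; first by rewrite addn1 (minn_idPl Nt).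
by rewrite addn0 (minn_idPr (leqW Nt)).
Qed.

Lemma staircase {R : realType} N (y : R) : 0 <= y -> y <= N%:R ->
  let s : R := \sum_(j < N) (j.+1%:R <= y)%R%:R in s <= y /\ y <= s + 1.
Proof.
move=> y0 yN s.
have tN : (Num.truncn y <= N)%N.
  by rewrite truncn_le_nat (le_lt_trans yN)// ltr_nat.
have -> : s = (Num.truncn y)%:R.
  rewrite -(minn_idPr tN) -sum_ltn_min natr_sum; apply: eq_bigr => j _.
  by rewrite truncn_ge_nat.
have /andP[t1 t2] := truncn_itv y0; split => //.
by rewrite natr1 ltW.
Qed.

Lemma bmeas_sum {R : realType} d {T : measurableType d} N (f : nat -> T -> R) :
  (forall j, bmeas (f j)) -> bmeas (fun x => \sum_(j < N) f j x).
Proof.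
move=> mf; elim: N => [|N mN].
  by under eq_fun do rewrite big_ord0; exact: bmeas_cst.
by under eq_fun do rewrite big_ord_recr/=; exact: bmeasD.
Qed.

(** Layer cake: [N * g] is within 1 of the sum of the indicators of [N] of its level sets. Each
    indicator costs [c], and after division by [N] the rounding costs at most [e]. *)
Lemma tv_test_function {R : realType} d {T : measurableType d} (m1 m2 : probability T R)
    (c : R) (g : T -> R) :
  (forall A, measurable A -> \int[m1]_x \1_A x - c <= \int[m2]_x \1_A x) ->
  bmeas g -> (forall x, 0 <= g x) -> (forall x, g x <= 1) ->
  \int[m1]_x g x - c <= \int[m2]_x g x.
Proof.
move=> H mg g0 g1; apply/ler_addgt0Pr => e e0.
pose N := (Num.truncn e^-1).+1; have N0 : 0 < N%:R :> R by [].
have Ne : 1 <= N%:R * e.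
  by rewrite -ler_pdivrMr// div1r ltW// /N; exact: truncnS_gt.
pose A j := [set x | j.+1%:R <= N%:R * g x].
have mNg : bmeas (fun x => N%:R * g x) by exact: bmeasZ.
have mA j : measurable (A j).
  have -> : A j = setT `&` (fun x => N%:R * g x) @^-1` [set` `[j.+1%:R, +oo[].
    by rewrite setTI; apply/seteqP; split => x /=; rewrite in_itv/= andbT.
  by apply: mNg.1.
have mI j : bmeas (\1_(A j) : T -> R) by exact: bmeas_indic.
have st x : \sum_(j < N) \1_(A j) x <= N%:R * g x /\ N%:R * g x <= \sum_(j < N) \1_(A j) x + 1.
  have sE : \sum_(j < N) \1_(A j) x = \sum_(j < N) (j.+1%:R <= N%:R * g x)%R%:R :> R.
    apply: eq_bigr => j _; rewrite indicE; congr (_ %:R); congr nat_of_bool.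
    by apply/idP/idP => [/set_mem|H1]; [|exact/mem_set].
  rewrite sE; apply: staircase; first by rewrite mulr_ge0.
  by rewrite -[leRHS]mulr1 ler_wpM2l.
have mS := bmeas_sum N mI.
have S (m : probability T R) :
    \int[m]_x (\sum_(j < N) \1_(A j) x) = \sum_(j < N) \int[m]_x \1_(A j) x :> R.
  apply: (@Rint_sum _ _ _ m _ _ (fun (j : 'I_N) x => \1_(A j) x)) => j.
  exact/bmeas_integrable/mI.
have mS1 : bmeas (fun x => \sum_(j < N) \1_(A j) x + (1 : R)).
  by apply: bmeasD => //; exact: bmeas_cst.
have H1 : N%:R * \int[m1]_x g x <= \sum_(j < N) \int[m1]_x \1_(A j) x + 1.
  rewrite -S -(RintZ m1 N%:R mg); apply: le_trans (le_Rint m1 mNg mS1 (fun x => (st x).2)) _.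
  by rewrite (RintD m1 mS (bmeas_cst 1)) Rint_cst.
have H2 : \sum_(j < N) \int[m2]_x \1_(A j) x <= N%:R * \int[m2]_x g x.
  by rewrite -S -(RintZ m2 N%:R mg); apply: le_Rint => // x; exact: (st x).1.
have H3 : \sum_(j < N) \int[m1]_x \1_(A j) x <= \sum_(j < N) \int[m2]_x \1_(A j) x + N%:R * c.
  rewrite -[N in N%:R * c]card_ord mulr_natl -sumr_const -big_split/=.
  by apply: ler_sum => j _; rewrite -lerBlDr; exact: H.
rewrite -(ler_pM2l N0) mulrBr mulrDr.
move: H1 H2 H3 Ne; move: (\sum_(j < N) _) (\sum_(j < N) _).
by move: (N%:R * _) (N%:R * _) (N%:R * _) (N%:R * _) => *; lra.
Qed.

Lemma ln_cube_le {R : realType} (e : R) : 0 < e -> ln (2 / e ^+ 3) <= 1 + 3 * (e^-1 - 1).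
Proof.
move=> e0; have u0 : 0 < e^-1 by rewrite invr_gt0.
have lnle (x : R) : 0 < x -> ln x <= x - 1.
  move=> x0; have := @le_ln1Dx R (x - 1); rewrite (addrC 1) subrK; apply; lra.
rewrite -exprVn lnM ?posrE ?exprn_gt0// lnXn// -[_ *+ 3]mulr_natl.
have := lnle 2 (ltr0Sn R 1); have := lnle _ u0; lra.
Qed.

(** The factor 3 leaves ample room; [window_count] uses this bound twice, which makes the 6 in front
    of both square roots. *)
Lemma sqrt_window {R : realType} (K K0 T : R) : 1 <= K -> 1 <= K0 -> 0 <= T ->
  Num.sqrt ((2 * (T + 1) + (K0 - 1)) * K) <= 3 * (Num.sqrt (K * K0) + Num.sqrt (K * T)).
Proof.
move=> K1 K01 T0; set a := Num.sqrt (K * K0); set b := Num.sqrt (K * T).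
have a0 : 0 <= a by exact: sqrtr_ge0.
have b0 : 0 <= b by exact: sqrtr_ge0.
have a2 : a ^+ 2 = K * K0 by rewrite sqr_sqrtr// mulr_ge0//; lra.
have b2 : b ^+ 2 = K * T by rewrite sqr_sqrtr// mulr_ge0//; lra.
have ab : 0 <= 3 * (a + b) by rewrite mulr_ge0// addr_ge0.
rewrite -[leRHS]ger0_norm// -sqrtr_sqr; apply: ler_wsqrtr.
have ab0 : 0 <= a * b by rewrite mulr_ge0.
have -> : (3 * (a + b)) ^+ 2 = 9 * (a ^+ 2 + b ^+ 2) + 18 * (a * b) by ring.
rewrite a2 b2.
have : 0 <= K * (K0 - 1) by rewrite mulr_ge0//; lra.
have : 0 <= K * T by rewrite mulr_ge0//; lra.
move: ab0; move: (a * b) => z; clear -K1; nra.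
Qed.

(** The total is at most [2 * s + 3 + K * (5 * u - 2)] with [u = 1 / eps]: one [s] from the Harnack
    steps, one from the contraction steps, and 3 from the initial step and the two roundings. *)
Lemma window_count {R : realType} (K K0 eps : R) (T : nat) :
  1 <= K -> 1 <= K0 -> 0 < eps -> eps < 2^-1 ->
  exists n m L, [/\ 0 < L, L <= m%:R / K - ln (2 / eps ^+ 3),
    ln 2 + (2 * T.+1%:R + (K0 - 1)) / (2 * n.+1%:R * eps) <= L * (eps / 2) &
    (T.+1 + n.+1 + m)%:R - T%:R <=
      6 / eps * (K + Num.sqrt (K * K0) + Num.sqrt (K * T%:R)) ].
Proof.
move=> K1 K01 e0 e1; set c := _ + (K0 - 1).
have K0' : 0 < K by lra.
have c0 : 0 < c by rewrite /c ltr_wpDr ?mulr_gt0// subr_ge0.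
(* The value of [n] at which [n] and [K * c / (n * eps ^+ 2)] are equal. *)
set s := Num.sqrt (c * K) / eps.
have s0 : 0 < s by rewrite divr_gt0// sqrtr_gt0 mulr_gt0.
have s2 : c * K = s ^+ 2 * eps ^+ 2.
  by rewrite -exprMn divfK ?gt_eqF// sqr_sqrtr// ltW// mulr_gt0.
have /andP[N1 N2] := truncn_itv (ltW s0).
pose n := Num.truncn s; pose N : R := n.+1%:R.
have NS : s <= N by rewrite ltW.
have N0 : 0 < N by [].
have NS1 : N <= s + 1 by rewrite /N -natr1 lerD2r.
pose u := eps^-1; have u2 : 2 <= u by rewrite -[2]invrK lef_pV2 ?posrE// ltW.
(* The smallest admissible [L]: the third condition holds with equality. *)
pose L := 2 * u * ln 2 + c / (N * eps ^+ 2).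
have ln20 : 0 < ln 2 :> R by rewrite ln_gt0// ltr1n.
have ln21 : ln 2 <= 1 :> R by have := @le_ln1Dx R 1; rewrite -[1 + 1]/(2); apply; lra.
have cN : 0 < c / (N * eps ^+ 2) by rewrite divr_gt0// mulr_gt0// exprn_gt0.
have L0 : 0 < L by rewrite addr_gt0// !mulr_gt0// invr_gt0.
pose l := ln (2 / eps ^+ 3).
have l0 : 0 < l.
  rewrite ln_gt0// -exprVn -/u; have : 1 <= u ^+ 3 by apply: exprn_ege1; move: u2; lra.
  lra.
have l1 : l <= 1 + 3 * (u - 1) by exact: ln_cube_le.
(* The real value that the second condition imposes on [m]. *)
pose x := K * (L + l).
have x0 : 0 <= x by apply: mulr_ge0; [exact: ltW|apply: addr_ge0; exact: ltW].
have /andP[m1 m2] := truncn_itv x0; pose m := (Num.truncn x).+1.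
have xm : x <= m%:R by rewrite ltW.
have mx : m%:R <= x + 1 by rewrite /m -natr1 lerD2r.
exists n, m, L; split => //.
- by rewrite -/l lerBrDr ler_pdivlMr// mulrC.
- rewrite -/N le_eqVlt /L /u; apply/orP; left; apply/eqP.
  by field; rewrite !gt_eqF.
rewrite !natrD -(natr1 T) -/N.
have Kc : K * (c / (N * eps ^+ 2)) <= s.
  have -> : K * (c / (N * eps ^+ 2)) = s * (s / N).
    rewrite mulrA (mulrC K) s2; field; rewrite !gt_eqF//.
  by rewrite -[leRHS]mulr1 ler_pM2l// ler_pdivrMr// mul1r.
have xb : x <= s + K * (5 * u - 2).
  have -> : x = K * (c / (N * eps ^+ 2)) + K * (2 * u * ln 2 + l) by rewrite /x /L; ring.
  apply: lerD => //; rewrite ler_pM2l//.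
  have : u * ln 2 <= u * 1 by rewrite ler_pM2l//; lra.
  lra.
have sb : s <= u * (3 * (Num.sqrt (K * K0) + Num.sqrt (K * T%:R))).
  rewrite /s mulrC ler_pM2l ?invr_gt0// /c -(natr1 T); exact: sqrt_window.
(* Absorbs the additive 3, turning [5 * u * K] into [6 * u * K]. *)
have Ku : 3 - 2 * K <= u * K.
  have : 1 * 1 <= u * K by apply: ler_pM => //; lra.
  lra.
rewrite (_ : 6 / eps = 6 * u)//.
move: sb xb Ku NS1 mx; move: (Num.sqrt _) (Num.sqrt _) => a b.
move: (m%:R) (N) (T%:R) => M N' T'; clearbody u x s => sb xb Ku NS1 mx.
clear -sb xb Ku NS1 mx; lra.
Qed.

Section mixing.
Context {R : realType} {d : nat}.
Notation E := 'rV[R]_d.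
Implicit Types (m pi : probability E R) (mu : nat -> probability E R).

Lemma TV_le_indic m pi (c : R) : (TV m pi <= c%:E)%E ->
  forall A, measurable A -> \int[pi]_x \1_A x - c <= \int[m]_x \1_A x.
Proof.
move=> H A mA; have : (`|m A - pi A| <= c%:E)%E.
  by apply: le_trans H; apply: ereal_sup_ubound; exists A.
rewrite -(Rint_indic m mA) -(Rint_indic pi mA) -EFinB abse_EFin lee_fin ler_norml.
by case/andP; lra.
Qed.

(** The reverse inequality is the assumed one for the complement. *)
Lemma indic_le_TV m pi (c : R) :
  (forall A, measurable A -> \int[pi]_x \1_A x - c <= \int[m]_x \1_A x) ->
  (TV m pi <= c%:E)%E.
Proof.
move=> H; apply: ge_ereal_sup => _ [A mA <-].
rewrite -(Rint_indic m mA) -(Rint_indic pi mA) -EFinB abse_EFin lee_fin ler_norml.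
have H1 := H A mA; have H2 := H (~` A) (measurableC mA).
have indicC (p : probability E R) : \int[p]_x \1_(~` A) x = 1 - \int[p]_x \1_A x.
  rewrite -{1}(Rint_cst p 1) -RintB//; [|exact: bmeas_cst|exact: bmeas_indic].
  apply: eq_Rintegral => x _; rewrite !indicE in_setC.
  by case: (x \in A); rewrite ?subrr ?subr0.
rewrite !indicC in H2; apply/andP; split; lra.
Qed.

Lemma t_mix_le mu pi (c : R) (N : nat) : (TV (mu N) pi <= c%:E)%E ->
  (t_mix mu pi c <= N%:R%:E)%E.
Proof. by move=> H; apply: ereal_inf_lbound; exists N. Qed.

Lemma t_mixP mu pi (c : R) : t_mix mu pi c = +oo%E \/
  exists T : nat, t_mix mu pi c = T%:R%:E /\ (TV (mu T) pi <= c%:E)%E.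
Proof.
have [[k Hk]|H] := pselect (exists k, (TV (mu k) pi <= c%:E)%E); last first.
  left; rewrite /t_mix (_ : [set k | _] = set0) ?image_set0 ?ereal_inf0//.
  by apply/seteqP; split => // k Hk; apply: H; exists k.
right; have ex : exists k, `[< (TV (mu k) pi <= c%:E)%E >] by exists k; exact/asboolP.
have := ex_minnP ex; case=> T /asboolP HT Tmin.
exists T; split => //; apply/eqP; rewrite eq_le t_mix_le//=.
apply: le_ereal_inf_tmp => _ [j Hj <-].
by rewrite lee_fin ler_nat; apply: Tmin; exact/asboolP.
Qed.

Lemma poincare_constant_ge0 m : (0 <= poincare_constant m)%E.
Proof. by apply: le_ereal_inf_tmp => _ [C [C0 _] <-]; rewrite lee_fin. Qed.

(** Avoids showing that the infimum is attained; the slack [e] vanishes at the very end. *)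
Lemma poincare_constant_approx m (c e : R) : poincare_constant m = c%:E -> 0 < e ->
  exists C, [/\ 0 <= C, poincare_inequality m C & C <= c + e].
Proof.
move=> mc e0; apply: contrapT => H.
have : (c%:E < (c + e)%:E)%E by rewrite lte_fin ltrDl.
rewrite -mc ltNge => /negP; apply; apply: le_ereal_inf_tmp => _ [C [C0 pC] <-].
by rewrite lee_fin leNgt; apply/negP => Cc; apply: H; exists C; split => //; exact: ltW.
Qed.

(** The first two terms are homogeneous of degree 1 in the two constants and the last of degree 1/2,
    so a factor [1 + g] on the constants costs at most that factor. *)
Lemma window_scale (K K0 T g : R) : 1 <= K -> 1 <= K0 -> 0 <= T -> 0 < g ->
  forall K' K0', 1 <= K' -> 1 <= K0' -> K' <= (1 + g) * K -> K0' <= (1 + g) * K0 ->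
  K' + Num.sqrt (K' * K0') + Num.sqrt (K' * T) <=
  (1 + g) * (K + Num.sqrt (K * K0) + Num.sqrt (K * T)).
Proof.
move=> K1 K01 T0 g0 K' K0' K'1 K0'1 HK HK0.
have sg : 0 <= (1 + g) by lra.
have sqrtg (x : R) : (1 + g) * Num.sqrt x = Num.sqrt ((1 + g) ^+ 2 * x).
  by rewrite sqrtrM ?sqr_ge0// sqrtr_sqr ger0_norm.
rewrite !mulrDr !sqrtg; apply: lerD; first apply: lerD => //.
- apply: ler_wsqrtr; rewrite expr2 mulrACA; apply: ler_pM => //; lra.
- apply: ler_wsqrtr; rewrite mulrA ler_wpM2r//.
  apply: le_trans HK _; rewrite expr2 -mulrA ler_wpM2l// ler_peMl//; lra.
Qed.

End mixing.

Section mixing_window.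
Context {R : realType} {d : nat}.
Notation E := 'rV[R]_d.
Notation leb := (@lebesgue_rV R d).
Variables (h : {posnum R}) (V : potential R d) (pi : probability E R).
Variables mu nu : nat -> probability E R.
Notation h' := (h%:num).
Notation O := (@zero_potential R d).
Notation P := (proximal_op h V).
Hypothesis piE : forall A, measurable A -> pi A = (\int[leb]_(x in A) (expR (- V x))%:E)%E.
Hypothesis nuE : forall k B, measurable B -> nu k B = (\int[mu k]_x gibbs h O x B)%E.
Hypothesis muE : forall k B, measurable B -> mu k.+1 B = (\int[nu k]_y gibbs h V y B)%E.

(** One step turns an indicator into a function with values in [0, 1] and the same mean under [pi],
    to which [tv_test_function] applies. *)
Lemma TV_decreasing k (c : R) :
  (forall A, measurable A -> \int[pi]_x \1_A x - c <= \int[mu k]_x \1_A x) ->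
  forall A, measurable A -> \int[pi]_x \1_A x - c <= \int[mu k.+1]_x \1_A x.
Proof.
move=> H A mA; have mI : bmeas (\1_A : E -> R) by exact: bmeas_indic.
have ->: k.+1 = (k + 1)%N by rewrite addn1.
rewrite (Rint_chain nuE muE k 1 mI) -(integral_proximal_iter h piE 1 mI).
apply: tv_test_function => //; first exact: bmeas_iter.
- by apply: proximal_iter_ge0 => // u; rewrite indicE ler0n.
- by apply: proximal_iter_le1 => // u; rewrite indicE lern1 leq_b1.
Qed.

Lemma mixing_time_bound (C C0 eps : R) (T : nat) : 0 < eps -> eps < 2^-1 ->
  0 <= C -> 0 <= C0 -> poincare_inequality pi C -> poincare_inequality (mu 0) C0 ->
  (TV (mu T) pi <= (1 - eps)%:E)%E ->
  exists N : nat, (TV (mu N) pi <= eps%:E)%E /\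
    N%:R - T%:R <= 6 / eps * ((1 + C / h') + Num.sqrt ((1 + C / h') * (1 + C0 / h'))
                              + Num.sqrt ((1 + C / h') * T%:R)).
Proof.
move=> e0 e1 C_ge0 C0_ge0 pC pC0 HT.
have K1 : 1 <= 1 + C / h' by rewrite lerDl divr_ge0.
have K01 : 1 <= 1 + C0 / h' by rewrite lerDl divr_ge0.
have [n [m [L [L0 hL hn hN]]]] := window_count T K1 K01 e0 e1.
exists (T.+1 + n.+1 + m)%N; split => //.
apply: indic_le_TV.
(* From [T] to [T.+1], since [window_step] starts from a law of positive index. *)
have Hk := TV_decreasing (TV_le_indic HT).
rewrite (addrC 1) addrK in hn.
exact: (window_step piE nuE muE C_ge0 C0_ge0 e0 e1 pC pC0 L0 Hk hL hn).
Qed.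

End mixing_window.

Local Open Scope ereal_scope.

Theorem theorem1p4 (R : realType) (d : nat) (hd : (0 < d)%N)
  (pi : probability 'rV[R]_d R) (V : 'rV[R]_d -> R)
  (hpi : log_concave_with_potential pi V)
  (mu0 : probability 'rV[R]_d R) (h : R) (hh : (0 < h)%R)
  (dT : measure_display) (T : measurableType dT) (P : probability T R)
  (X Y : nat -> {RV P >-> 'rV[R]_d}) (hXY : proximal_sampler V mu0 h X Y)
  (eps : R) (heps0 : (0 < eps)%R) (heps : (eps < 2^-1)%R) :
  let mu_ (k : nat) : probability 'rV[R]_d R := distribution P (X k) in
  w_mix mu_ pi eps <=
    (6 / eps)%:E *
      (poincare_hat h pi
       + sqrte (poincare_hat h pi * poincare_hat h mu0)
       + sqrte (poincare_hat h pi * t_mix mu_ pi (1 - eps))).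
Proof.
lazy zeta; set mu_ := (X in w_mix X); rewrite /w_mix.
(* If the mixing time for [1 - eps] is infinite, the difference is [-oo] by convention, even when
   both times are infinite. *)
have [->|[t [-> Ht]]] := t_mixP mu_ pi (1 - eps).
  by rewrite /= addeNy leNye.
have hatE (m : probability 'rV[R]_d R) c :
    poincare_constant m = c%:E -> poincare_hat h m = (1 + c / h)%:E.
  by move=> mc; rewrite /poincare_hat mc inver gt_eqF// -EFinM -EFinD.
have hat_oo (m : probability 'rV[R]_d R) : poincare_constant m = +oo -> poincare_hat h m = +oo.
  by move=> mc; rewrite /poincare_hat mc inver gt_eqF// gt0_mulye ?addey// lte_fin invr_gt0.
have sqrteN (x : \bar R) : sqrte x != -oo by case: x.
have hat_ge1 c : (0 <= c)%R -> (1 <= 1 + c / h)%R.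
  by move=> c0; rewrite lerDl divr_ge0// ltW.
have e6 : 0 < (6 / eps)%:E by rewrite lte_fin divr_gt0.
(* An infinite Poincare constant, here or for [mu0] below, makes the right-hand side [+oo]. *)
have := poincare_constant_ge0 pi; case Epi: (poincare_constant pi) => [c||]// c0; last first.
  by rewrite (hat_oo _ Epi) !addye ?sqrteN// gt0_muley// leey.
rewrite lee_fin in c0; have K1 := hat_ge1 _ c0; rewrite (hatE _ _ Epi).
set K := (1 + c / h)%R in K1 *; have K0 : (0 < K)%R by apply: lt_le_trans K1.
have := poincare_constant_ge0 mu0; case Emu: (poincare_constant mu0) => [b||]// b0; last first.
  rewrite (hat_oo _ Emu) gt0_muley ?lte_fin//= addey// addye ?sqrteN//.
  by rewrite gt0_muley// leey.
rewrite lee_fin in b0; have K01 := hat_ge1 _ b0; rewrite (hatE _ _ Emu).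
set K' := (1 + b / h)%R in K01 *.
pose F := (K + Num.sqrt (K * K') + Num.sqrt (K * t%:R))%R.
rewrite [leRHS](_ : _ = (6 / eps * F)%:E); last by rewrite -!EFinM.
have F0 : (0 <= 6 / eps * F)%R.
  apply: mulr_ge0; first by rewrite divr_ge0// ltW.
  by apply: addr_ge0; [apply: addr_ge0; [exact: ltW|]|]; exact: sqrtr_ge0.
(* Admissible constants near the two infima give the bound up to a factor [1 + g], which then tends
   to 1. *)
have bound (g : R) : (0 < g)%R -> t_mix mu_ pi eps - t%:R%:E <= ((1 + g) * (6 / eps * F))%:E.
  move=> g0; pose hp := PosNum hh; pose Vp := log_concave_potential hpi.
  have near (m : probability 'rV[R]_d R) a :
      poincare_constant m = a%:E -> (0 <= a)%R -> exists C, [/\ (0 <= C)%R,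
      poincare_inequality m C & (1 + C / h <= (1 + g) * (1 + a / h))%R].
    (* An additive slack [g * h] becomes [g] after division by [h], hence a relative error of at
       most [g] because [1 + a / h] is at least 1. *)
    move=> ma a0; have [C [C0 pC Ca]] := poincare_constant_approx ma (mulr_gt0 g0 hh).
    exists C; split => //.
    have -> : ((1 + g) * (1 + a / h) = 1 + (a + g * h) / h + g * (a / h))%R.
      by field; rewrite gt_eqF.
    rewrite -[leLHS]addr0; apply: lerD; last by rewrite mulr_ge0 ?divr_ge0// ltW.
    by rewrite lerD2l ler_pM2r ?invr_gt0.
  have [C [C0 pC CK]] := near _ _ Epi c0; have [B [B0 pB BK]] := near _ _ Emu b0.
  have [H0 _ _] := hXY.
  have pB' : poincare_inequality (mu_ 0%N) B.
    by apply: eq_poincare pB => A mA; exact/esym/H0.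
  have piE : forall A, measurable A ->
      pi A = \int[lebesgue_rV d]_(x in A) (expR (- Vp x))%:E by have [] := hpi.
  have sXY : proximal_sampler Vp mu0 hp%:num X Y := hXY.
  pose nu_ k : probability 'rV[R]_d R := distribution P (Y k).
  have [N [TVN HN]] := @mixing_time_bound R d hp Vp pi mu_ nu_ piE
    (fun k B mB => distribution_forward sXY k mB)
    (fun k B mB => distribution_backward sXY k mB) C B eps t heps0 heps C0 B0 pC pB' Ht.
  apply: le_trans (leeB (t_mix_le TVN) (lexx _)) _; rewrite -EFinB lee_fin.
  apply: le_trans HN _; rewrite mulrCA ler_pM2l ?divr_gt0//.
  by apply: window_scale => //; exact: hat_ge1.
apply/lee_addgt0Pr => e e0.
pose g := (e / (6 / eps * F + 1))%R.
have F1 : (0 < 6 / eps * F + 1)%R by rewrite ltr_wpDl.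
apply: le_trans (bound g (divr_gt0 e0 F1)) _.
rewrite -EFinD lee_fin mulrDl mul1r lerD2l /g mulrAC ler_pdivrMr// ler_wpM2l ?(ltW e0)//.
by rewrite lerDl.
Qed.
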